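(* Let $n\ge 2$, $q>1$, $\nu\in(0,1)\cap(0,q-1)$, $p=2(q-\nu)/(q-1)$, and let $Lu=\sum_{i,j=1}^n (a_{ij}(x)u_{x_i})_{x_j}$ be a differential operator on $\mathbb{R}^n$ whose coefficients are measurable and locally bounded, symmetric ($a_{ij}=a_{ji}$), and satisfy $\sum_{i,j=1}^n a_{ij}(x)\xi_i\xi_j\ge 0$ for all $\xi\in\mathbb{R}^n$ and almost all $x\in\mathbb{R}^n$. Assume that $$\liminf_{R\to\infty}\ \mathrm{cap}_{L,p}\big(\overline{\mathcal B}_{R/2},\mathbb{R}^n\setminus\mathcal B_R;\mathbb{R}^n\big)<\infty .$$ Let $(u,v)$ be an entire solution in $\mathbb{R}^n$ of the inequality $Lu+|u|^{q-1}u\le Lv+|v|^{q-1}v$ such that $u\ge v$ a.e. in $\mathbb{R}^n$. Then $u=v$ a.e. in $\mathbb{R}^n$.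
   Context: $\mathcal B_r=\{x\in\mathbb{R}^n:|x|<r\}$ and $\overline{\mathcal B}_r=\{x:|x|\le r\}$. Capacity. For $p>1$ and disjoint closed sets $\mathcal D,\mathcal G\subset\mathbb{R}^n$, $$\mathrm{cap}_{L,p}(\mathcal D,\mathcal G;\mathbb{R}^n)=\inf_\varphi\int_{\mathbb{R}^n}\Big(\sum_{i,j=1}^n a_{ij}\varphi_{x_i}\varphi_{x_j}\Big)^{p/2}dx,$$ the infimum being over all functions $\varphi$ on $\mathbb{R}^n$ that are Lipschitz on every compact set and satisfy $\varphi=1$ on $\mathcal D$, $\varphi=0$ on $\mathcal G$, $0\le\varphi\le1$ on $\mathbb{R}^n$. Function space. Put $\hat q=\max\{1,q\}$. For a bounded domain $\mathcal Q\subset\mathbb{R}^n$, $W^{L,q}(\mathcal Q)$ is the completion of $C^\infty(\mathcal Q)$ (functions of finite norm) with respect to $$\|f\|_{W^{L,q}(\mathcal Q)}=\Big(\int_{\mathcal Q}\sum_{i,j=1}^n a_{ij}f_{x_i}f_{x_j}\,dx\Big)^{1/2}+\Big(\int_{\mathcal Q}|f|^{\hat q}dx\Big)^{1/\hat q}.$$ $W^{L,q}_{\rm loc}(\mathbb{R}^n)$ consists of all $f$ that belong to $W^{L,q}(\mathcal Q)$ for every bounded domain $\mathcal Q$. With $a=(a_{ij})$, if $f_k\in C^\infty(\mathcal Q)$ converge to $f$ in this completion, then $a^{1/2}\nabla f_k$ converges in $L^2(\mathcal Q)$; the limit, denoted $a^{1/2}\nabla f$, is part of the data of $f$ (consistently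 for different $\mathcal Q$), and $\sum_{i,j} a_{ij}f_{x_i}\zeta_{x_j}$ means $(a^{1/2}\nabla f)\cdot(a^{1/2}\nabla\zeta)$. Entire solution. A pair $(u,v)$ is an entire solution of $Lu+|u|^{q-1}u\le Lv+|v|^{q-1}v$ in $\mathbb{R}^n$ if $u,v\in W^{L,q}_{\rm loc}(\mathbb{R}^n)$ and $$\int_{\mathbb{R}^n}\Big(\sum_{i,j=1}^n a_{ij}u_{x_i}\zeta_{x_j}-|u|^{q-1}u\,\zeta\Big)dx\ \ge\ \int_{\mathbb{R}^n}\Big(\sum_{i,j=1}^n a_{ij}v_{x_i}\zeta_{x_j}-|v|^{q-1}v\,\zeta\Big)dx$$ for every non-negative $\zeta\in C^\infty(\mathbb{R}^n)$ with compact support. *)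

(* Defs.v *)
(* MathComp-Analysis, over an arbitrary realType; R^n is 'rV[R]_n. *)
From HB Require Import structures.
From mathcomp Require Import all_boot all_order all_algebra.
From mathcomp Require Import all_classical all_reals all_analysis.
Set Implicit Arguments.
Unset Strict Implicit.
Unset Printing Implicit Defensive.
Import Order.TTheory GRing.Theory Num.Theory.
Import numFieldNormedType.Exports.
Local Open Scope classical_set_scope.
Local Open Scope ring_scope.

Section borel_rV.
Context {R : realType} {n : nat}.

Definition rV_coord (i : 'I_n) (x : 'rV[R]_n) : measurableTypeR R := x ord0 i.

Let set0_mes : g_sigma_preimage rV_coord set0.
Proof. exact: sigma_algebra0. Qed.

Let setC_mes A : g_sigma_preimage rV_coord A -> g_sigma_preimage rV_coord (~` A).
Proof. exact: sigma_algebraC. Qed.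

Let bigcup_mes (F : (set 'rV[R]_n)^nat) :
  (forall i, g_sigma_preimage rV_coord (F i)) ->
  g_sigma_preimage rV_coord (\bigcup_i F i).
Proof. exact: sigma_algebra_bigcup. Qed.

(* The product sigma-algebra, i.e. the Borel sets of 'rV[R]_n. *)
HB.instance Definition _ := @isMeasurable.Build default_measure_display
  'rV[R]_n (g_sigma_preimage rV_coord) set0_mes setC_mes bigcup_mes.

Lemma measurable_rV_coord i : measurable_fun [set: 'rV[R]_n] (rV_coord i).
Proof.
move=> _ Y mY; rewrite setTI; apply: sub_sigma_algebra => /=.
rewrite -bigcup_seq/=; exists i => /=; first by rewrite mem_index_enum.
by exists Y => //; rewrite setTI.
Qed.

Lemma measurable_fun_rV d (T : measurableType d) (f : T -> 'rV[R]_n) :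
  (forall i, measurable_fun [set: T] (rV_coord i \o f)) ->
  measurable_fun [set: T] f.
Proof.
move=> mf _ A mA; rewrite setTI.
suff : g_sigma_preimage rV_coord `<=` [set B | measurable (f @^-1` B)].
  by apply.
apply: smallest_sub.
  split; rewrite /=.
  - by rewrite preimage_set0.
  - by move=> B mB; rewrite setTD preimage_setC; exact: measurableC.
  - by move=> F mF; rewrite preimage_bigcup; exact: bigcupT_measurable.
rewrite -bigcup_seq/=; apply: bigcup_sub => i _ B [C mC <-] /=.
by rewrite setTI -comp_preimage -[X in measurable X]setTI; exact: mf.
Qed.

End borel_rV.

Section lebesgue_borel.
Context {R : realType}.

Definition rV_cons n (t : measurableTypeR R * 'rV[R]_n) : 'rV[R]_n.+1 :=
  row_mx (const_mx t.1 : 'rV_1) t.2.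

Definition rV_uncons n (x : 'rV[R]_n.+1) : measurableTypeR R * 'rV[R]_n :=
  (x ord0 ord0, rsubmx (x : 'rV_(1 + n))).

Lemma rV_consK n : cancel (@rV_cons n) (@rV_uncons n).
Proof.
case=> t x; rewrite /rV_cons /rV_uncons /= row_mxKr; congr pair.
have E := row_mxEl (const_mx t : 'rV_1) x ord0 ord0; rewrite [RHS]mxE in E.
by rewrite -[RHS]E; congr (fun_of_matrix _ ord0 _); exact: val_inj.
Qed.

Lemma measurable_rV_cons n : measurable_fun setT (@rV_cons n).
Proof.
apply: measurable_fun_rV => i; rewrite -[i]/(i : 'I_(1 + n)).
case: (split_ordP (i : 'I_(1 + n))) => j ->.
- rewrite (_ : _ \o _ = fst); first exact: measurable_fst.
  by apply/funext => -[t x]; exact: etrans (row_mxEl _ _ _ _) (mxE _ _ _ _).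
- rewrite (_ : _ \o _ = rV_coord j \o snd).
    exact: (measurableT_comp (measurable_rV_coord j) measurable_snd).
  by apply/funext => -[t x]; exact: row_mxEr.
Qed.

Lemma measurable_rV_uncons n : measurable_fun setT (@rV_uncons n).
Proof.
apply/measurable_fun_pairP; split; first exact: measurable_rV_coord.
apply: measurable_fun_rV => i.
rewrite (_ : _ \o _ = rV_coord (rshift 1 i)); first exact: measurable_rV_coord.
by apply/funext => x; exact: mxE.
Qed.

Section step.
Variables (n : nat) (mu : {sigma_finite_measure set 'rV[R]_n -> \bar R}).

Definition lebesgue_borel_step : set 'rV[R]_n.+1 -> \bar R :=
  pushforward (lebesgue_measure \x mu)%E (@rV_cons n).

Let step0 : lebesgue_borel_step set0 = 0%E.
Proof. by rewrite /lebesgue_borel_step /pushforward preimage_set0 measure0. Qed.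

Let step_ge0 A : (0 <= lebesgue_borel_step A)%E.
Proof. by apply: integral_ge0 => x _; exact: measure_ge0. Qed.

Let step_sigma_additive : semi_sigma_additive lebesgue_borel_step.
Proof.
move=> F mF tF mUF; rewrite /lebesgue_borel_step /pushforward preimage_bigcup.
have mc A : measurable A -> measurable (@rV_cons n @^-1` A).
  by move=> mA; rewrite -[X in measurable X]setTI; exact: measurable_rV_cons.
apply: measure_semi_sigma_additive.
- by move=> k; exact: mc.
- apply/trivIsetP => /= i j _ _ ij; rewrite -preimage_setI.
  by move/trivIsetP : tF => /(_ _ _ _ _ ij) ->//; rewrite preimage_set0.
- by rewrite -preimage_bigcup; exact: mc.
Qed.

HB.instance Definition _ := isMeasure.Build _ _ _ lebesgue_borel_step
  step0 step_ge0 step_sigma_additive.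

Let lebesgue_borel_step_sigma_finite : sigma_finite setT lebesgue_borel_step.
Proof.
have /sigma_finiteP[F [TF ndF Foo]] := sigma_finiteT (@lebesgue_measure R).
have /sigma_finiteP[G [TG ndG Goo]] := sigma_finiteT mu.
exists (fun k => @rV_uncons n @^-1` (F k `*` G k)).
  rewrite -preimage_bigcup -(preimage_setT (@rV_uncons n)); congr (_ @^-1` _).
  rewrite -setXTT TF TG predeqE => -[x y]; split.
    move=> [/= [i _ Fix] [k _ Gky]]; exists (maxn i k) => //; split.
    - by move: x Fix; exact/subsetPset/ndF/leq_maxl.
    - by move: y Gky; exact/subsetPset/ndG/leq_maxr.
  by move=> [i _ []/= ? ?]; split; exists i.
move=> k; have [mFk Fk] := Foo k; have [mGk Gk] := Goo k; split.
  rewrite -[X in measurable X]setTI; apply: measurable_rV_uncons => //.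
  exact: measurableX.
rewrite /lebesgue_borel_step /pushforward -comp_preimage.
rewrite (_ : _ \o _ = id); last by apply/funext => x; exact: rV_consK.
by rewrite preimage_id product_measure1E// lte_mul_pinfty// ge0_fin_numE.
Qed.

HB.instance Definition _ := Measure_isSigmaFinite.Build _ _ _
  lebesgue_borel_step lebesgue_borel_step_sigma_finite.

End step.

(* Iterated product of the one-dimensional Lebesgue measure. *)
Fixpoint lebesgue_borel n : {sigma_finite_measure set 'rV[R]_n -> \bar R} :=
  if n is m.+1 then lebesgue_borel_step (lebesgue_borel m)
  else \d_(0 : 'rV[R]_0).

End lebesgue_borel.
Arguments lebesgue_borel R n : clear implicits.

(* R^n with the Lebesgue sigma-algebra, i.e. the completion of the Borel one. *)
Notation lebesgue_rVType R n :=
  (caratheodory_type (mu_ext (lebesgue_borel R n))).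

Definition lebesgue_rV (R : realType) (n : nat) :
    set (lebesgue_rVType R n) -> \bar R :=
  @completed_measure_extension _ _ _ (lebesgue_borel R n).
HB.instance Definition _ (R : realType) (n : nat) :=
  Measure.on (@lebesgue_rV R n).
Arguments lebesgue_rV R n : clear implicits.

Definition lebesgue_measurable_fun (R : realType) (n : nat)
    (Q : set 'rV[R]_n) (f : 'rV[R]_n -> R) :=
  measurable_fun (Q : set (lebesgue_rVType R n))
    (f : lebesgue_rVType R n -> measurableTypeR R).

Section euclidean_space.
Context {R : realType} {n : nat}.
Implicit Types (x y : 'rV[R]_n) (f : 'rV[R]_n -> R).

Definition dot x y : R := \sum_(i < n) x ord0 i * y ord0 i.

(* The library norm on 'rV is the sup norm; balls below are Euclidean. *)
Definition enorm x : R := Num.sqrt (dot x x).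

Definition eball (r : R) : set 'rV[R]_n := [set x | enorm x < r].
Definition closed_eball (r : R) : set 'rV[R]_n := [set x | enorm x <= r].

Definition unit_rV (i : 'I_n) : 'rV[R]_n := delta_mx ord0 i.

Definition partial (i : 'I_n) f : 'rV[R]_n -> R := fun x => 'D_(unit_rV i) f x.

Definition grad f x : 'rV[R]_n := \row_(i < n) partial i f x.

Definition iter_partial (s : seq 'I_n) f : 'rV[R]_n -> R := foldr partial f s.

(* f is C^oo on the open set Q; its values outside Q are irrelevant. *)
Definition smooth_on (Q : set 'rV[R]_n) f :=
  forall s x, Q x ->
    {for x, continuous (iter_partial s f)} /\
    forall i, derivable (iter_partial s f) x (unit_rV i).

Definition compactly_supported f := compact (closure [set x | f x != 0]).

Definition bounded_domain (Q : set 'rV[R]_n) :=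
  [/\ Q !=set0, open Q, connected Q & bounded_set Q].

End euclidean_space.

Section operator.
Context {R : realType} {n : nat} (a : 'rV[R]_n -> 'M[R]_n).
Implicit Types (f h : 'rV[R]_n -> R) (F : 'rV[R]_n -> 'rV[R]_n).

Definition quad_form (A : 'M[R]_n) (xi eta : 'rV[R]_n) : R :=
  \sum_(i < n) \sum_(j < n) A i j * xi ord0 i * eta ord0 j.

(* The positive semidefinite square root (junk 0 if there is none). *)
Definition psd_sqrt (A : 'M[R]_n) : 'M[R]_n :=
  xget 0 [set B | [/\ B^T = B, forall xi, 0 <= quad_form B xi xi
                    & B *m B = A]].

(* a^{1/2} grad f for differentiable f, as a row vector (a^{1/2} being
   symmetric, the side on which it multiplies does not matter). *)
Definition sqrt_grad f (x : 'rV[R]_n) : 'rV[R]_n :=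
  grad f x *m psd_sqrt (a x).

(* The partial derivatives of a locally Lipschitz phi exist almost everywhere;
   'D_v is total, so the integrand is defined at the exceptional points too. *)
Definition capacity (p : R) (D G : set 'rV[R]_n) : \bar R :=
  ereal_inf [set (\int[lebesgue_rV R n]_x
      ((quad_form (a x) (grad phi x) (grad phi x)) `^ (p / 2))%:E)%E
    | phi in [set phi : 'rV[R]_n -> R |
        [/\ forall K, compact K -> [lipschitz phi x | x in K],
            forall x, D x -> phi x = 1,
            forall x, G x -> phi x = 0 &
            forall x, 0 <= phi x <= 1]]].

Definition qhat (q : R) : R := Num.max 1 q.

Local Open Scope ereal_scope.

(* L^2 norm on Q of F plus L^qhat norm on Q of f. *)
Definition WL_pair_norm (q : R) (Q : set 'rV[R]_n) f F : \bar R :=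
  (\int[lebesgue_rV R n]_(x in Q) (dot (F x) (F x))%:E) `^ 2^-1 +
  (\int[lebesgue_rV R n]_(x in Q) (`|f x| `^ (qhat q))%:E) `^ (qhat q)^-1.

Definition WL_norm (q : R) (Q : set 'rV[R]_n) f : \bar R :=
  (\int[lebesgue_rV R n]_(x in Q)
     (quad_form (a x) (grad f x) (grad f x))%:E) `^ 2^-1 +
  (\int[lebesgue_rV R n]_(x in Q) (`|f x| `^ (qhat q))%:E) `^ (qhat q)^-1.

(* Since |a^{1/2} grad f|^2 = sum a_ij f_i f_j, f |-> (f, a^{1/2} grad f) is
   isometric from the smooth functions of finite norm into the complete space
   L^qhat(Q) x L^2(Q)^n, so that the completion is the closure of its image.
   An element of W^{L,q}(Q) is thus a pair (f, F), and F, which f need not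
   determine, is what is denoted a^{1/2} grad f. *)
Definition in_WL (q : R) (Q : set 'rV[R]_n) f F :=
  [/\ lebesgue_measurable_fun Q f,
      forall i, lebesgue_measurable_fun Q (fun x => F x ord0 i) &
      exists fk : ('rV[R]_n -> R)^nat,
        (forall k, smooth_on Q (fk k) /\ WL_norm q Q (fk k) < +oo) /\
        WL_pair_norm q Q (fun x => fk k x - f x)%R
          (fun x => sqrt_grad (fk k) x - F x)%R @[k --> \oo] --> 0].

Definition in_WL_loc (q : R) f F :=
  forall Q, bounded_domain Q -> in_WL q Q f F.

(* The functional int (sum a_ij f_i zeta_j - |f|^(q-1) f zeta) dx. *)
Definition weak_form (q : R) f F (zeta : 'rV[R]_n -> R) : \bar R :=
  \int[lebesgue_rV R n]_x
    (dot (F x) (sqrt_grad zeta x) - `|f x| `^ (q - 1) * f x * zeta x)%:E.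

(* (u, v), with the accompanying U = a^{1/2} grad u and V = a^{1/2} grad v, is
   an entire solution of L u + |u|^(q-1) u <= L v + |v|^(q-1) v. *)
Definition entire_solution (q : R) u U v V :=
  [/\ in_WL_loc q u U, in_WL_loc q v V &
      forall zeta, smooth_on setT zeta -> compactly_supported zeta ->
        (forall x, 0 <= zeta x)%R ->
        weak_form q u U zeta >= weak_form q v V zeta].

End operator.

(* Main.v *)
(* Write w = u - v >= 0 and c = 2^-q, so that |u|^(q-1) u - |v|^(q-1) v >= c w^q.
   For a Lipschitz cut-off phi with compact support the inequality is tested with
   phi^s g(w), where g is a bounded smooth substitute for w^(-nu). The gradient
   falling on g has a good sign; by AM-GM it absorbs the cross term, and letting g
   tend to w^(-nu) one gets
     c int phi^s w^(q-nu) <= s^2/(2 nu) int phi^(s-2) w^(1-nu) |a^{1/2} grad phi|^2.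
   Interpolating the right-hand side between int phi^s w^(q-nu) and
   int |a^{1/2} grad phi|^p, with competitors phi for the capacity, first bounds
   int w^(q-nu) over all balls. In a second pass grad phi = 0 on a large ball, so
   only the tail of the convergent integral int w^(q-nu) enters the right-hand
   side, and the coefficient of the capacity can be made arbitrarily small: hence
   int w^(q-nu) = 0.

   Only smooth test functions are admitted, while u and v have no gradients but
   merely limits U and V of a^{1/2} grad u_k and a^{1/2} grad v_k. The function w
   is therefore replaced by w_k = u_k - v_k in the test function, and phi by
   smooth functions converging uniformly whose partial derivatives stay bounded
   and converge weakly to those of phi. As a is degenerate, U - V may be nonzero
   where w = 0, which is why g must be decreasing up to w = 0. *)
Require Import Defs.
From HB Require Import structures.
From mathcomp Require Import all_boot all_order all_algebra.
From mathcomp Require Import all_classical all_reals all_analysis.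
From mathcomp Require Import measurable_realfun ring lra.
Set Implicit Arguments.
Unset Strict Implicit.
Unset Printing Implicit Defensive.
Import Order.TTheory GRing.Theory Num.Theory.
Import numFieldNormedType.Exports.
Local Open Scope classical_set_scope.
Local Open Scope ring_scope.

(** * The positive semidefinite square root *)

(** The order of the limits is forced. While [eps] and a smooth cut-off are fixed, the approximants
    w_k enter only through the test function, and U - V stays in the other slot of the bilinear
    term; with one factor fixed in L^2, that term converges although g'(w_k) is merely bounded and
    convergent almost everywhere. The tested inequality is then linear in the cut-off and its
    partial derivatives, with integrable coefficients, which is why weak convergence of the partial
    derivatives suffices to reach Lipschitz cut-offs. AM-GM, quadratic in the gradient of the
    cut-off, can only come after that, and [eps] tends to 0 last. The exponent p is the one for
    which Hoelder's inequality with weight th = (1 - nu) / (q - nu) on w^(q - nu) leaves |a^{1/2}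
    grad phi|^p as the conjugate factor; the power s of the cut-off must exceed 2 and be at least p.
    The root a^{1/2} is given pointwise by a choice, so that its measurability has to be proved:
    explicit iterates in the entries of a converge to it. *)

Section dot_product.
Context {R : realType} {n : nat}.
Implicit Types (x y z : 'rV[R]_n) (A B M : 'M[R]_n) (c : R).

Lemma dotC x y : dot x y = dot y x.
Proof. by apply: eq_bigr => i _; rewrite mulrC. Qed.

Lemma dotDl x y z : dot (x + y) z = dot x z + dot y z.
Proof. by rewrite -big_split; apply: eq_bigr => i _; rewrite mxE mulrDl. Qed.

Lemma dotZl c x y : dot (c *: x) y = c * dot x y.
Proof. by rewrite /dot mulr_sumr; apply: eq_bigr => i _; rewrite mxE mulrA. Qed.

Lemma dotNl x y : dot (- x) y = - dot x y.
Proof. by rewrite -scaleN1r dotZl mulN1r. Qed.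

Lemma dotBl x y z : dot (x - y) z = dot x z - dot y z.
Proof. by rewrite dotDl dotNl. Qed.

Lemma dotDr x y z : dot x (y + z) = dot x y + dot x z.
Proof. by rewrite dotC dotDl dotC (dotC z). Qed.

Lemma dotZr c x y : dot x (c *: y) = c * dot x y.
Proof. by rewrite dotC dotZl dotC. Qed.

Lemma dotBr x y z : dot x (y - z) = dot x y - dot x z.
Proof. by rewrite dotC dotBl dotC (dotC z). Qed.

Lemma dot0l x : dot 0 x = 0.
Proof. by rewrite -(scale0r (0 : 'rV[R]_n)) dotZl mul0r. Qed.

Lemma dot0r x : dot x 0 = 0.
Proof. by rewrite dotC dot0l. Qed.

Lemma dot_ge0 x : 0 <= dot x x.
Proof. by apply: sumr_ge0 => i _; rewrite -expr2 sqr_ge0. Qed.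

Lemma dot_eq0 x : dot x x = 0 -> x = 0.
Proof.
move=> /psumr_eq0P h; apply/rowP => i; rewrite mxE.
apply/eqP; rewrite -sqrf_eq0 expr2; apply/eqP/h => // j _.
by rewrite -expr2 sqr_ge0.
Qed.

Lemma dotE x y : dot x y = (x *m y^T) ord0 ord0.
Proof. by rewrite mxE; apply: eq_bigr => i _; rewrite mxE. Qed.

Lemma dot_mulmx x M y : dot (x *m M) y = dot x (y *m M^T).
Proof. by rewrite !dotE trmx_mul trmxK mulmxA. Qed.

Lemma quad_formE A x y : quad_form A x y = dot (x *m A) y.
Proof.
rewrite /quad_form /dot exchange_big; apply: eq_bigr => j _.
by rewrite mxE mulr_suml; apply: eq_bigr => i _; rewrite [A i j * _]mulrC.
Qed.

Lemma dot_unit x i : dot x (unit_rV i) = x ord0 i.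
Proof.
rewrite /dot (bigD1 i)//= big1 ?addr0 => [|j ji]; first by rewrite mxE !eqxx mulr1.
by rewrite mxE eqxx (negbTE ji) mulr0.
Qed.

Lemma unit_mulmx M i j : (unit_rV i *m M) ord0 j = M i j.
Proof. by rewrite -rowE mxE. Qed.

(** The case c = 0 is kept because the forms to which this applies may be degenerate; the polynomial
    is then affine and forces b = 0. *)
Lemma discriminant_le (a b c : R) : 0 <= c ->
  (forall t, 0 <= a + 2 * b * t + c * t ^+ 2) -> b ^+ 2 <= a * c.
Proof.
rewrite le_eqVlt => /predU1P[<- h|c0 h].
  rewrite mulr0; have [->|b0] := eqVneq b 0; first by rewrite expr0n.
  (* At this t the affine function takes the value -1. *)
  have := h (- (a + 1) / (2 * b)).
  rewrite mul0r addr0 mulrCA divff ?mulr1; last by rewrite mulf_neq0// pnatr_eq0.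
  by lra.
have := h (- b / c).
rewrite (_ : a + _ + _ = (a * c - b ^+ 2) / c); last by field; rewrite gt_eqF.
by rewrite pmulr_lge0 ?invr_gt0// subr_ge0.
Qed.

Definition psd A := A^T = A /\ forall x, 0 <= dot (x *m A) x.

Lemma psd_cauchy_schwarz A x y : psd A ->
  (dot (x *m A) y) ^+ 2 <= dot (x *m A) x * dot (y *m A) y.
Proof.
move=> [sA pA]; apply: discriminant_le => [//|t].
have := pA (x + t *: y); rewrite mulmxDl -scalemxAl !(dotDl, dotDr, dotZl, dotZr).
rewrite (_ : dot (y *m A) x = dot (x *m A) y); first by lra.
by rewrite dot_mulmx sA dotC.
Qed.

Lemma psd1 : psd 1%:M.
Proof. by split=> [|x]; rewrite ?trmx1// mulmx1 dot_ge0. Qed.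

Lemma cauchy_schwarz x y : dot x y ^+ 2 <= dot x x * dot y y.
Proof. by have := psd_cauchy_schwarz x y psd1; rewrite !mulmx1. Qed.

Lemma enorm_ge0 x : 0 <= enorm x.
Proof. exact: sqrtr_ge0. Qed.

Lemma enorm_sqr x : enorm x ^+ 2 = dot x x.
Proof. by rewrite sqr_sqrtr// dot_ge0. Qed.

Lemma normr_dot_le x y : `|dot x y| <= enorm x * enorm y.
Proof.
rewrite -(@ler_pXn2r _ 2)// ?nnegrE ?mulr_ge0 ?enorm_ge0//.
by rewrite exprMn !enorm_sqr real_normK ?num_real// cauchy_schwarz.
Qed.

Lemma enormD x y : enorm (x + y) <= enorm x + enorm y.
Proof.
rewrite -(@ler_pXn2r _ 2)// ?nnegrE ?addr_ge0 ?enorm_ge0//.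
rewrite sqrrD !enorm_sqr dotDl !dotDr (dotC y x).
have := le_trans (ler_norm _) (normr_dot_le x y); rewrite mulr2n; lra.
Qed.

Lemma enormZ c x : enorm (c *: x) = `|c| * enorm x.
Proof.
by rewrite /enorm dotZl dotZr mulrA -expr2 sqrtrM ?sqr_ge0// sqrtr_sqr.
Qed.

Lemma enorm_unit i : enorm (unit_rV i : 'rV[R]_n) = 1.
Proof. by rewrite /enorm dot_unit mxE !eqxx sqrtr1. Qed.

Lemma coord_le_enorm x i : `|x ord0 i| <= enorm x.
Proof.
by rewrite -dot_unit; apply: le_trans (normr_dot_le _ _) _; rewrite enorm_unit mulr1.
Qed.

End dot_product.

(* Riesz-Nagy iteration: for 0 <= Z <= 1, Y_(k+1) = (Z + Y_k^2) / 2 converges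
   to 1 - (1 - Z)^(1/2). *)
Section riesz_nagy.
Context {R : realType} {n : nat}.
Implicit Types (x y : 'rV[R]_n) (A B C Z M N : 'M[R]_n) (r s c : R).

Fixpoint rn_mx Z k : 'M[R]_n :=
  if k is j.+1 then 2^-1 *: (Z + rn_mx Z j *m rn_mx Z j) else 0.

(** The same iteration for the scalar Z = 1; its value is the sum of the coefficients of [rn_mx Z k]
    as a polynomial in Z. *)
Fixpoint rn_real k : R := if k is j.+1 then 2^-1 * (1 + rn_real j ^+ 2) else 0.

(* M is a polynomial in Z with nonnegative coefficients of sum r. *)
Inductive nonneg_poly Z : 'M[R]_n -> R -> Prop :=
| np_var : nonneg_poly Z Z 1
| np_zero : nonneg_poly Z 0 0
| np_add M N r s : nonneg_poly Z M r -> nonneg_poly Z N s ->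
    nonneg_poly Z (M + N) (r + s)
| np_mul M N r s : nonneg_poly Z M r -> nonneg_poly Z N s ->
    nonneg_poly Z (M *m N) (r * s)
| np_scale M c r : 0 <= c -> nonneg_poly Z M r -> nonneg_poly Z (c *: M) (c * r).

Lemma nonneg_poly_ge0 Z M r : nonneg_poly Z M r -> 0 <= r.
Proof.
elim=> // [_ _ ? ? _ ? _ ?|_ _ ? ? _ ? _ ?|_ ? ? ? _ ?].
- exact: addr_ge0.
- exact: mulr_ge0.
- exact: mulr_ge0.
Qed.

Lemma nonneg_poly_comm Z M r C : nonneg_poly Z M r ->
  C *m Z = Z *m C -> C *m M = M *m C.
Proof.
move=> + CZ; elim=> // [|? ? ? ? _ IH1 _ IH2|? ? ? ? _ IH1 _ IH2|? ? ? ? _ IH].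
- by rewrite mulmx0 mul0mx.
- by rewrite mulmxDr mulmxDl IH1 IH2.
- by rewrite mulmxA IH1 -mulmxA IH2 mulmxA.
- by rewrite -scalemxAr IH scalemxAl.
Qed.

Lemma nonneg_poly_comm2 Z M N r s : nonneg_poly Z M r -> nonneg_poly Z N s ->
  M *m N = N *m M.
Proof.
move=> HM HN; apply: (nonneg_poly_comm HN); apply/esym.
exact: (nonneg_poly_comm HM).
Qed.

Lemma nonneg_poly_sym Z M r : Z^T = Z -> nonneg_poly Z M r -> M^T = M.
Proof.
move=> ZT; elim=> // [|? ? ? ? _ IH1 _ IH2|? ? ? ? H1 IH1 H2 IH2|? ? ? ? _ IH].
- by rewrite trmx0.
- by rewrite linearD/= IH1 IH2.
- by rewrite trmx_mul IH1 IH2 (nonneg_poly_comm2 H1 H2).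
- by rewrite linearZ/= IH.
Qed.

Lemma rn_mxS Z k : rn_mx Z k.+1 = 2^-1 *: (Z + rn_mx Z k *m rn_mx Z k).
Proof. by []. Qed.

Lemma rn_realS k : rn_real k.+1 = 2^-1 * (1 + rn_real k ^+ 2).
Proof. by []. Qed.

Lemma rn_nonneg_poly Z k : nonneg_poly Z (rn_mx Z k) (rn_real k).
Proof.
elim: k => [|k IH]; first exact: np_zero.
apply: np_scale; first by rewrite invr_ge0.
by apply: np_add; [exact: np_var|rewrite expr2; exact: np_mul].
Qed.

(** All iterates commute, so the next increment is half the product of the last increment and the
    sum of the last two iterates: nonnegative coefficients persist. The increments of the matrices
    are thereby dominated by those of [rn_real]. *)
Lemma rn_diff_nonneg_poly Z k :
  nonneg_poly Z (rn_mx Z k.+1 - rn_mx Z k) (rn_real k.+1 - rn_real k).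
Proof.
elim: k => [|k IH]; first by rewrite !subr0; exact: rn_nonneg_poly.
rewrite (rn_mxS Z k.+1) (rn_realS k.+1).
set Y1 := rn_mx Z k.+1 in IH *; set y1 := rn_real k.+1 in IH *.
rewrite {2}/Y1 {2}/y1 rn_mxS rn_realS.
set Y0 := rn_mx Z k in IH *; set y0 := rn_real k in IH *.
have -> : 2^-1 *: (Z + Y1 *m Y1) - 2^-1 *: (Z + Y0 *m Y0) =
    2^-1 *: ((Y1 - Y0) *m (Y1 + Y0)).
  rewrite -scalerBr mulmxDr !mulmxBl; congr (_ *: _).
  rewrite (nonneg_poly_comm2 (rn_nonneg_poly Z k) (rn_nonneg_poly Z k.+1)).
  by rewrite -/Y0 -/Y1 addrA subrK opprD addrACA subrr add0r.
have -> : 2^-1 * (1 + y1 ^+ 2) - 2^-1 * (1 + y0 ^+ 2) =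
    2^-1 * ((y1 - y0) * (y1 + y0)) by ring.
apply: np_scale; first by rewrite invr_ge0.
by apply: np_mul => //; apply: np_add; exact: rn_nonneg_poly.
Qed.

Lemma rn_real_nd : nondecreasing_seq rn_real.
Proof.
apply/nondecreasing_seqP => k; rewrite -subr_ge0.
exact: (nonneg_poly_ge0 (rn_diff_nonneg_poly 0 k)).
Qed.

Lemma rn_real_le1 k : rn_real k <= 1.
Proof.
elim: k => [//|k IH]; rewrite rn_realS.
have := nonneg_poly_ge0 (rn_nonneg_poly 0 k); nra.
Qed.

Lemma cvg_sumR (I : Type) (r : seq I) (P : pred I) (f : I -> nat -> R) (l : I -> R) :
  (forall i, P i -> f i k @[k --> \oo] --> l i) ->
  (\sum_(i <- r | P i) f i k) @[k --> \oo] --> \sum_(i <- r | P i) l i.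
Proof.
by move=> fl; apply: cvg_big => //; exact: add_continuous.
Qed.

Section convergence.
Variable Z : 'M[R]_n.
Hypotheses (pZ : psd Z) (Z1 : forall x, dot (x *m Z) x <= dot x x).

(** Cauchy-Schwarz for the form of Z, applied to x and xZ, gives |xZ|^4 <= (xZ, x) (xZZ, xZ) <=
    |x|^2 |xZ|^2. *)
Lemma psd_contraction x : enorm (x *m Z) <= enorm x.
Proof.
have [x0|x0] := eqVneq (enorm (x *m Z)) 0; first by rewrite x0 enorm_ge0.
rewrite -(@ler_pXn2r _ 2)// ?nnegrE ?enorm_ge0// !enorm_sqr.
have h := psd_cauchy_schwarz x (x *m Z) pZ.
have p : 0 < dot (x *m Z) (x *m Z).
  by rewrite -enorm_sqr exprn_gt0// lt_neqAle eq_sym x0 enorm_ge0.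
rewrite -(ler_pM2r p); rewrite expr2 in h; apply: le_trans h _.
by apply: ler_pM => //; apply: pZ.2.
Qed.

Lemma nonneg_poly_enorm M r x : nonneg_poly Z M r ->
  enorm (x *m M) <= r * enorm x.
Proof.
move=> H; elim: H x => [x|x|? ? ? ? _ IH1 _ IH2 x|? ? ? ? H1 IH1 H2 IH2 x|? ? ? ? ? IH x].
- by rewrite mul1r psd_contraction.
- by rewrite mulmx0 mul0r /enorm dot0l sqrtr0.
- by rewrite mulmxDr mulrDl; apply: le_trans (enormD _ _) _; exact: lerD.
- rewrite mulmxA; apply: le_trans (IH2 _) _; rewrite mulrAC mulrC.
  by rewrite ler_wpM2r// (nonneg_poly_ge0 H2).
- by rewrite -scalemxAr enormZ ger0_norm// -mulrA ler_wpM2l.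
Qed.

Lemma nonneg_poly_entry M r i j : nonneg_poly Z M r -> `|M i j| <= r.
Proof.
move=> H; rewrite -(unit_mulmx M i j); apply: le_trans (coord_le_enorm _ _) _.
by apply: le_trans (nonneg_poly_enorm _ H) _; rewrite enorm_unit mulr1.
Qed.

(** The increments of an entry are bounded by those of [rn_real], so adding [rn_real] makes the
    entry nondecreasing, and bounded monotone sequences converge. *)
Lemma rn_mx_cvg i j : cvgn (fun k => rn_mx Z k i j).
Proof.
have rc : cvgn rn_real.
  apply: nondecreasing_is_cvgn; first exact: rn_real_nd.
  by exists 1 => _ [k _ <-]; exact: rn_real_le1.
have sc : cvgn (fun k => rn_mx Z k i j + rn_real k).
  apply: nondecreasing_is_cvgn.
    apply/nondecreasing_seqP => k; rewrite -subr_ge0 opprD addrACA.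
    have := nonneg_poly_entry i j (rn_diff_nonneg_poly Z k).
    by rewrite !mxE ler_norml => /andP[]; lra.
  exists 2 => _ [k _ <-].
  have := nonneg_poly_entry i j (rn_nonneg_poly Z k).
  have := rn_real_le1 k; rewrite ler_norml => ? /andP[]; lra.
rewrite (_ : (fun k => _) = (fun k => (rn_mx Z k i j + rn_real k) - rn_real k)).
  exact: is_cvgB.
by apply/funext => k; rewrite addrK.
Qed.

Definition rn_lim : 'M[R]_n := \matrix_(i, j) limn (fun k => rn_mx Z k i j).

Lemma rn_limP i j : rn_mx Z k i j @[k --> \oo] --> rn_lim i j.
Proof. by rewrite mxE; exact: rn_mx_cvg. Qed.

Lemma cvg_mulmx_entry (M N : nat -> 'M[R]_n) A B :
  (forall i j, M k i j @[k --> \oo] --> A i j) ->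
  (forall i j, N k i j @[k --> \oo] --> B i j) ->
  forall i j, (M k *m N k) i j @[k --> \oo] --> (A *m B) i j.
Proof.
move=> MA NB i j; rewrite mxE.
rewrite (_ : (fun k => _) = (fun k => \sum_l M k i l * N k l j)).
  apply: cvg_sumR => l _; apply: cvgM; [exact: MA|exact: NB].
by apply/funext => k; rewrite mxE.
Qed.

Lemma rn_lim_fixpoint : rn_lim = 2^-1 *: (Z + rn_lim *m rn_lim).
Proof.
apply/matrixP => i j.
have /cvg_lim <- // : rn_mx Z k.+1 i j @[k --> \oo] --> rn_lim i j.
  by have := rn_limP (i:=i) (j:=j); rewrite -cvg_shiftS.
apply: cvg_lim => //.
rewrite (_ : (fun k => _) =
  (fun k => 2^-1 * (Z i j + (rn_mx Z k *m rn_mx Z k) i j))); last first.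
  by apply/funext => k; rewrite rn_mxS !mxE.
have -> : (2^-1 *: (Z + rn_lim *m rn_lim)) i j =
    2^-1 * (Z i j + (rn_lim *m rn_lim) i j) by rewrite !mxE.
apply: cvgMr; apply: cvgD; first exact: cvg_cst.
by apply: cvg_mulmx_entry => ? ?; exact: rn_limP.
Qed.

Lemma rn_lim_comm C : C *m Z = Z *m C -> C *m rn_lim = rn_lim *m C.
Proof.
move=> CZ; apply/matrixP => i j.
have h1 : (C *m rn_mx Z k) i j @[k --> \oo] --> (C *m rn_lim) i j.
  apply: cvg_mulmx_entry => i' j'; [exact: cvg_cst|exact: rn_limP].
have h2 : (C *m rn_mx Z k) i j @[k --> \oo] --> (rn_lim *m C) i j.
  rewrite (_ : (fun k => _) = (fun k => (rn_mx Z k *m C) i j)); last first.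
    by apply/funext => k; rewrite (nonneg_poly_comm (rn_nonneg_poly Z k) CZ).
  apply: cvg_mulmx_entry => i' j'; [exact: rn_limP|exact: cvg_cst].
exact: (cvg_unique _ h1 h2).
Qed.

(** The fixed point equation 2Y = Z + Y^2 rearranges to (1 - Y)^2 = 1 - Z. *)
Lemma rn_lim_sqr : (1%:M - rn_lim) *m (1%:M - rn_lim) = 1%:M - Z.
Proof.
have h : rn_lim + rn_lim = Z + rn_lim *m rn_lim.
  rewrite {1 2}rn_lim_fixpoint -mulr2n -scaler_nat scalerA.
  by rewrite divff ?pnatr_eq0// scale1r.
rewrite mulmxBl !mulmxBr !mulmx1 !mul1mx opprB addrA addrAC -!addrA.
rewrite -[rn_lim *m rn_lim](addKr Z) -h; congr (_ + _).
by rewrite (addrC (- Z)) -[rn_lim + rn_lim - Z]addrA !addKr.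
Qed.

Lemma rn_lim_psd : psd (1%:M - rn_lim).
Proof.
split.
  rewrite linearB/= trmx1; congr (_ - _); apply/matrixP => i j.
  rewrite !mxE; congr (limn _); apply/funext => k.
  by have /matrixP/(_ i j) := nonneg_poly_sym pZ.1 (rn_nonneg_poly Z k); rewrite mxE.
move=> x; rewrite mulmxBr mulmx1 dotBl subr_ge0.
have h : dot (x *m rn_mx Z k) x @[k --> \oo] --> dot (x *m rn_lim) x.
  apply: cvg_sumR => i _; apply: cvgMl; rewrite mxE.
  rewrite (_ : (fun k => _) = (fun k => \sum_l x ord0 l * rn_mx Z k l i)).
    by apply: cvg_sumR => l _; apply: cvgMr; exact: rn_limP.
  by apply/funext => k; rewrite mxE.
rewrite -(cvg_lim _ h)//; apply: limr_le; first by apply/cvg_ex; eexists; exact: h.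
apply: nearW => k; apply: le_trans (ler_norm _) _.
apply: le_trans (normr_dot_le _ _) _; rewrite -enorm_sqr expr2 ler_wpM2r ?enorm_ge0//.
apply: le_trans (nonneg_poly_enorm _ (rn_nonneg_poly Z k)) _.
by rewrite ler_piMl ?enorm_ge0// rn_real_le1.
Qed.

End convergence.

(** A positive bound for the quadratic form of A on unit vectors, built from the entries so that it
    depends measurably on A. Dividing a positive semidefinite A by it brings 1 - A between 0 and
    1. *)
Definition mx_bound A : R := 1 + \sum_i \sum_j `|A i j|.

Lemma mx_bound_gt0 A : 0 < mx_bound A.
Proof. by rewrite /mx_bound ltr_pwDl// !sumr_ge0// => i _; rewrite sumr_ge0. Qed.

Lemma dot_mx_bound A x : dot (x *m A) x <= mx_bound A * dot x x.
Proof.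
rewrite mulrDl mul1r -quad_formE /quad_form ler_wpDl ?dot_ge0// mulr_suml.
apply: ler_sum => i _; rewrite mulr_suml; apply: ler_sum => j _.
apply: le_trans (ler_norm _) _; rewrite !normrM -mulrA ler_wpM2l//.
rewrite -enorm_sqr expr2; apply: ler_pM => //; exact: coord_le_enorm.
Qed.

(** [psd_sqrt] is a choice among roots and says nothing about its dependence on A. These
    approximants are explicit in the entries of A, so their limit inherits measurability. *)
Definition rn_sqrt_approx k A : 'M[R]_n :=
  Num.sqrt (mx_bound A) *: (1%:M - rn_mx (1%:M - (mx_bound A)^-1 *: A) k).

Let Zof A : 'M[R]_n := 1%:M - (mx_bound A)^-1 *: A.
Let Bof A : 'M[R]_n := Num.sqrt (mx_bound A) *: (1%:M - rn_lim (Zof A)).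

Let Zof_psd A : psd A -> psd (Zof A).
Proof.
move=> [sA pA]; split=> [|x]; first by rewrite linearB linearZ/= trmx1 sA.
rewrite mulmxBr mulmx1 -scalemxAr dotBl dotZl subr_ge0.
by rewrite mulrC ler_pdivrMr ?mx_bound_gt0// mulrC dot_mx_bound.
Qed.

Let Zof_le1 A x : psd A -> dot (x *m Zof A) x <= dot x x.
Proof.
move=> [sA pA]; rewrite mulmxBr mulmx1 -scalemxAr dotBl dotZl lerBlDr lerDl.
by rewrite mulr_ge0// invr_ge0 ltW// mx_bound_gt0.
Qed.

Let Bof_psd A : psd A -> psd (Bof A).
Proof.
move=> pA; have [sB pB] := rn_lim_psd (Zof_psd pA) (fun x => Zof_le1 x pA).
split=> [|x]; first by rewrite linearZ/= sB.
by rewrite -scalemxAr dotZl mulr_ge0// sqrtr_ge0.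
Qed.

Let Bof_sqr A : psd A -> Bof A *m Bof A = A.
Proof.
move=> pA; rewrite -scalemxAl -scalemxAr scalerA -expr2 sqr_sqrtr ?ltW ?mx_bound_gt0//.
rewrite (rn_lim_sqr (Zof_psd pA) (fun x => Zof_le1 x pA)).
by rewrite opprB addrC subrK scalerA divff ?scale1r// gt_eqF// mx_bound_gt0.
Qed.

Let Bof_comm A C : psd A -> C *m A = A *m C -> C *m Bof A = Bof A *m C.
Proof.
move=> pA CA; rewrite -scalemxAr -scalemxAl; congr (_ *: _).
rewrite mulmxBr mulmxBl mulmx1 mul1mx; congr (_ - _).
apply: (rn_lim_comm (Zof_psd pA) (fun x => Zof_le1 x pA)).
by rewrite mulmxBr mulmxBl mulmx1 mul1mx -scalemxAr -scalemxAl CA.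
Qed.

Lemma psd_ker A x : psd A -> dot (x *m A) x = 0 -> x *m A = 0.
Proof.
move=> pA x0; apply: dot_eq0; apply/eqP; rewrite -sqrf_eq0 eq_le sqr_ge0 andbT.
by have := psd_cauchy_schwarz x (x *m A) pA; rewrite x0 mul0r.
Qed.

(** B commutes with A = B^2, hence with the limit C built from A. For y = x(B - C) this gives y(B +
    C) = 0, so the nonnegative numbers (yB, y) and (yC, y) vanish; then yB = yC = 0 and |y|^2 = (x,
    y(B - C)) = 0. *)
Lemma psd_sqrt_unique A B : psd A -> psd B -> B *m B = A -> B = Bof A.
Proof.
move=> pA pB BA; have pB' := Bof_psd pA; have BA' := Bof_sqr pA.
have cB : B *m Bof A = Bof A *m B by apply: Bof_comm => //; rewrite -BA mulmxA.
set C := Bof A in pB' BA' cB *.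
have key x : x *m (B - C) = 0.
  set y := x *m (B - C).
  have : y *m (B + C) = 0.
    by rewrite /y -mulmxA mulmxDr !mulmxBl BA BA' cB addrA subrK subrr mulmx0.
  rewrite mulmxDr => yBC; have := dot0l y; rewrite -{1}yBC dotDl => /eqP.
  rewrite paddr_eq0 ?(pB.2) ?(pB'.2)// => /andP[/eqP yB /eqP yC].
  apply: dot_eq0; rewrite /y dot_mulmx -/y linearB/= pB.1 pB'.1 mulmxBr.
  by rewrite (psd_ker pB yB) (psd_ker pB' yC) subrr dot0r.
apply/row_matrixP => i; apply/eqP; rewrite -subr_eq0 !rowE -mulmxBr.
by apply/eqP/key.
Qed.

Lemma psd_quad_form A : (forall i j, A i j = A j i) ->
  (forall x, 0 <= quad_form A x x) -> psd A.
Proof.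
move=> sA pA; split=> [|x]; last by rewrite -quad_formE.
by apply/matrixP => i j; rewrite mxE.
Qed.

Let psd_sqrtE A : psd A -> psd_sqrt A = Bof A.
Proof.
move=> pA; rewrite /psd_sqrt; case: xgetP => [B _ [sB qB BA]|].
  by apply: psd_sqrt_unique => //; split=> // x; rewrite -quad_formE.
move=> /(_ (Bof A)) []; split; [exact: (Bof_psd pA).1| |exact: Bof_sqr].
by move=> x; rewrite quad_formE; exact: (Bof_psd pA).2.
Qed.

Lemma psd_sqrt_psd A : psd A -> psd (psd_sqrt A).
Proof. by move=> pA; rewrite psd_sqrtE//; exact: Bof_psd. Qed.

Lemma psd_sqrt_sqr A : psd A -> psd_sqrt A *m psd_sqrt A = A.
Proof. by move=> pA; rewrite psd_sqrtE//; exact: Bof_sqr. Qed.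

Lemma psd_sqrt_cvg A i j : psd A ->
  rn_sqrt_approx k A i j @[k --> \oo] --> psd_sqrt A i j.
Proof.
move=> pA; rewrite psd_sqrtE// /Bof /rn_sqrt_approx -/(Zof A).
have -> : (Num.sqrt (mx_bound A) *: (1%:M - rn_lim (Zof A))) i j =
    Num.sqrt (mx_bound A) * ((1%:M : 'M[R]_n) i j - rn_lim (Zof A) i j).
  by rewrite !mxE.
rewrite (_ : (fun k => _) =
  (fun k => Num.sqrt (mx_bound A) * ((1%:M : 'M[R]_n) i j - rn_mx (Zof A) k i j))).
  apply: cvgMr; apply: cvgB; first exact: cvg_cst.
  exact: (rn_limP (Zof_psd pA) (fun x => Zof_le1 x pA)).
by apply/funext => k; rewrite !mxE.
Qed.

Lemma dot_psd_sqrt A x y : psd A ->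
  dot (x *m psd_sqrt A) (y *m psd_sqrt A) = quad_form A x y.
Proof.
move=> pA; rewrite dotC dot_mulmx (psd_sqrt_psd pA).1 -mulmxA psd_sqrt_sqr//.
by rewrite dotC quad_formE.
Qed.

End riesz_nagy.

(** * Smooth functions *)

Section directional_derivative.
Context {R : realType} {V : normedModType R}.
Implicit Types (f : V -> R) (h : R -> R).

(** Only the derivative of f along v is assumed. The rule is that of one real variable, applied to t
    -> f(t v + x). *)
Lemma is_derive_comp1 h f (x v : V) dh df :
  is_derive (f x) 1 h dh -> is_derive x v f df ->
  is_derive x v (fun y => h (f y)) (dh * df).
Proof.
move=> hd fd.
pose g (t : R) := f (t *: v + x).
have dg : is_derive (0 : R) 1 g df.
  apply: DeriveDef; first by case: fd => /derivable1P.
  case: fd => _ <-; rewrite -derive1E /derive1 /derive.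
  set d := (fun _ : R => _); set d' := (fun _ : R => _).
suff -> : d = d' by [].
apply/funext => t; rewrite /d /d' /=.
  by rewrite /g addr0 scale0r add0r.
have g0 : g 0 = f x by rewrite /g scale0r add0r.
have := @is_derive1_comp R h g 0 dh df; rewrite g0 => /(_ hd dg) [e1 e2].
apply: DeriveDef; first exact/derivable1P.
rewrite -e2 -derive1E /derive1 /derive.
set d := (fun _ : R => _); set d' := (fun _ : R => _).
suff -> : d = d' by [].
apply/funext => t; rewrite /d /d' /=.
by rewrite /g addr0 scale0r add0r.
Qed.

End directional_derivative.

Lemma near_eq_continuous {R : realType} {T : topologicalType} (f g : T -> R) (x : T) :
  (\near x, f x = g x) -> {for x, continuous g} -> {for x, continuous f}.
Proof.
move=> fg cg; have fgx : f x = g x := nbhs_singleton fg.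
have fg' : {near x, g =1 f} by apply: filterS fg => y ->.
by rewrite /prop_for /continuous_at fgx; apply: cvg_trans (near_eq_cvg fg') cg.
Qed.

Section smooth.
Context {R : realType} {n : nat}.
Implicit Types (f g : 'rV[R]_n -> R) (x : 'rV[R]_n) (i : 'I_n) (s : seq 'I_n).

Lemma near_eq_partial i f g x : (\near x, f x = g x) -> partial i f x = partial i g x.
Proof. exact: near_eq_derive. Qed.

Lemma open_near (Q : set 'rV[R]_n) x : open Q -> Q x -> \near x, Q x.
Proof. by move=> oQ Qx; exact: open_nbhs_nbhs. Qed.

(** A coinduction principle: every step of an iterated partial derivative stays in C. Equality on Q
    suffices because Q is open and a partial derivative sees only the values near the point. *)
Lemma smooth_on_class (Q : set 'rV[R]_n) (C : ('rV[R]_n -> R) -> Prop) :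
  open Q ->
  (forall f, C f -> forall x, Q x ->
    {for x, continuous f} /\ forall i, derivable f x (unit_rV i)) ->
  (forall f i, C f -> exists2 g, C g & forall x, Q x -> partial i f x = g x) ->
  forall f, C f -> smooth_on Q f.
Proof.
move=> oQ C1 C2 f Cf s.
suff [g Cg E] : exists2 g, C g & forall x, Q x -> iter_partial s f x = g x.
  move=> x Qx; have [cg dg] := C1 _ Cg _ Qx.
  have nE : \near x, iter_partial s f x = g x.
    by near=> y; apply: E; near: y; exact: open_near.
  split=> [|i].
    exact: near_eq_continuous cg.
  by apply: near_eq_derivable (dg i); near do apply/esym.
elim: s => [|i s [g Cg E]]; first by exists f.
have [h Ch Eh] := C2 _ i Cg; exists h => // x Qx; rewrite -Eh//=.
by apply: near_eq_partial; near=> y; apply: E; near: y; exact: open_near.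
Unshelve. all: by end_near. Qed.

Lemma smooth_on_continuous Q f x : smooth_on Q f -> Q x -> {for x, continuous f}.
Proof. by move=> sf Qx; have [] := sf [::] x Qx. Qed.

Lemma smooth_on_derivable Q f x i : smooth_on Q f -> Q x -> derivable f x (unit_rV i).
Proof. by move=> sf Qx; have [_] := sf [::] x Qx; apply. Qed.

Lemma smooth_on_partial Q f i : smooth_on Q f -> smooth_on Q (partial i f).
Proof.
by move=> sf s x Qx; have := sf (rcons s i) x Qx; rewrite /iter_partial foldr_rcons.
Qed.

Lemma smooth_onW (P Q : set 'rV[R]_n) f : P `<=` Q -> smooth_on Q f -> smooth_on P f.
Proof. by move=> PQ sf s x Px; apply: sf; exact: PQ. Qed.

(** Iterated partial derivatives at x depend only on a neighbourhood of x. Needed to extend by zero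
    a test function that is given by a smooth formula only inside a cube. *)
Lemma smooth_on_local f :
  (forall x, exists2 U : set 'rV[R]_n, nbhs x U & exists2 g, smooth_on U g &
    forall y, U y -> f y = g y) -> smooth_on setT f.
Proof.
move=> loc s x _; have [U0 xU0 [g sg0 fg0]] := loc x.
pose U := interior U0.
have oU : open U by exact: open_interior.
have Ux : U x by [].
have sg : smooth_on U g by apply: smooth_onW sg0; exact: interior_subset.
have fg y : U y -> f y = g y by move=> Uy; apply: fg0; exact: interior_subset.
have E : forall y, U y -> iter_partial s f y = iter_partial s g y.
  elim: s => [//|i s IH] y Uy /=; apply: near_eq_partial.
  by near=> z; apply: IH; near: z; exact: open_near.
have [c d] := sg s x Ux.
split=> [|i].
  by apply: near_eq_continuous c; near=> y; apply/E; near: y; exact: open_near.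
by apply: near_eq_derivable (d i); near=> y; apply/esym/E; near: y; exact: open_near.
Unshelve. all: by end_near. Qed.

(** The product rule leads out of B but not out of this algebra; for a concrete family only the
    derivatives of the generators then remain to be computed. *)
Inductive alg_gen (B : ('rV[R]_n -> R) -> Prop) : ('rV[R]_n -> R) -> Prop :=
| ag_base f : B f -> alg_gen B f
| ag_add f g : alg_gen B f -> alg_gen B g -> alg_gen B (f + g)
| ag_mul f g : alg_gen B f -> alg_gen B g -> alg_gen B (f * g).

Lemma smooth_alg_gen (Q : set 'rV[R]_n) B : open Q ->
  (forall f, B f -> forall x, Q x ->
    {for x, continuous f} /\ forall i, derivable f x (unit_rV i)) ->
  (forall f i, B f -> exists2 g, alg_gen B g & forall x, Q x -> partial i f x = g x) ->
  forall f, alg_gen B f -> smooth_on Q f.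
Proof.
move=> oQ B1 B2.
have h1 f : alg_gen B f -> forall x, Q x ->
    {for x, continuous f} /\ forall i, derivable f x (unit_rV i).
  elim=> [g Bg|g1 g2 _ IH1 _ IH2|g1 g2 _ IH1 _ IH2] x Qx; first exact: B1.
    have [c1 d1] := IH1 x Qx; have [c2 d2] := IH2 x Qx.
    by split=> [|i]; [exact: continuousD|exact: derivableD].
  have [c1 d1] := IH1 x Qx; have [c2 d2] := IH2 x Qx.
  by split=> [|i]; [exact: continuousM|exact: derivableM].
apply: smooth_on_class => // f i.
elim=> [g Bg|g1 g2 H1 [k1 K1 E1] H2 [k2 K2 E2]|g1 g2 H1 [k1 K1 E1] H2 [k2 K2 E2]].
- exact: B2.
- exists (k1 + k2); first exact: ag_add.
  move=> x Qx; rewrite /partial deriveD; last 2 first.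
  + by apply: (h1 _ H1 x Qx).2.
  + by apply: (h1 _ H2 x Qx).2.
  by rewrite -/(partial i g1 x) E1// -/(partial i g2 x) E2.
- exists (g1 * k2 + g2 * k1); first by apply: ag_add; exact: ag_mul.
  move=> x Qx; rewrite /partial deriveM; last 2 first.
  + by apply: (h1 _ H1 x Qx).2.
  + by apply: (h1 _ H2 x Qx).2.
  by rewrite -/(partial i g1 x) E1// -/(partial i g2 x) E2.
Qed.

Lemma smooth_base (Q : set 'rV[R]_n) f : smooth_on Q f -> forall x, Q x ->
  {for x, continuous f} /\ forall i, derivable f x (unit_rV i).
Proof.
move=> sf x Qx; split=> [|i]; first exact: smooth_on_continuous sf Qx.
exact: smooth_on_derivable sf Qx.
Qed.

Lemma smooth_on_alg (Q : set 'rV[R]_n) : open Q ->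
  forall f, alg_gen (smooth_on Q) f -> smooth_on Q f.
Proof.
move=> oQ; apply: smooth_alg_gen => // [f sf|f i sf]; first exact: smooth_base.
by exists (partial i f) => //; apply: ag_base; exact: smooth_on_partial.
Qed.

Lemma smooth_onD (Q : set 'rV[R]_n) f g : open Q ->
  smooth_on Q f -> smooth_on Q g -> smooth_on Q (fun x => f x + g x).
Proof.
by move=> oQ sf sg; apply: smooth_on_alg => //; apply: ag_add; exact: ag_base.
Qed.

Lemma smooth_onM (Q : set 'rV[R]_n) f g : open Q ->
  smooth_on Q f -> smooth_on Q g -> smooth_on Q (fun x => f x * g x).
Proof.
by move=> oQ sf sg; apply: smooth_on_alg => //; apply: ag_mul; exact: ag_base.
Qed.

Lemma partial_cst i c x : partial i (fun=> c) x = 0.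
Proof. by rewrite /partial derive_cst. Qed.

Lemma smooth_on_cst (Q : set 'rV[R]_n) (c : R) : open Q -> smooth_on Q (fun=> c).
Proof.
move=> oQ; apply: (@smooth_on_class Q (fun f => exists c, f = fun=> c)) => //; last by exists c.
  move=> _ [{}c ->] x Qx; split=> [|i]; first exact: cst_continuous.
  exact: derivable_cst.
by move=> _ i [{}c ->]; exists (fun=> 0); [exists 0|move=> x _; rewrite partial_cst].
Qed.

Lemma smooth_on_sum (Q : set 'rV[R]_n) (I : Type) (r : seq I) (P : pred I)
    (f : I -> 'rV[R]_n -> R) : open Q -> (forall j, smooth_on Q (f j)) ->
  smooth_on Q (fun x => \sum_(j <- r | P j) f j x).
Proof.
move=> oQ sf; elim: r => [|j r IH].
  by under eq_fun do rewrite big_nil; exact: smooth_on_cst.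
under eq_fun do rewrite big_cons.
by case: (P j); [exact: smooth_onD|exact: IH].
Qed.

Lemma smooth_on_prod (Q : set 'rV[R]_n) (I : Type) (r : seq I) (P : pred I)
    (f : I -> 'rV[R]_n -> R) : open Q -> (forall j, smooth_on Q (f j)) ->
  smooth_on Q (fun x => \prod_(j <- r | P j) f j x).
Proof.
move=> oQ sf; elim: r => [|j r IH].
  by under eq_fun do rewrite big_nil; exact: smooth_on_cst.
under eq_fun do rewrite big_cons.
by case: (P j); [exact: smooth_onM|exact: IH].
Qed.

Lemma is_derive_coord (v x : 'rV[R]_n) (j : 'I_n) :
  is_derive x v (fun y : 'rV[R]_n => y ord0 j) (v ord0 j).
Proof.
have E : forall h : R, h != 0 ->
    h^-1 *: (((fun y : 'rV[R]_n => y ord0 j) \o shift x) (h *: v) - x ord0 j) = v ord0 j.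
  move=> h h0 /=; rewrite !mxE addrK.
  by rewrite /GRing.scale/= mulrA mulVf// mul1r.
have C : h^-1 *: (((fun y : 'rV[R]_n => y ord0 j) \o shift x) (h *: v) - x ord0 j) @[h --> 0^'] --> v ord0 j.
  apply: (@cvg_trans _ ((fun=> v ord0 j : R) h @[h --> (0:R)^'])); last exact: cvg_cst.
  apply: near_eq_cvg; near=> h; rewrite E//; near: h; exact: nbhs_dnbhs_neq.
by apply: DeriveDef; [apply/cvg_ex; eexists; exact: C|exact: cvg_lim].
Unshelve. all: by end_near. Qed.

Lemma coord_continuous (j : 'I_n) : continuous (fun y : 'rV[R]_n => y ord0 j).
Proof. exact: coord_continuous. Qed.

Lemma smooth_on_coord (Q : set 'rV[R]_n) (j : 'I_n) : open Q ->
  smooth_on Q (fun y => y ord0 j).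
Proof.
move=> oQ; apply: (@smooth_on_class Q
  (fun f => f = (fun y => y ord0 j) \/ exists c, f = fun=> c)) => //; last by left.
  move=> _ [->|[c ->]] x Qx; split=> [|i].
  - exact: coord_continuous.
  - by case: (is_derive_coord (unit_rV i) x j).
  - exact: cst_continuous.
  - exact: derivable_cst.
move=> _ i [->|[c ->]].
  exists (fun=> (unit_rV i : 'rV[R]_n) ord0 j); first by right; eexists.
  by move=> x _; case: (is_derive_coord (unit_rV i) x j).
by exists (fun=> 0); [right; exists 0|move=> x _; rewrite partial_cst].
Qed.

Lemma partial_powR (h : 'rV[R]_n -> R) (b : R) x i : 0 < h x ->
  derivable h x (unit_rV i) ->
  is_derive x (unit_rV i) (fun y => h y `^ b) (b * h x `^ (b - 1) * partial i h x).
Proof.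
move=> h0 dh.
have H := @is_derive_comp1 R _ (fun t => t `^ b) h x (unit_rV i) _ _
  (is_derive1_powR b h0) (derivableP dh).
exact: H.
Qed.

Lemma powR_continuous_at (b t : R) : 0 < t -> {for t, continuous (fun r : R => r `^ b)}.
Proof.
move=> t0; have [d _] := is_derive1_powR b t0.
exact/differentiable_continuous/derivable1_diffP.
Qed.

(** The generators are the smooth functions and all real powers of h: differentiation lowers the
    exponent by one and brings in smooth factors. *)
Lemma smooth_on_powR (Q : set 'rV[R]_n) (h : 'rV[R]_n -> R) (b : R) : open Q ->
  smooth_on Q h -> (forall x, Q x -> 0 < h x) -> smooth_on Q (fun x => h x `^ b).
Proof.
move=> oQ sh h0.
pose B f := smooth_on Q f \/ exists c, f = fun x => h x `^ c.
have hB c : B (fun x => h x `^ c) by right; exists c.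
apply: (@smooth_alg_gen Q B) => //; last by apply: ag_base.
  move=> f [sf|[c ->]] x Qx; first exact: (smooth_base sf).
  have [ch dh] := smooth_base sh Qx.
  split=> [|i]; last by case: (partial_powR c (h0 x Qx) (dh i)).
  have H := (continuous_comp ch (powR_continuous_at (h0 x Qx))).
  exact: H.
move=> f i [sf|[c ->]].
  by exists (partial i f) => //; apply/ag_base; left; exact: smooth_on_partial.
exists ((fun=> c) * (fun x => h x `^ (c - 1)) * partial i h).
  apply: ag_mul; last by apply/ag_base; left; exact: smooth_on_partial.
  apply: ag_mul; last exact/ag_base.
  by apply: ag_base; left; exact: smooth_on_cst.
move=> x Qx; have [_ dh] := smooth_base sh Qx.
by case: (partial_powR c (h0 x Qx) (dh i)).
Qed.

End smooth.

(** * A smooth monotone step built from exp(-1/t) *)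

Section flat.
Context {R : realType}.
Implicit Types (t : R) (m : nat).

(** exp(-1/t) / t^m for t > 0, continued by 0. The index m makes the family stable, up to linear
    combinations, under differentiation. *)
Definition flat m t : R := if 0 < t then t^-1 ^+ m * expR (- t^-1) else 0.

Lemma flat_ge0 m t : 0 <= flat m t.
Proof.
by rewrite /flat; case: ifP => // t0; rewrite mulr_ge0 ?expR_ge0// exprn_ge0// invr_ge0 ltW.
Qed.

Lemma flat_le0 m t : t <= 0 -> flat m t = 0.
Proof. by rewrite leNgt /flat => /negbTE ->. Qed.

(** With y = 1/t, the exponential series gives exp y >= y^(m+2) / (m+2)!. The quadratic bound is
    what makes the derivative at 0 exist and vanish. *)
Lemma flat_le m t : flat m t <= (m.+2)`!%:R * t ^+ 2.
Proof.
rewrite /flat; case: ifPn => t0; last by rewrite mulr_ge0// sqr_ge0.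
have y0 : 0 <= t^-1 by rewrite invr_ge0 ltW.
have := expR_ge1Dxn m.+1 y0.
set f := (m.+2)`!%:R; have f0 : 0 < f :> R by rewrite ltr0n fact_gt0.
move=> h; have {}h : t^-1 ^+ m.+2 <= f * expR t^-1.
  by rewrite mulrC -ler_pdivrMr//; apply: le_trans h; rewrite lerDr.
rewrite expRN ler_pdivrMr ?expR_gt0//.
rewrite -(ler_pM2r (_ : 0 < t^-1 ^+ 2)) ?exprn_gt0 ?invr_gt0//.
rewrite -exprD addn2; apply: le_trans h _.
rewrite (_ : _ * t^-1 ^+ 2 = f * expR t^-1)//.
by field; rewrite gt_eqF.
Qed.

Lemma is_derive_flat m t : is_derive t 1 (flat m) (flat m.+2 t - m%:R * flat m.+1 t).
Proof.
have [t0|t0|->] := ltgtP t 0.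
- rewrite !flat_le0 ?ltW// mulr0 subr0.
  apply: (@near_eq_is_derive _ _ _ (cst 0)).
  by near=> y; rewrite flat_le0// ltW//; near: y; exact: lt_nbhsl.
- pose e (t : R) := t^-1 ^+ m * expR (- t^-1).
  apply: (@near_eq_is_derive _ _ _ e).
    by near=> y; rewrite /e /flat ifT//; near: y; exact: lt_nbhsr.
  have d1 : is_derive t 1 (fun y : R => y^-1) (- t ^- 2).
    apply: is_derive_eq; first by apply: is_deriveV; rewrite gt_eqF.
    by rewrite /GRing.scale/= mulr1.
  have d2 : is_derive t 1 (fun y : R => y^-1 ^+ m) (m%:R * t^-1 ^+ m.-1 * - t ^- 2).
    rewrite (_ : (fun y : R => y^-1 ^+ m) = (fun y : R => y^-1) ^+ m); last first.
    by apply/funext => y; rewrite exprfctE.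
  exact: (@is_deriveX _ _ (fun y : R => y^-1) m t 1 (- t ^- 2)).
  have d3 : is_derive t 1 (fun y : R => expR (- y^-1)) (expR (- t^-1) * t ^- 2).
    apply: (@is_derive1_comp _ expR (fun y : R => - y^-1)).
    by rewrite -[X in is_derive _ _ _ X]opprK; exact: is_deriveN.
  apply: (is_derive_eq (is_deriveM d2 d3)).
  rewrite /flat t0 /GRing.scale/= !exprS; case: m {d2 e} => [|m].
    by field; rewrite gt_eqF.
  by rewrite /= [t^-1 ^+ m.+1]exprS; field; rewrite gt_eqF.
- rewrite !flat_le0// mulr0 subr0.
  have C : h^-1 *: ((flat m \o shift 0) (h *: (1 : R)) - flat m 0) @[h --> 0^'] --> (0 : R).
    apply/cvgrPdist_le => e e0.
    pose K : R := (m.+2)`!%:R.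
    have K0 : 0 < K by rewrite ltr0n fact_gt0.
    near=> h.
    have h0 : h != 0 by near: h; exact: nbhs_dnbhs_neq.
    rewrite sub0r normrN /= addr0 (flat_le0 _ (lexx _)) subr0 [h%:A]mulr1.
    rewrite normrM normfV ler_pdivrMl ?normr_gt0// ger0_norm ?flat_ge0//.
    apply: le_trans (flat_le _ _) _; rewrite -/K -[h ^+ 2]real_normK ?num_real// expr2 mulrCA.
    rewrite ler_wpM2l// mulrC -ler_pdivlMr//.
    near: h; apply: dnbhs0_le; exact: divr_gt0.
  by apply: DeriveDef; [apply/cvg_ex; eexists; exact: C|exact: cvg_lim].
Unshelve. all: by end_near. Qed.

Lemma flat_continuous m : continuous (flat m).
Proof.
move=> t; have [d _] := is_derive_flat m t.
exact/differentiable_continuous/derivable1_diffP.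
Qed.

Lemma flat0_nd : {homo flat 0 : s t / s <= t}.
Proof.
move=> s t st; have [s0|s0] := leP s 0; first by rewrite (flat_le0 _ s0) flat_ge0.
have t0 := lt_le_trans s0 st.
by rewrite /flat s0 t0 !expr0 !mul1r ler_expR lerN2 lef_pV2.
Qed.

Lemma flat0_gt0 t : 0 < t -> 0 < flat 0 t.
Proof. by move=> t0; rewrite /flat t0 expr0 mul1r expR_gt0. Qed.

Definition step_den t := flat 0 t + flat 0 (1 - t).

(** One of t and 1 - t is at least 1/2. *)
Lemma step_den_ge t : flat 0 2^-1 <= step_den t.
Proof.
rewrite /step_den; have [h|h] := leP (2^-1) t.
  by rewrite ler_wpDr ?flat_ge0// flat0_nd.
rewrite ler_wpDl ?flat_ge0// flat0_nd//; lra.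
Qed.

Lemma step_den_gt0 t : 0 < step_den t.
Proof. by apply: lt_le_trans (step_den_ge t); rewrite flat0_gt0. Qed.

(** The quotient is written as a power so that its smoothness follows from that of real powers of
    positive functions. *)
Definition step t := flat 0 t * step_den t `^ (- 1).

Lemma stepE t : step t = flat 0 t / step_den t.
Proof. by rewrite /step powR_inv1// ltW// step_den_gt0. Qed.

Lemma step_le0 t : t <= 0 -> step t = 0.
Proof. by move=> t0; rewrite stepE flat_le0// mul0r. Qed.

Lemma step_ge1 t : 1 <= t -> step t = 1.
Proof.
move=> t1; have := step_den_gt0 t; rewrite stepE /step_den (@flat_le0 _ (1 - t)) ?subr_le0//.
by rewrite addr0 => h; rewrite divff// gt_eqF.
Qed.

Lemma step_nd : {homo step : s t / s <= t}.
Proof.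
move=> s t st; rewrite !stepE ler_pdivrMr ?step_den_gt0// mulrAC ler_pdivlMr ?step_den_gt0//.
rewrite !mulrDr; apply: lerD; first by rewrite mulrC.
apply: ler_pM; rewrite ?flat_ge0 ?flat0_nd//; lra.
Qed.

Lemma step_ge0 t : 0 <= step t.
Proof. by rewrite stepE divr_ge0 ?flat_ge0// ltW// step_den_gt0. Qed.

Lemma step_le1 t : step t <= 1.
Proof. by rewrite stepE ler_pdivrMr ?step_den_gt0// mul1r lerDl flat_ge0. Qed.

Definition dstep t := flat 0 t * (- step_den t `^ (- 2) * (flat 2 t - flat 2 (1 - t)))
  + step_den t `^ (- 1) * flat 2 t.

Lemma is_derive_step t : is_derive t 1 step (dstep t).
Proof.
have d0 (s : R) : is_derive s 1 (flat 0) (flat 2 s).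
  by apply: is_derive_eq (is_derive_flat 0 s) _; rewrite mul0r subr0.
have d1 : is_derive t 1 step_den (flat 2 t - flat 2 (1 - t)).
  apply: is_deriveD.
  rewrite -[- _]mulrN1; apply: (@is_derive1_comp _ (flat 0) (fun s => 1 - s)) => //.
  rewrite -[- 1]add0r; apply: is_deriveB.
have d2 : is_derive t 1 (fun s => step_den s `^ (- 1))
    (- step_den t `^ (- 2) * (flat 2 t - flat 2 (1 - t))).
  apply: (@is_derive1_comp _ (fun s => s `^ (- 1)) step_den) => //.
  apply: is_derive_eq; first by apply: is_derive1_powR; exact: step_den_gt0.
  by rewrite mulN1r -opprD.
exact: is_deriveM.
Qed.

Lemma dstep_support t : dstep t != 0 -> 0 < t < 1.
Proof.
apply: contraR; rewrite negb_and -!leNgt => /orP[t0|t1]; rewrite /dstep.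
  by rewrite !(flat_le0 _ t0) mul0r mulr0 addr0.
have := step_den_gt0 t; rewrite /step_den !(@flat_le0 _ (1 - t)) ?subr_le0//.
rewrite addr0 subr0 => f0; rewrite !powRN powRr1 ?ltW// (powR_mulrn 2) ?ltW//.
by apply/eqP; field; rewrite gt_eqF.
Qed.

(** [dstep] lives on ]0, 1[, where [flat 2] is at most 4! by the quadratic bound and the denominator
    is bounded below. *)
Lemma dstep_bounded : exists D : R, forall t, `|dstep t| <= D.
Proof.
pose d : R := flat 0 2^-1; have d0 : 0 < d by rewrite flat0_gt0.
pose K : R := 4`!%:R.
have K0 : 0 <= K by [].
exists (d `^ (- 2) * (K + K) + d `^ (- 1) * K) => t.
have [->|/dstep_support/andP[t0 t1]] := eqVneq (dstep t) 0.
  by rewrite normr0 addr_ge0// mulr_ge0 ?powR_ge0// addr_ge0.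
have pd c : 0 <= c -> step_den t `^ (- c) <= d `^ (- c).
  move=> c0; rewrite !powRN lef_pV2 ?posrE ?powR_gt0 ?step_den_gt0//.
  by rewrite ge0_ler_powR// ?nnegrE ?step_den_ge// ltW// step_den_gt0.
have f2 s : 0 < s < 1 -> `|flat 2 s| <= K.
  move=> /andP[s0 s1]; rewrite ger0_norm ?flat_ge0//; apply: le_trans (flat_le _ _) _.
  by rewrite ler_piMr// expr_le1 ?ltW.
have f0 : `|flat 0 t| <= 1.
  rewrite ger0_norm ?flat_ge0// /flat t0 expr0 mul1r -expR0 ler_expR.
  by rewrite oppr_le0 invr_ge0 ltW.
apply: le_trans (ler_normD _ _) _; apply: lerD; rewrite !normrM.
  rewrite -[X in _ <= X]mul1r; apply: ler_pM => //.
  rewrite normrN; apply: ler_pM => //.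
    by rewrite ger0_norm ?powR_ge0// pd.
  apply: le_trans (ler_normB _ _) _; apply: lerD; apply: f2; first by rewrite t0.
  by apply/andP; split; lra.
by apply: ler_pM => //; [rewrite ger0_norm ?powR_ge0// pd|rewrite f2// t0].
Qed.

End flat.

Section smooth_step.
Context {R : realType} {n : nat}.
Implicit Types (f g l : 'rV[R]_n -> R) (x : 'rV[R]_n) (i : 'I_n).

Lemma smooth_on_flat (Q : set 'rV[R]_n) l m : open Q -> smooth_on Q l ->
  smooth_on Q (fun x => flat m (l x)).
Proof.
move=> oQ sl.
pose B f := smooth_on Q f \/ exists c, f = fun x => flat c (l x).
have hB c : B (fun x => flat c (l x)) by right; exists c.
have D c x i : Q x -> is_derive x (unit_rV i) (fun x => flat c (l x))
    ((flat c.+2 (l x) - c%:R * flat c.+1 (l x)) * partial i l x).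
  move=> Qx; have [_ dl] := smooth_base sl Qx.
  have H := @is_derive_comp1 R _ (flat c) l x (unit_rV i) _ _
    (is_derive_flat c (l x)) (derivableP (dl i)).
  exact: H.
apply: (@smooth_alg_gen _ _ Q B) => //; last by apply: ag_base.
  move=> f [sf|[c ->]] x Qx; first exact: (smooth_base sf).
  have [ch dh] := smooth_base sl Qx.
  split=> [|i]; last by case: (D c x i Qx).
  have H := continuous_comp ch (@flat_continuous R c (l x)).
  exact: H.
move=> f i [sf|[c ->]].
  by exists (partial i f) => //; apply/ag_base; left; exact: smooth_on_partial.
exists (((fun x => flat c.+2 (l x)) + (fun=> - c%:R) * (fun x => flat c.+1 (l x))) * partial i l).
  apply: ag_mul; last by apply/ag_base; left; exact: smooth_on_partial.
  apply: ag_add; first exact: ag_base.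
  apply: ag_mul; last exact/ag_base.
  by apply: ag_base; left; exact: smooth_on_cst.
move=> x Qx; case: (D c x i Qx) => _; rewrite /partial => ->.
by rewrite !fctE mulNr.
Qed.

Lemma smooth_on_step (Q : set 'rV[R]_n) l : open Q -> smooth_on Q l ->
  smooth_on Q (fun x => step (l x)).
Proof.
move=> oQ sl.
have sc : smooth_on Q (fun x => 1 - l x).
  rewrite (_ : (fun x => 1 - l x) = (fun x => 1 + (- 1) * l x)).
    by apply: (smooth_onD oQ (smooth_on_cst 1 oQ)); exact: (smooth_onM oQ (smooth_on_cst _ oQ) sl).
  by apply/funext => x; rewrite mulN1r.
have sd : smooth_on Q (fun x => step_den (l x)).
  exact: (smooth_onD oQ (smooth_on_flat 0%N oQ sl)
    (smooth_on_flat 0%N oQ sc)).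
have sp : smooth_on Q (fun x => step_den (l x) `^ (- 1)).
  by apply: (smooth_on_powR (- 1) oQ sd) => x _; exact: step_den_gt0.
exact: (smooth_onM oQ (smooth_on_flat 0%N oQ sl) sp).
Qed.

End smooth_step.

(** * Smooth approximation of Lipschitz functions *)

Section rV_norm.
Context {R : realType} {n : nat}.
Implicit Types (x : 'rV[R]_n).

Lemma coord_le_norm x i : `|x ord0 i| <= `|x|.
Proof.
rewrite [leRHS]/Num.norm/= mx_normrE.
by apply: le_trans (le_bigmax _ _ (ord0, i)).
Qed.

Lemma norm_rV_le x (e : R) : 0 <= e -> (forall i, `|x ord0 i| <= e) -> `|x| <= e.
Proof.
move=> e0 xe; rewrite [leLHS]/Num.norm/= mx_normrE.
by apply/bigmax_leP; split => // -[i j] _ /=; rewrite ord1.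
Qed.

End rV_norm.

Section big_derive.
Context {R : realType} {V : normedModType R}.

Lemma is_derive_bigsum (I : Type) (r : seq I) (f : I -> V -> R) (df : I -> R) (x v : V) :
  (forall j, is_derive x v (f j) (df j)) ->
  is_derive x v (fun y => \sum_(j <- r) f j y) (\sum_(j <- r) df j).
Proof.
move=> H; elim: r => [|j r IH].
  rewrite big_nil (_ : (fun y => _) = cst 0); first exact: is_derive_cst.
  by apply/funext => y; rewrite big_nil.
rewrite big_cons (_ : (fun y => _) = f j + (fun y => \sum_(j <- r) f j y)).
  exact: is_deriveD.
by apply/funext => y; rewrite big_cons.
Qed.

Lemma is_derive_const_along (f : V -> R) (x v : V) :
  (forall h : R, f (h *: v + x) = f x) -> is_derive x v f 0.
Proof.
move=> H.
have C : h^-1 *: ((f \o shift x) (h *: v) - f x) @[h --> 0^'] --> (0 : R).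
  rewrite (_ : (fun h => _) = (fun=> 0)); first exact: cvg_cst.
  by apply/funext => h /=; rewrite H subrr scaler0.
by apply: DeriveDef; [apply/cvg_ex; eexists; exact: C|exact: cvg_lim].
Qed.

End big_derive.

Section lattice_approx.
Context {R : realType} {n : nat}.
Implicit Types (x y : 'rV[R]_n) (i l : 'I_n).

(* The functions hat M j, j < 2M+1, form a partition of unity on [1-M, M-1]. *)
Section bumps.
Variable M : nat.
Let N := M.*2.+1.

Definition node (j : nat) : R := j%:R - M%:R.

Definition hat (j : nat) (t : R) := step (t - node j) - step (t - node j.+1).

Definition dhat (j : nat) (t : R) := dstep (t - node j) - dstep (t - node j.+1).

Lemma nodeS j : node j.+1 = node j + 1.
Proof. by rewrite /node -natr1 addrAC. Qed.

Lemma hat_ge0 j t : 0 <= hat j t.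
Proof. by rewrite subr_ge0; apply: step_nd; rewrite nodeS; lra. Qed.

Lemma is_derive_hat j (t : R) : is_derive t 1 (hat j) (dhat j t).
Proof.
have H c : is_derive t 1 (fun s => step (s - c)) (dstep (t - c)).
  rewrite -[dstep _]mulr1; apply: (@is_derive1_comp _ step (fun s => s - c)).
    exact: is_derive_step.
  by rewrite -[X in is_derive _ _ _ X]subr0; apply: is_deriveB.
exact: is_deriveB.
Qed.

Lemma hat_support j t : hat j t != 0 -> `|t - node j| <= 2.
Proof.
apply: contraR; rewrite -ltNge lter_normr => /orP[h|h]; rewrite /hat nodeS.
  by rewrite !step_ge1 ?subrr//; lra.
by rewrite !step_le0 ?subrr//; lra.
Qed.

Lemma dhat_support j t : dhat j t != 0 -> `|t - node j| <= 2.
Proof.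
rewrite /dhat; have [->|/dstep_support + _] := eqVneq (dstep (t - node j)) 0.
  rewrite sub0r oppr_eq0 => /dstep_support; rewrite nodeS ler_norml => /andP[? ?].
  by apply/andP; split; lra.
by rewrite ler_norml => /andP[? ?]; apply/andP; split; lra.
Qed.

Lemma sum_hat t : \sum_(j < N) hat j t = step (t + M%:R) - step (t - M%:R - 1).
Proof.
rewrite -(big_mkord xpredT (fun j => hat j t)).
rewrite (eq_big_nat _ _ (F2 := fun j => - step (t - node j.+1) - (- step (t - node j)))).
  rewrite telescope_sumr// opprK addrC.
  have -> : t - node 0 = t + M%:R by rewrite /node sub0r opprK.
  have -> // : t - node N = t - M%:R - 1.
  by rewrite /node /N -natr1 -addnn natrD; lra.
by move=> j _; rewrite opprK addrC.
Qed.

Lemma sum_hat_le1 t : \sum_(j < N) hat j t <= 1.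
Proof.
rewrite sum_hat lerBlDr; apply: le_trans (step_le1 _) _.
by rewrite lerDl step_ge0.
Qed.

Lemma sum_hat1 t : `|t| + 1 <= M%:R -> \sum_(j < N) hat j t = 1.
Proof.
rewrite -lerBrDr ler_norml => /andP[t1 t2].
by rewrite sum_hat step_ge1 ?step_le0 ?subr0//; lra.
Qed.

Lemma sum_dhat0 t : `|t| + 1 <= M%:R -> \sum_(j < N) dhat j t = 0.
Proof.
rewrite -lerBrDr ler_norml => /andP[t1 t2].
rewrite -(big_mkord xpredT (fun j => dhat j t)).
rewrite (eq_big_nat _ _ (F2 := fun j => - dstep (t - node j.+1) - (- dstep (t - node j)))).
  rewrite telescope_sumr// opprK addrC /node.
  have h s : ~~ (0 < s < 1) -> dstep s = 0 :> R.
    by apply: contraNeq; exact: dstep_support.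
  rewrite !h ?subrr//; rewrite negb_and -!leNgt.
    by rewrite /N -natr1 -addnn natrD; apply/orP; left; lra.
  by apply/orP; right; lra.
by move=> j _; rewrite opprK addrC.
Qed.

(** The supports ]j + c, j + 1 + c[ are disjoint, so at most one term is nonzero, whatever the
    number of terms. *)
Lemma sum_dstep_le (D c t : R) (m : nat) : (forall s, `|dstep s| <= D) ->
  \sum_(j < m) `|dstep (t - (j%:R + c))| <= D.
Proof.
move=> hD; have D0 : 0 <= D by apply: le_trans (hD 0).
have [/existsP[j0 h0]|] := boolP [exists j : 'I_m, dstep (t - (j%:R + c)) != 0].
  rewrite (bigD1 j0)//= big1 ?addr0// => j jj0; apply/eqP; rewrite normr_eq0.
  apply: contraNT jj0 => h.
  have /andP[a1 a2] := dstep_support h; have /andP[b1 b2] := dstep_support h0.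
  have c1 : (j : nat)%:R < (j0 : nat)%:R + 1 :> R by lra.
  have c2 : (j0 : nat)%:R < (j : nat)%:R + 1 :> R by lra.
  rewrite !natr1 !ltr_nat !ltnS in c1 c2.
  by apply/eqP/val_inj/eqP; rewrite eqn_leq c1.
move=> /existsPn h; rewrite big1// => j _; apply/eqP.
by rewrite normr_eq0; have := h j; rewrite negbK.
Qed.

Lemma sum_dhat_le (D t : R) : (forall s, `|dstep s| <= D) ->
  \sum_(j < N) `|dhat j t| <= 2 * D.
Proof.
move=> hD; apply: (@le_trans _ _ (\sum_(j < N) (`|dstep (t - (j%:R + (- M%:R)))|
   + `|dstep (t - (j%:R + (1 - M%:R)))|))).
  apply: ler_sum => j _; apply: le_trans (ler_normB _ _) _.
  by rewrite /node -natr1 addrA.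
by rewrite big_split mulr2n mulrDl mul1r; apply: lerD; exact: sum_dstep_le.
Qed.

End bumps.

Variables (psi : 'rV[R]_n -> R) (L rho : R).
Hypothesis L0 : 0 <= L.
Hypothesis psiL : forall x y, `|psi x - psi y| <= L * `|x - y|.
Hypothesis psi0 : forall x, 0 <= psi x.
Hypothesis psi_supp : forall x, psi x != 0 -> `|x| <= rho.

Variables (M k : nat).
Let K : R := k.+1%:R.
Hypothesis MK : K * (rho + 2) + 1 <= M%:R.
Let N := M.*2.+1.
Let idx := {ffun 'I_n -> 'I_N}.

Let pt (al : idx) : 'rV[R]_n := \row_l (node M (al l) / K).

(** Sampling on a lattice of mesh 1/K takes the place of convolution: the sum is finite, so
    smoothness is immediate. By [MK] the hats sum to 1 on the cube of radius rho + 2, outside of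
    which every term vanishes. *)
Definition lattice_approx x :=
  \sum_(al : idx) psi (pt al) * \prod_l hat M (al l) (K * x ord0 l).

Let K0 : 0 < K. Proof. by rewrite ltr0n. Qed.

Let K1 : 1 <= K. Proof. by rewrite ler1n. Qed.

Let pt_dist (al : idx) x : (forall l, `|K * x ord0 l - node M (al l)| <= 2) ->
  `|x - pt al| <= 2 / K.
Proof.
move=> h; apply: norm_rV_le => [|l]; first by rewrite divr_ge0// ltW.
rewrite !mxE ler_pdivlMr// -{2}(gtr0_norm K0) -normrM.
by rewrite mulrBl mulrC divfK ?gt_eqF.
Qed.

Lemma smooth_lattice_approx : smooth_on setT lattice_approx.
Proof.
have oT : open [set: 'rV[R]_n] := openT.
apply: (smooth_on_sum _ _ oT) => al.
apply: (smooth_onM oT (smooth_on_cst _ oT)).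
apply: (smooth_on_prod _ _ oT) => l.
have sl c : smooth_on [set: 'rV[R]_n] (fun x => K * x ord0 l - c).
  exact: (smooth_onD oT (smooth_onM oT (smooth_on_cst _ oT) (smooth_on_coord _ oT)) (smooth_on_cst _ oT)).
have E : (fun x : 'rV[R]_n => hat M (al l) (K * x ord0 l)) =
  (fun x => step (K * x ord0 l - node M (al l)) + (- 1) * step (K * x ord0 l - node M (al l).+1)).
  by apply/funext => x; rewrite /hat mulN1r.
rewrite E; apply: (smooth_onD oT (smooth_on_step oT (sl _))).
exact: (smooth_onM oT (smooth_on_cst _ oT) (smooth_on_step oT (sl _))).
Qed.

Lemma lattice_approx_ge0 x : 0 <= lattice_approx x.
Proof.
apply: sumr_ge0 => al _; apply: mulr_ge0 => //.
by apply: prodr_ge0 => l _; exact: hat_ge0.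
Qed.

Let term_support (al : idx) x (F : 'I_n -> R) :
  (forall l, F l != 0 -> `|K * x ord0 l - node M (al l)| <= 2) ->
  psi (pt al) * \prod_l F l != 0 -> `|x| <= rho + 2.
Proof.
move=> hF; rewrite mulf_eq0 negb_or => /andP[/psi_supp p1 /prodf_neq0 p2].
rewrite -[x](subrK (pt al)) addrC; apply: le_trans (ler_normD _ _) _.
apply: lerD => //; apply: (@le_trans _ _ (2 / K)).
  by apply: pt_dist => l; apply: hF; exact: p2.
by rewrite ler_pdivrMr// ler_peMr.
Qed.

Lemma lattice_approx_support x : lattice_approx x != 0 -> `|x| <= rho + 2.
Proof.
apply: contraR => h; apply/eqP/big1 => al _; apply/eqP; apply: contraNT h.
by apply: term_support => l; exact: hat_support.
Qed.

Let box_coord x l : `|x| <= rho + 2 -> `|K * x ord0 l| + 1 <= M%:R.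
Proof.
move=> xr; apply: le_trans MK; rewrite lerD2r normrM gtr0_norm// ler_wpM2l ?(ltW K0)//.
exact: le_trans (coord_le_norm _ _) xr.
Qed.

Let psi_pt (al : idx) x (F : 'I_n -> R) :
  (forall l, F l != 0 -> `|K * x ord0 l - node M (al l)| <= 2) ->
  `|psi (pt al) - psi x| * \prod_l `|F l| <= L * (2 / K) * \prod_l `|F l|.
Proof.
move=> hF; have [->|p] := eqVneq (\prod_l `|F l|) 0; first by rewrite !mulr0.
apply: ler_wpM2r; first exact: prodr_ge0.
rewrite distrC; apply: le_trans (psiL _ _) _; rewrite ler_wpM2l//.
apply: pt_dist => l; apply: hF; move/prodf_neq0 : p => /(_ l isT).
by rewrite normr_eq0.
Qed.

(** On the cube of radius rho + 2 the weights sum to 1, and only lattice points within 2/K of x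
    carry weight: the error is an average of differences of psi over that distance. *)
Lemma lattice_approx_dist x : `|lattice_approx x - psi x| <= L * (2 / K).
Proof.
have [xr|xr] := leP `|x| (rho + 2); last first.
  have -> : lattice_approx x = 0.
    by apply/eqP; apply: contraTT xr => /lattice_approx_support; rewrite -leNgt.
  have -> : psi x = 0.
    apply/eqP; apply: contraTT xr => /psi_supp xr.
    by rewrite -leNgt (le_trans xr)// lerDl.
  by rewrite subrr normr0 mulr_ge0// divr_ge0// ltW.
have S1 : \sum_(al : idx) \prod_l hat M (al l) (K * x ord0 l) = 1.
  rewrite -(bigA_distr_bigA (fun l j => hat M (j : 'I_N) (K * x ord0 l))).
  by apply: big1 => l _; rewrite sum_hat1// box_coord.
have -> : lattice_approx x - psi x = \sum_(al : idx)
    (psi (pt al) - psi x) * \prod_l hat M (al l) (K * x ord0 l).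
  under [RHS]eq_bigr do rewrite mulrBl.
  by rewrite sumrB -mulr_sumr S1 mulr1.
apply: le_trans (ler_norm_sum _ _ _) _.
apply: (@le_trans _ _ (\sum_(al : idx) L * (2 / K) * \prod_l `|hat M (al l) (K * x ord0 l)|)).
  apply: ler_sum => al _; rewrite normrM normr_prod.
  by apply: (@psi_pt al x (fun l => hat M (al l) (K * x ord0 l))) => l; exact: hat_support.
rewrite -mulr_sumr (eq_bigr (fun al : idx => \prod_l hat M (al l) (K * x ord0 l))).
  by rewrite S1 mulr1.
by move=> al _; apply: eq_bigr => l _; rewrite ger0_norm// hat_ge0.
Qed.

Let factor (al : idx) i x l :=
  if l == i then dhat M (al l) (K * x ord0 l) else hat M (al l) (K * x ord0 l).

Lemma is_derive_lattice_approx i x :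
  is_derive x (unit_rV i) lattice_approx
    (\sum_(al : idx) K * (psi (pt al) * \prod_l factor al i x l)).
Proof.
apply: is_derive_bigsum => al.
(* Only the factor with index i varies along [unit_rV i]; the product P of the others is constant in
   that direction. *)
pose P (y : 'rV[R]_n) := \prod_(l | l != i) hat M (al l) (K * y ord0 l).
pose H (y : 'rV[R]_n) := hat M (al i) (K * y ord0 i).
have dP : is_derive x (unit_rV i) P 0.
  apply: is_derive_const_along => h; apply: eq_bigr => l li.
  by rewrite !mxE eqxx (negbTE li)/= mulr0 add0r.
have dH : is_derive x (unit_rV i) H (dhat M (al i) (K * x ord0 i) * K).
  apply: (@is_derive_comp1 R _ (hat M (al i)) (fun y : 'rV[R]_n => K * y ord0 i)).
    exact: is_derive_hat.
  have := is_deriveZ K (is_derive_coord (unit_rV i) x i).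
  by rewrite mxE !eqxx /GRing.scale/= mulr1.
have := is_deriveZ (psi (pt al)) (is_deriveM dH dP).
rewrite (_ : _ \*: _ = (fun y => psi (pt al) * \prod_l hat M (al l) (K * y ord0 l))); last first.
  by apply/funext => y; rewrite [in RHS](bigD1 i).
move=> /is_derive_eq; apply.
rewrite (bigD1 i)//= /factor eqxx scaler0 add0r /GRing.scale/=.
rewrite (eq_bigr (fun l => hat M (al l) (K * x ord0 l))); last first.
  by move=> l /negbTE ->.
by rewrite /P; ring.
Qed.

(** The scaling costs a factor K. But the differentiated weights sum to 0, so psi at the lattice
    points may be replaced by its difference to psi x, at most 2L/K, while the absolute values of
    these weights sum to at most 2D. The product K (2L/K) (2D) does not depend on K. *)
Lemma partial_lattice_approx_le D i x : (forall s, `|dstep s| <= D) ->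
  `|partial i lattice_approx x| <= 4 * L * D.
Proof.
move=> hD; have D0 : 0 <= D by apply: le_trans (hD 0).
case: (is_derive_lattice_approx i x) => _; rewrite /partial => ->.
have fsupp al l : factor al i x l != 0 -> `|K * x ord0 l - node M (al l)| <= 2.
  by rewrite /factor; case: ifP => _; [exact: dhat_support|exact: hat_support].
have [xr|xr] := leP `|x| (rho + 2); last first.
  rewrite big1 ?normr0 ?mulr_ge0// => al _.
  have [->|/term_support] := eqVneq (psi (pt al) * \prod_l factor al i x l) 0.
    by rewrite mulr0.
  by move=> /(_ x (fsupp al)); rewrite leNgt xr.
have S0 : \sum_(al : idx) \prod_l factor al i x l = 0.
  rewrite -(bigA_distr_bigA (fun l (j : 'I_N) =>
    if l == i then dhat M j (K * x ord0 l) else hat M j (K * x ord0 l))).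
  rewrite (bigD1 i)//= eqxx sum_dhat0 ?mul0r//; exact: box_coord.
rewrite -mulr_sumr.
rewrite (_ : \sum_(al : idx) _ = \sum_(al : idx) (psi (pt al) - psi x) * \prod_l factor al i x l); last first.
  by under [RHS]eq_bigr do rewrite mulrBl; rewrite sumrB -mulr_sumr S0 mulr0 subr0.
rewrite normrM gtr0_norm//; apply: (@le_trans _ _ (K * (\sum_(al : idx) L * (2 / K) * \prod_l `|factor al i x l|))).
  rewrite ler_wpM2l ?(ltW K0)//; apply: le_trans (ler_norm_sum _ _ _) _.
  apply: ler_sum => al _; rewrite normrM normr_prod.
  exact: psi_pt (fsupp al).
rewrite -mulr_sumr; set S := \sum_(al : idx) _.
suff S2 : S <= 2 * D.
  rewrite (_ : K * _ = L * 2 * S); last by field; rewrite gt_eqF.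
  apply: le_trans (ler_wpM2l _ S2) _; first by rewrite mulr_ge0.
  by rewrite le_eqVlt; apply/orP; left; apply/eqP; ring.
rewrite /S -(bigA_distr_bigA (fun l (j : 'I_N) =>
    `|if l == i then dhat M j (K * x ord0 l) else hat M j (K * x ord0 l)|)).
rewrite (bigD1 i)//= eqxx -[leRHS]mulr1; apply: ler_pM.
- by apply: sumr_ge0.
- by apply: prodr_ge0 => l _; apply: sumr_ge0.
- exact: sum_dhat_le.
- apply: (@le_trans _ _ (\prod_(l < n | l != i) 1)); last by rewrite big1.
  apply: ler_prod => l /negbTE ->; apply/andP; split; first exact: sumr_ge0.
  under eq_bigr do rewrite ger0_norm ?hat_ge0//; exact: sum_hat_le1.
Qed.

End lattice_approx.

Lemma lipschitz_smooth_approx {R : realType} {n : nat} (psi : 'rV[R]_n -> R) (L rho : R) :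
  0 <= L -> (forall x y, `|psi x - psi y| <= L * `|x - y|) ->
  (forall x, 0 <= psi x) -> (forall x, psi x != 0 -> `|x| <= rho) ->
  exists (C : R) (f : nat -> 'rV[R]_n -> R), forall k,
    [/\ smooth_on setT (f k), forall x, 0 <= f k x,
        forall x, f k x != 0 -> `|x| <= rho + 2,
        forall x, `|f k x - psi x| <= 2 * L / k.+1%:R &
        forall i x, `|partial i (f k) x| <= C].
Proof.
move=> L0 psiL psi0 psi_supp; have [D hD] := @dstep_bounded R.
exists (4 * L * D).
pose M k := (Num.truncn (k.+1%:R * (rho + 2) + 1)).+1.
have HM k : k.+1%:R * (rho + 2) + 1 <= (M k)%:R by apply: ltW; exact: truncnS_gt.
exists (fun k => lattice_approx psi (M k) k) => k; split.
- exact: smooth_lattice_approx.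
- exact: lattice_approx_ge0.
- move=> x; exact: lattice_approx_support.
- move=> x; have := lattice_approx_dist L0 psiL psi_supp (HM k) x.
  by rewrite mulrA [L * 2]mulrC.
- move=> i x; exact: (partial_lattice_approx_le L0 psiL psi_supp (HM k)).
Qed.

(** * Lipschitz functions of one variable *)

Section lipschitz_derivable.
Context {R : realType}.
Variables (f : R -> R) (k : R).
Hypothesis fk : forall x y, `|f x - f y| <= k * `|x - y|.

Let k0 : 0 <= k.
Proof. by have := le_trans (normr_ge0 _) (fk 1 0); rewrite subr0 normr1 mulr1. Qed.

Lemma lipschitz_continuousR : continuous f.
Proof.
move=> x; apply/cvgrPdist_le => e e0; near=> y.
apply: (le_trans (fk _ _)).
apply: (@le_trans _ _ (k * (e / (k + 1)))).
  rewrite ler_wpM2l//; near: y.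
  have /cvgrPdist_le : (y @[y --> x] --> x) by exact: cvg_id.
  by apply; rewrite divr_gt0// ltr_wpDl.
rewrite mulrCA ger_pMr// ler_pdivrMr ?ltr_wpDl// mul1r lerDl//.
Unshelve. all: by end_near. Qed.

Definition tilt x := f x + k * x.

Let tilt_nd : {homo tilt : x y / x <= y}.
Proof.
move=> x y xy; rewrite /tilt -subr_ge0.
have := fk x y; rewrite distrC (distrC x) (ger0_norm (_ : 0 <= y - x)) ?subr_ge0//.
by rewrite ler_norml => /andP[+ _]; lra.
Qed.

Let tilt_cont : continuous tilt.
Proof.
move=> x; apply: cvgD; first exact: lipschitz_continuousR.
by apply: cvgM; [exact: cvg_cst|exact: cvg_id].
Qed.

Let tilt_rc : right_continuous tilt.
Proof. exact: right_continuousW. Qed.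

HB.instance Definition _ := isCumulative.Build R _ R tilt tilt_nd tilt_rc.

Let nu := lebesgue_stieltjes_measure tilt.
Let mu := @lebesgue_measure R.

Let tilt_le x y : x <= y -> tilt y - tilt x <= 2 * k * (y - x).
Proof.
move=> xy; rewrite /tilt.
have := fk y x; rewrite (ger0_norm (_ : 0 <= y - x)) ?subr_ge0//.
by rewrite ler_norml => /andP[_]; lra.
Qed.

(** A half-open interval has Stieltjes measure at most 2k times its length, so a cover of A of small
    total length bounds the measure of A. The denominator 2k + 1 stays positive when k = 0. *)
Let nu_dom (A : set (measurableTypeR R)) : mu A = 0%E -> nu A = 0%E.
Proof.
move=> A0; apply/eqP; rewrite eq_le measure_ge0 andbT.
apply/lee_addgt0Pr => e e0; rewrite add0e.
have c0 : 0 < 2 * k + 1 by rewrite ltr_wpDl// mulr_ge0.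
have : (mu A < (e / (2 * k + 1))%:E)%E by rewrite A0 lte_fin divr_gt0.
move=> /ereal_inf_lt[_ [/= F [mF AF] <-]] sF.
apply: (@le_trans _ _ (\sum_(i <oo) wlength tilt (F i))%E).
  by apply: ereal_inf_lbound; exists F.
apply: (@le_trans _ _ (\sum_(i <oo) ((2 * k)%:E * wlength idfun (F i)))%E).
  apply: lee_nneseries => [i _ _|i _]; first exact: wlength_ge0.
  have [[a b] _ <-] := mF i; have [ab|ba] /= := leP a b.
    by rewrite !wlength_itv_bnd//= -EFinM lee_fin tilt_le.
  have -> : `]a, b]%classic = set0.
    by rewrite set_itv_ge// bnd_simp -leNgt ltW.
  by rewrite !wlength0 mule0.
rewrite nneseriesZl//.
apply: (@le_trans _ _ ((2 * k)%:E * (e / (2 * k + 1))%:E)%E).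
  by apply: lee_wpmul2l; [rewrite lee_fin mulr_ge0|exact: ltW].
by rewrite -EFinM lee_fin mulrCA ger_pMr// ler_pdivrMr// mul1r lerDl.
Qed.

(** Restricting the Stieltjes measure to a bounded interval makes it finite and its density
    integrable. On that interval the primitive of the density differs from f + k x by a constant,
    and it is differentiable almost everywhere. *)
Let derivable_itv (N : nat) :
  {ae mu, forall x, `|x| < N%:R -> derivable f x 1}.
Proof.
pose I : set (measurableTypeR R) := `]- (N%:R) , N%:R]%classic.
have mI : measurable I by exact: measurable_itv.
have nuI : (nu I < +oo)%E.
  rewrite /nu /lebesgue_stieltjes_measure /measure_extension measurable_mu_extE/=; last first.
    exact: is_ocitv.
  by rewrite wlength_itv_bnd ?ltry// (@le_trans _ _ 0)// oppr_le0.
pose nuN : {finite_measure set _ -> \bar R} := mfrestr mI nuI.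
have nm : nuN `<< mu.
  apply/null_content_dominatesP => A mA A0.
  rewrite /nuN /= /mfrestr /mrestr; apply: nu_dom.
  by apply: subset_measure0 A0 => //; exact: measurableI.
have [g [g0 gfin gint gE]] := radon_nikodym_sigma_finite nm.
pose h x := fine (g x).
have hE : EFin \o h = g by apply/funext => x /=; rewrite /h fineK.
have hint : mu.-integrable setT (EFin \o h) by rewrite hE.
have := @FTC1Ny R h; rewrite -/mu => /(_ _ _)/=.
have h1 y : mu.-integrable `]-oo, y] (EFin \o h) by exact: integrableS hint.
have h2 : locally_integrable [set: R] h.
  by apply: open_integrable_locally => //; exact: openT.
move=> /(_ h1 h2); apply: filterS; first exact: (ae_filter_ringOfSetsType mu).
move=> x [dF _] xN.
have FE y : - N%:R <= y <= N%:R ->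
    (\int[mu]_(t in `]-oo, y]) h t)%R = tilt y - tilt (- N%:R).
  move=> /andP[y1 y2].
  rewrite /Rintegral (eq_integral (fun x => g x)); last by move=> ? _; rewrite -hE.
  rewrite -gE/= ?/mfrestr ?/mrestr; last exact: measurable_itv.
  rewrite (_ : _ `&` _ = `]- N%:R, y]%classic); last first.
    rewrite /I; apply/seteqP; split => z /=; rewrite !in_itv/=.
      by move=> [-> /andP[-> _]].
    by move=> /andP[z1 z2]; rewrite z1 z2 (le_trans z2 y2).
  rewrite /nu /lebesgue_stieltjes_measure /measure_extension measurable_mu_extE/=; last first.
    exact: is_ocitv.
  by rewrite wlength_itv_bnd.
have dt : derivable tilt x 1.
  have : derivable ((fun y => (\int[mu]_(t in `]-oo, y]) h t)%R) + cst (tilt (- N%:R))) x 1.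
    by apply: derivableD.
  apply: near_eq_derivable; near=> y.
  rewrite /= fctE /cst FE ?subrK//.
  have : `|y| < N%:R.
    near: y.
    apply: (@cvgr_lt _ _ _ _ _ `|x|) => //.
    exact: cvg_norm.
  by rewrite ltr_norml => /andP[y1 y2]; rewrite !ltW.
rewrite (_ : f = tilt - (fun y => k * y)); last first.
  by apply/funext => y; rewrite !fctE /tilt addrK.
apply: derivableB => //.
Unshelve. all: by end_near. Qed.

(* The Stieltjes measure of the increasing function f + k x has a bounded density,
   to which Lebesgue differentiation applies. *)
Lemma lipschitz_derivable_ae : {ae mu, forall x, derivable f x 1}.
Proof.
have : {ae mu, forall x, forall N : nat, `|x| < N%:R -> derivable f x 1}.
  exact/ae_foralln/derivable_itv.
apply: filterS; first exact: (ae_filter_ringOfSetsType mu).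
move=> x; apply.
exact: (truncnS_gt `|x|).
Qed.

End lipschitz_derivable.

(** * Real-valued integrals *)

Section real_integrals.
Context d (T : measurableType d) (R : realType) (mu : {measure set T -> \bar R}).
Implicit Types (f g : T -> R) (P Q : T -> Prop).

Lemma ae_imp P Q : (forall x, P x -> Q x) ->
  {ae mu, forall x, P x} -> {ae mu, forall x, Q x}.
Proof. by move=> PQ; exact: filterS. Qed.

Lemma ae_imp2 P1 P2 Q : (forall x, P1 x -> P2 x -> Q x) ->
  {ae mu, forall x, P1 x} -> {ae mu, forall x, P2 x} -> {ae mu, forall x, Q x}.
Proof. by move=> PQ; exact: filterS2. Qed.

Lemma ae_forall (I : finType) (P : I -> T -> Prop) :
  (forall i, {ae mu, forall x, P i x}) -> {ae mu, forall x, forall i, P i x}.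
Proof. by move=> h; exact: filter_forall. Qed.

Definition rintegrable f := mu.-integrable setT (EFin \o f).

Lemma rintegrable_measurable f : rintegrable f -> measurable_fun setT f.
Proof. by move=> /measurable_int/measurable_EFinP. Qed.

Lemma rintegrableD f g : rintegrable f -> rintegrable g -> rintegrable (fun x => f x + g x).
Proof. by move=> fi gi; have := integrableD measurableT fi gi. Qed.

Lemma rintegrableB f g : rintegrable f -> rintegrable g -> rintegrable (fun x => f x - g x).
Proof. by move=> fi gi; have := integrableB measurableT fi gi. Qed.

Lemma rintegrableZ (c : R) f : rintegrable f -> rintegrable (fun x => c * f x).
Proof. by move=> fi; have := integrableZl measurableT c fi. Qed.

Lemma rintegrable_sum (I : Type) (r : seq I) (F : I -> T -> R) : (forall i, rintegrable (F i)) ->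
  rintegrable (fun x => \sum_(i <- r) F i x).
Proof.
move=> iF; elim: r => [|i r IH].
  by under eq_fun do rewrite big_nil; exact: integrable0.
by under eq_fun do rewrite big_cons; exact: rintegrableD.
Qed.

Lemma rintegral_sum (I : Type) (r : seq I) (F : I -> T -> R) : (forall i, rintegrable (F i)) ->
  (\int[mu]_x (\sum_(i <- r) F i x) = \sum_(i <- r) \int[mu]_x F i x)%R.
Proof.
move=> iF; elim: r => [|i r IH].
  rewrite big_nil /Rintegral (eq_integral (cst 0%E)) ?integral0//.
  by move=> x _; rewrite big_nil.
rewrite big_cons -IH -RintegralD//; [|exact: iF|exact: rintegrable_sum].
by apply: eq_Rintegral => x _; rewrite big_cons.
Qed.

Lemma rintegrable_norm f : rintegrable f -> rintegrable (fun x => `|f x|).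
Proof. by move=> fi; have := integrable_norm fi. Qed.

Lemma rintegrable_le f g : measurable_fun setT f ->
  (forall x, `|f x| <= g x) -> rintegrable g -> rintegrable f.
Proof.
move=> mf fg; apply: le_integrable => //; first exact/measurable_EFinP.
by move=> x _ /=; rewrite lee_fin (le_trans (fg x))// ler_norm.
Qed.

Lemma rintegrable_fin_num f : rintegrable f -> (\int[mu]_x (f x)%:E)%E \is a fin_num.
Proof. by move=> fi; exact: integrable_fin_num. Qed.

Lemma fine_rintegral f : rintegrable f ->
  ((\int[mu]_x f x)%R%:E = \int[mu]_x (f x)%:E)%E.
Proof. by move=> fi; rewrite /Rintegral fineK//; exact: rintegrable_fin_num. Qed.

Lemma ae_le_rintegral f g : rintegrable f -> rintegrable g ->
  {ae mu, forall x, f x <= g x} -> (\int[mu]_x f x)%R <= (\int[mu]_x g x)%R.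
Proof.
move=> fi gi fg; rewrite -subr_ge0 -RintegralB//.
rewrite -lee_fin fine_rintegral; last exact: rintegrableB.
have mgf : measurable_fun setT (fun x => g x - f x).
  by apply: rintegrable_measurable; exact: rintegrableB.
(* The inequality holds only almost everywhere; the integrand is replaced by its positive part,
   which is nonnegative at every point. *)
rewrite (@ae_eq_integral _ _ _ mu setT (fun x => (Num.max (g x - f x) 0)%:E))//.
- by apply: integral_ge0 => x _; rewrite lee_fin le_max lexx orbT.
- exact/measurable_EFinP.
- by apply/measurable_EFinP; exact: measurable_maxr.
- by apply: ae_imp fg => x fgx _; congr (_%:E); rewrite max_l// subr_ge0.
Qed.

Lemma ae_eq_rintegral f g : measurable_fun setT f -> measurable_fun setT g ->
  {ae mu, forall x, f x = g x} -> (\int[mu]_x f x)%R = (\int[mu]_x g x)%R.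
Proof.
move=> mf mg fg; rewrite /Rintegral; congr fine; apply: ae_eq_integral => //.
- exact/measurable_EFinP.
- exact/measurable_EFinP.
- by apply: ae_imp fg => x -> _.
Qed.

Lemma rintegral_dominated (f_ : nat -> T -> R) f g :
  (forall k, measurable_fun setT (f_ k)) -> measurable_fun setT f ->
  {ae mu, forall x, f_ k x @[k --> \oo] --> f x} ->
  rintegrable g -> {ae mu, forall x, forall k, `|f_ k x| <= g x} ->
  [/\ rintegrable f,
      (\int[mu]_x `|(f_ k x)%:E - (f x)%:E|)%E @[k --> \oo] --> (0 : \bar R)%E &
      (\int[mu]_x f_ k x)%R @[k --> \oo] --> (\int[mu]_x f x)%R].
Proof.
move=> mf_ mf f_f gi f_g.
have mf_' k : measurable_fun setT (fun x => (f_ k x)%:E) by exact/measurable_EFinP.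
have mf' : measurable_fun setT (fun x => (f x)%:E) by exact/measurable_EFinP.
have h1 : {ae mu, forall x, [set: T] x -> (f_ k x)%:E @[k --> \oo] --> (f x)%:E}.
  by apply: ae_imp f_f => x fx _; apply: cvg_EFin => //; exact: nearW.
have h2 : {ae mu, forall x k, [set: T] x -> (`|(f_ k x)%:E| <= (EFin \o g) x)%E}.
  by apply: ae_imp f_g => x fx k _ /=; rewrite lee_fin.
have [fi C1 C2] := dominated_convergence measurableT mf_' mf' h1 gi h2.
split => //; rewrite /Rintegral; apply: fine_cvg.
by rewrite fineK//; exact: rintegrable_fin_num.
Qed.

Lemma rintegrableM_bounded f g (C : R) : rintegrable f -> measurable_fun setT g ->
  (forall x, `|g x| <= C) -> rintegrable (fun x => f x * g x).
Proof.
move=> fi mg gC; apply: (@rintegrable_le _ (fun x => C * `|f x|)).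
- by apply: measurable_funM => //; exact: rintegrable_measurable fi.
- by move=> x; rewrite normrM mulrC ler_wpM2r.
- by apply: rintegrableZ; exact: rintegrable_norm.
Qed.

Section finite_support.
Variable B : set T.
Hypotheses (mB : measurable B) (Boo : (mu B < +oo)%E).

Lemma rintegrable_indic : rintegrable \1_B.
Proof.
apply/integrableP; split; first exact/measurable_EFinP/measurable_indic.
rewrite (eq_integral (fun x => (\1_B x)%:E)).
  by rewrite integral_indic// setIT.
by move=> x _; rewrite gee0_abs// lee_fin.
Qed.

Lemma rintegrable_bounded_support f (C : R) :
  measurable_fun setT f -> (forall x, `|f x| <= C) ->
  (forall x, f x != 0 -> B x) -> rintegrable f.
Proof.
move=> mf fC fB.
apply: (@rintegrable_le _ (fun x => C * \1_B x)) => //; last first.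
  by apply: rintegrableZ; exact: rintegrable_indic.
move=> x; rewrite indicE.
have [fx0|/fB Bx] := eqVneq (f x) 0; last by rewrite mem_set// mulr1.
by rewrite fx0 normr0 mulr_ge0// (le_trans _ (fC x)).
Qed.

End finite_support.

(** Meant for difference quotients: g is a translate of f, and translation invariance supplies the
    equality of the integrals. *)
Lemma rintegral_scaled_diff0 f g (c : R) : rintegrable f -> rintegrable g ->
  (\int[mu]_x (g x)%:E = \int[mu]_x (f x)%:E)%E ->
  (\int[mu]_x (c * (g x - f x))%:E = 0)%E.
Proof.
move=> fi gi gf.
rewrite (eq_integral (fun x => c%:E * ((g x)%:E - (f x)%:E))%E); last first.
  by move=> x _; rewrite -EFinB -EFinM.
rewrite integralZl//; last exact: integrableB.
by rewrite integralB_EFin// gf subee ?mule0//; exact: integrable_fin_num.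
Qed.

End real_integrals.

(** * Lebesgue measure on row vectors *)

Section borel_sets.
Context {R : realType} {n : nat}.
Implicit Types (x : 'rV[R]_n) (A : set 'rV[R]_n).

Let box (q : 'rV[R]_n) (e : R) : set 'rV[R]_n :=
  [set x | forall i, `|x ord0 i - q ord0 i| < e].

Let measurable_box q e : measurable (box q e).
Proof.
rewrite (_ : box q e = \big[setI/setT]_(i < n)
    (rV_coord i @^-1` [set t : measurableTypeR R | `|t - q ord0 i| < e])).
  apply: bigsetI_measurable => i _; rewrite -[X in measurable X]setTI.
  apply: measurable_rV_coord => //.
  have := @open_measurable R [set t : R | `|t - q ord0 i| < e]; apply.
  have -> : [set t : R | `|t - q ord0 i| < e] = ball (q ord0 i) e.
    by apply/seteqP; split => t; rewrite /ball/= distrC.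
  by have [e0|e0] := leP e 0; [rewrite (ball0 _ _).2//; exact: open0|exact: ball_open].
rewrite -bigcap_seq; apply/seteqP; split => x /= h i; first by move=> _; exact: h.
by apply: (h i); rewrite /= mem_index_enum.
Qed.

(** U is the union of those boxes with rational centre and radius 1/(m+1) that lie in U, enumerated
    through [pickle]. Since 2/(m+1) < e for the chosen m, a box whose centre is within its radius of
    x stays in the ball of radius e about x. *)
Lemma open_measurable_rV (U : set 'rV[R]_n) : open U -> measurable U.
Proof.
move=> oU.
pose q (r : 'rV[rat]_n) : 'rV[R]_n := \row_i ratr (r ord0 i).
pose F k := if @unpickle ('rV[rat]_n * nat)%type k is Some (r, m)
  then if `[< box (q r) m.+1%:R^-1 `<=` U >] then box (q r) m.+1%:R^-1 else set0
  else set0.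
suff -> : U = \bigcup_k F k.
  apply: bigcupT_measurable => k; rewrite /F; case: unpickle => [[r m]|//].
  by case: ifP => // _; exact: measurable_box.
apply/seteqP; split => [x Ux|x [k _]]; last first.
  rewrite /F; case: unpickle => [[r m]|//].
  by case: ifP => // /asboolP + bx; apply.
have /nbhs_ballP[e /= e0 xeU] : nbhs x U by exact: open_nbhs_nbhs.
pose m := Num.truncn (2 / e).
pose d : R := m.+1%:R^-1.
have d0 : 0 < d by rewrite invr_gt0.
have de : d + d < e.
  rewrite -[d + d]mulr2n -mulr_natl /d ltr_pdivrMr// mulrC -ltr_pdivrMr//.
  exact: truncnS_gt.
have /choice[r hr] : forall i, exists r : rat, `|x ord0 i - ratr r| < d.
  move=> i; have := @rat_in_itvoo R (x ord0 i - d) (x ord0 i + d).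
  have lt1 : x ord0 i - d < x ord0 i + d by lra.
  move=> /(_ lt1)[r]; rewrite in_itv/= => /andP[r1 r2]; exists r.
  by rewrite ltr_norml; apply/andP; split; lra.
pose rr : 'rV[rat]_n := \row_i r i.
have xb : box (q rr) d x by move=> i; rewrite !mxE.
exists (pickle (rr, m)) => //; rewrite /F pickleK -/d ifT//.
apply/asboolP => y yb; apply: xeU; rewrite /ball/= /mx_ball; split => // i j; rewrite ord1.
rewrite /ball/=; have := yb j; have := xb j; rewrite !ltr_norml => /andP[? ?] /andP[? ?].
by apply/andP; split; lra.
Qed.

Lemma closed_measurable_rV (F : set 'rV[R]_n) : closed F -> measurable F.
Proof.
by move=> cF; have := measurableC (open_measurable_rV (closed_openC cF)); rewrite setCK.
Qed.

Lemma continuous_measurable_rV (f : 'rV[R]_n -> R) : continuous f ->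
  measurable_fun [set: 'rV[R]_n] (f : 'rV[R]_n -> measurableTypeR R).
Proof.
move=> /continuousP cf; apply: (measurability _ (RGenOpens.measurableE R)).
move=> _ [_ [a [b ->] <-]]; rewrite setTI.
by apply: open_measurable_rV; apply: cf; exact: interval_open.
Qed.

End borel_sets.

Section lebesgue_rV_basics.
Context {R : realType} {n : nat}.
Implicit Types (A : set 'rV[R]_n).

Lemma borel_lebesgue A : measurable A -> measurable (A : set (lebesgue_rVType R n)).
Proof. by move=> mA; apply: sub_caratheodory; exact: sub_sigma_algebra. Qed.

Lemma lebesgue_rVE A : measurable A -> lebesgue_rV R n A = lebesgue_borel R n A.
Proof. by move=> mA; exact: measurable_mu_extE. Qed.

Lemma measurable_lebesgue_id :
  measurable_fun [set: lebesgue_rVType R n] (id : lebesgue_rVType R n -> 'rV[R]_n).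
Proof. by move=> _ A mA; rewrite setTI; exact: borel_lebesgue. Qed.

Lemma borel_lebesgue_fun (f : 'rV[R]_n -> R) :
  measurable_fun [set: 'rV[R]_n] (f : 'rV[R]_n -> measurableTypeR R) ->
  lebesgue_measurable_fun setT f.
Proof. by move=> mf; exact: (measurableT_comp mf measurable_lebesgue_id). Qed.

Lemma continuous_lebesgue_fun (f : 'rV[R]_n -> R) : continuous f ->
  lebesgue_measurable_fun setT f.
Proof. by move=> cf; apply: borel_lebesgue_fun; exact: continuous_measurable_rV. Qed.

Lemma lebesgue_rV_complete : measure_is_complete (lebesgue_rV R n).
Proof. exact: measure_is_complete_caratheodory. Qed.

Lemma borel_ae (P : set 'rV[R]_n) : {ae lebesgue_borel R n, forall x, P x} ->
  {ae lebesgue_rV R n, forall x, P x}.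
Proof.
move=> [N [mN N0 PN]]; exists N; split => //; first exact: borel_lebesgue.
by rewrite [LHS]lebesgue_rVE.
Qed.

(** The identity is measurable from the completed to the Borel sigma-algebra and pushes one measure
    to the other; Borel integrands can thus be handled with the iterated product measure. *)
Lemma ge0_integral_lebesgue_borel (f : 'rV[R]_n -> \bar R) :
  measurable_fun [set: 'rV[R]_n] f -> (forall x, 0 <= f x)%E ->
  (\int[lebesgue_rV R n]_x (f : lebesgue_rVType R n -> \bar R) x =
   \int[lebesgue_borel R n]_x (f x))%E.
Proof.
move=> mf f0.
transitivity (\int[pushforward (lebesgue_rV R n) (id : lebesgue_rVType R n -> 'rV[R]_n)]_x f x)%E.
  by rewrite (ge0_integral_pushforward measurable_lebesgue_id).
apply: (@eq_measure_integral _ _ _ setT (lebesgue_borel R n)) => [|mid A mA _]; first exact: measurable_lebesgue_id.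
transitivity (lebesgue_rV R n A); first by [].
exact: lebesgue_rVE.
Qed.

End lebesgue_rV_basics.

(** * Translations and null sets of the iterated product measure *)

Section lebesgue_borel_theory.
Context {R : realType}.

Lemma lebesgue_measure_shift (c : R) (A : set (measurableTypeR R)) : measurable A ->
  lebesgue_measure ((fun t : R => t + c) @^-1` A) = lebesgue_measure A.
Proof.
move=> mA; apply/esym.
have ms : measurable_fun setT (fun t : measurableTypeR R => t + c : measurableTypeR R).
  by apply: measurable_funD => //; exact: measurable_id.
pose sh : {mfun _ >-> _} := HB.pack (fun t : measurableTypeR R => t + c : measurableTypeR R)
  (isMeasurableFun.Build _ _ _ _ _ ms).
rewrite (@lebesgue_measure_unique R (pushforward lebesgue_measure sh))//.
move=> _ [[a b] _ <-].
rewrite [RHS](_ : _ = lebesgue_measure (`]a - c, b - c]%classic : set R)); last first.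
  congr (lebesgue_measure _).
  by apply/seteqP; split => t /=; rewrite !in_itv/= => /andP[? ?]; apply/andP; split; lra.
rewrite !lebesgue_measure_itv/= !lte_fin ltrD2r; case: ifP => // _.
by rewrite -!EFinD; congr (_%:E); ring.
Qed.

Lemma measurable_rV_add n (v : 'rV[R]_n) :
  measurable_fun [set: 'rV[R]_n] (fun x => x + v).
Proof.
apply: measurable_fun_rV => i.
rewrite (_ : _ \o _ = (fun x => rV_coord i x + v ord0 i : measurableTypeR R)).
  by apply: measurable_funD => //; exact: measurable_rV_coord.
by apply/funext => x; rewrite /rV_coord/= mxE.
Qed.

Lemma rV_cons0 n (t : R) (x : 'rV[R]_n) : rV_cons (t, x) ord0 ord0 = t.
Proof. by have := congr1 fst (rV_consK (t, x)). Qed.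

Lemma rV_cons_lift n (t : R) (x : 'rV[R]_n) j :
  rV_cons (t, x) ord0 (lift ord0 j) = x ord0 j.
Proof.
have := congr1 snd (rV_consK (t, x)) => /= /rowP/(_ j) <-.
by rewrite [RHS]mxE; congr (fun_of_matrix (rV_cons (t, x)) ord0 _); exact: val_inj.
Qed.

Lemma rV_cons_add n (t s : R) (x y : 'rV[R]_n) :
  rV_cons (t, x) + rV_cons (s, y) = rV_cons (t + s, x + y).
Proof.
by apply/rowP => i; case: (unliftP ord0 i) => [j ->|->];
  rewrite mxE ?(rV_cons_lift, rV_cons0)// mxE.
Qed.

Lemma rV_unconsK n : cancel (@rV_uncons R n) (@rV_cons R n).
Proof.
move=> x; apply/rowP => i; case: (unliftP ord0 i) => [j ->|->].
  by rewrite rV_cons_lift mxE; congr (x _ _); exact: val_inj.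
by rewrite rV_cons0.
Qed.

Lemma lebesgue_borelS n (A : set 'rV[R]_n.+1) :
  lebesgue_borel R n.+1 A =
  (@lebesgue_measure R \x lebesgue_borel R n)%E (@rV_cons R n @^-1` A).
Proof. by []. Qed.

Lemma measurable_rV_cons_preimage n (A : set 'rV[R]_n.+1) : measurable A ->
  measurable (@rV_cons R n @^-1` A).
Proof. by move=> mA; rewrite -[X in measurable X]setTI; exact: measurable_rV_cons. Qed.

(** Induction on the dimension: the product measure and its translate agree on rectangles, which
    determine it. *)
Lemma lebesgue_borel_shift n (v : 'rV[R]_n) (A : set 'rV[R]_n) : measurable A ->
  lebesgue_borel R n ((fun x => x + v) @^-1` A) = lebesgue_borel R n A.
Proof.
elim: n v A => [|n IH] v A mA.
  rewrite (_ : (fun x => x + v) = id) ?preimage_id//.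
  by apply/funext => x; apply/rowP => -[].
rewrite !lebesgue_borelS.
pose sh (p : measurableTypeR R * 'rV[R]_n) : measurableTypeR R * 'rV[R]_n :=
  (p.1 + (rV_uncons v).1, p.2 + (rV_uncons v).2).
have msh : measurable_fun setT sh.
  apply/measurable_fun_pairP; split.
    by apply: measurable_funD => //; exact: measurable_fst.
  exact: (measurableT_comp (measurable_rV_add (rV_uncons v).2) measurable_snd).
pose shm : {mfun _ >-> _} := HB.pack sh (isMeasurableFun.Build _ _ _ _ _ msh).
rewrite [RHS](@product_measure_unique _ _ _ _ R lebesgue_measure (lebesgue_borel R n)
  (pushforward (lebesgue_measure \x lebesgue_borel R n)%E shm)); last first.
- exact: measurable_rV_cons_preimage.
- move=> B C mB mC; transitivity ((lebesgue_measure \x lebesgue_borel R n)%E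
    (((fun t : R => t + (rV_uncons v).1) @^-1` B) `*`
      ((fun x => x + (rV_uncons v).2) @^-1` C))); first by [].
  rewrite product_measure1E.
  + by congr (_ * _)%E; [exact: (lebesgue_measure_shift (rV_uncons v).1 mB)|exact: IH].
  + rewrite -[X in measurable X]setTI.
    have ms : measurable_fun setT (fun t : measurableTypeR R => t + (rV_uncons v).1 : measurableTypeR R).
      by apply: measurable_funD => //; exact: measurable_id.
    exact: ms.
  + by rewrite -[X in measurable X]setTI; exact: measurable_rV_add.
have shE p : rV_cons p + v = rV_cons (sh p).
  case: p => t x; rewrite -{1}(rV_unconsK v) [rV_uncons v]surjective_pairing.
  by rewrite rV_cons_add.
have E : @rV_cons R n @^-1` ((fun x => x + v) @^-1` A) = sh @^-1` (@rV_cons R n @^-1` A).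
  apply/seteqP; split => p Ap.
    by have : A (rV_cons p + v) := Ap; rewrite shE.
  by have : A (rV_cons (sh p)) := Ap; rewrite -shE.
by rewrite E.
Qed.

Lemma lebesgue_borel_cube n (r : R) :
  (lebesgue_borel R n [set x : 'rV[R]_n | forall i, (`|x ord0 i| <= r)%R] < +oo)%E.
Proof.
elim: n => [|n IH].
  by rewrite /= /dirac/= ltry.
rewrite lebesgue_borelS.
rewrite (_ : _ @^-1` _ = (`[- r, r]%classic : set (measurableTypeR R)) `*` [set x : 'rV[R]_n | forall i, `|x ord0 i| <= r]).
  rewrite product_measure1E; last 2 first.
  - exact: measurable_itv.
  - rewrite (_ : [set x : 'rV[R]_n | _] = \big[setI/setT]_(i < n) (rV_coord i @^-1` (`[- r, r]%classic : set (measurableTypeR R)))).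
      apply: bigsetI_measurable => i _; rewrite -[X in measurable X]setTI.
      exact: measurable_rV_coord.
    rewrite -bigcap_seq; apply/seteqP; split => x /= h i.
      by move=> _; rewrite /= in_itv/= -ler_norml; exact: h.
    by have := h i; rewrite /= in_itv/= -ler_norml; apply; rewrite mem_index_enum.
  have Hf : (lebesgue_measure (`[(- r)%R, r]%classic : set R) < +oo)%E.
    by rewrite lebesgue_measure_itv/=; case: ifP => // _; rewrite -EFinB ltry.
  by apply: lte_mul_pinfty => //; rewrite ge0_fin_numE.
apply/seteqP; split => [[t x] /= h|[t x] /= [ht hx] i].
  split=> [|i]; first by have := h ord0; rewrite rV_cons0 in_itv/= -ler_norml.
  by have := h (lift ord0 i); rewrite rV_cons_lift.
case: (unliftP ord0 i) => [j ->|->]; first by rewrite rV_cons_lift.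
by rewrite rV_cons0 ler_norml; move: ht; rewrite in_itv.
Qed.

(** Fubini, by induction on the dimension. If i is not the first coordinate, every slice with fixed
    first coordinate is null by induction; if it is, the order of integration is exchanged and the
    inner sections are the lines themselves. *)
Lemma lebesgue_borel_lines n (i : 'I_n) (N : set 'rV[R]_n) : measurable N ->
  (forall x, lebesgue_measure [set t : measurableTypeR R | N (t *: unit_rV i + x)] = 0%E) ->
  lebesgue_borel R n N = 0%E.
Proof.
elim: n i N => [[]//|n IH] i N mN hN.
have mN' := measurable_rV_cons_preimage mN.
rewrite lebesgue_borelS.
have [j ij|i0] := unliftP ord0 i.
  have E (t s : R) (x : 'rV[R]_n) :
      rV_cons (t, s *: unit_rV j + x) = s *: unit_rV i + rV_cons (t, x).
    apply/rowP => l; rewrite [RHS]mxE ij; case: (unliftP ord0 l) => [m ->|->].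
      by rewrite !rV_cons_lift !mxE (inj_eq lift_inj).
    by rewrite !rV_cons0 !mxE eqxx (negbTE (neq_lift _ _)) mulr0 add0r.
  rewrite /product_measure1 integral0_eq// => t _ /=; apply: (IH j).
    exact: measurable_xsection.
  move=> x; rewrite -[RHS](hN (rV_cons (t, x))); congr (lebesgue_measure _).
  by apply/seteqP; split => s /=; rewrite /xsection/= inE/= E.
have E (s : R) (x : 'rV[R]_n) : rV_cons (s, x) = s *: unit_rV i + rV_cons (0, x).
  apply/rowP => l; rewrite [RHS]mxE i0; case: (unliftP ord0 l) => [m ->|->].
    by rewrite !rV_cons_lift !mxE eqxx eq_sym (negbTE (neq_lift _ _)) mulr0 add0r.
  by rewrite !rV_cons0 !mxE !eqxx mulr1 addr0.
rewrite (@product_measure_unique _ _ _ _ R lebesgue_measure (lebesgue_borel R n)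
  (lebesgue_measure \x^ lebesgue_borel R n)%E)//; last first.
  by move=> B C mB mC; rewrite /= product_measure2E.
transitivity (\int[lebesgue_borel R n]_y
  (@lebesgue_measure R \o ysection (@rV_cons R n @^-1` N)) y)%E; first by [].
rewrite integral0_eq// => x _ /=.
rewrite -[RHS](hN (rV_cons (0, x))); congr (lebesgue_measure _).
by apply/seteqP; split => s /=; rewrite /ysection/= inE/= (E s x).
Qed.

End lebesgue_borel_theory.

(** * Partial derivatives of Lipschitz functions *)

Section partial_ae.
Context {R : realType} {n : nat}.
Implicit Types (x y : 'rV[R]_n) (i : 'I_n).

(** Along a single axis, a bound on one partial derivative is itself a Lipschitz constant, with no
    factor depending on n. *)
Definition dir_lipschitz i (L : R) (f : 'rV[R]_n -> R) :=
  forall x (h : R), `|f (h *: unit_rV i + x) - f x| <= L * `|h|.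

Definition diff_quot i (f : 'rV[R]_n -> R) (h : R) x : R :=
  h^-1 * (f (h *: unit_rV i + x) - f x).

Variables (i : 'I_n) (L : R) (f : 'rV[R]_n -> R).
Hypotheses (fc : continuous f) (fL : dir_lipschitz i L f).

Lemma diff_quot_continuous h : continuous (diff_quot i f h).
Proof.
have c1 : continuous (fun x => f (h *: unit_rV i + x)).
  move=> x; apply: (@continuous_comp _ _ _ (fun x => h *: unit_rV i + x) f); last exact: fc.
  by apply: continuousD; [exact: cst_continuous|exact: cvg_id].
move=> x; apply: (@continuousM _ _ (cst h^-1) (fun x => f (h *: unit_rV i + x) - f x)).
  exact: cst_continuous.
by apply: continuousB; [exact: c1|exact: fc].
Qed.

Lemma diff_quot_le h x : `|diff_quot i f h x| <= L.
Proof.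
have [->|h0] := eqVneq h 0.
  rewrite /diff_quot invr0 mul0r normr0.
  by have := le_trans (normr_ge0 _) (fL x 1); rewrite normr1 mulr1.
by rewrite normrM normfV ler_pdivrMl ?normr_gt0// mulrC fL.
Qed.

Let F (k m : nat) : set 'rV[R]_n := [set x | forall h h' : R, h != 0 -> h' != 0 ->
  `|h| < m.+1%:R^-1 -> `|h'| < m.+1%:R^-1 ->
  `|diff_quot i f h x - diff_quot i f h' x| <= k.+1%:R^-1].

(** Uncountably many pairs of increments are involved; measurability survives because each condition
    is closed in x, the difference quotients being continuous. *)
Let closed_F k m : closed (F k m).
Proof.
have -> : F k m = \bigcap_(p in [set p : R * R | [/\ p.1 != 0, p.2 != 0,
    `|p.1| < m.+1%:R^-1 & `|p.2| < m.+1%:R^-1]])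
    ((fun x => `|diff_quot i f p.1 x - diff_quot i f p.2 x|) @^-1` [set t | t <= k.+1%:R^-1]).
  apply/seteqP; split => x /= h.
    by move=> [h1 h2] [? ? ? ?]; exact: h.
  by move=> h1 h2 ? ? ? ?; exact: (h (h1, h2)).
apply: closed_bigI => -[h1 h2] _ /=.
apply: closed_comp; last exact: closed_le.
have c : continuous (fun x => `|diff_quot i f h1 x - diff_quot i f h2 x|).
  move=> x; apply: (@continuous_comp _ _ _
    (fun x => diff_quot i f h1 x - diff_quot i f h2 x) (fun t : R => `|t|)).
    by apply: continuousB; exact: diff_quot_continuous.
  exact: norm_continuous.
by move=> x _; exact: c.
Qed.

Let S := \bigcap_k \bigcup_m F k m.

Let measurable_S : measurable S.
Proof.
apply: bigcapT_measurable => k; apply: bigcupT_measurable => m.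
exact: closed_measurable_rV.
Qed.

Let S_derivable x : S x -> derivable f x (unit_rV i).
Proof.
move=> Sx; rewrite /derivable; apply: cauchy_cvg; apply: cauchy_exP => e e0.
have [k hk] : exists k : nat, k.+1%:R^-1 < e.
  exists (Num.truncn e^-1); rewrite invf_plt ?posrE//; exact: truncnS_gt.
have [m _ Fm] := Sx k I.
pose d : R := m.+1%:R^-1; have d0 : 0 < d by rewrite invr_gt0.
exists (diff_quot i f (d / 2) x).
suff : \forall h \near 0^', ball (diff_quot i f (d / 2) x) e (diff_quot i f h x) by [].
near=> h; rewrite /ball/=.
apply: le_lt_trans hk; apply: Fm.
- by rewrite gt_eqF// divr_gt0.
- by near: h; exact: nbhs_dnbhs_neq.
- by rewrite gtr0_norm ?divr_gt0// -/d ltr_pdivrMr// ltr_pMr// ltr1n.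
- by near: h; exact: dnbhs0_lt.
Unshelve. all: by end_near. Qed.

Let derivable_S x : derivable f x (unit_rV i) -> S x.
Proof.
move=> /cvg_ex[/= l /cvgrPdist_lt fl] k _.
have e0 : 0 < (k.+1%:R^-1 / 2 : R) by rewrite divr_gt0.
have /nbhs_ballP[d /= d0 H] := fl _ e0.
exists (Num.truncn d^-1) => // h h' h0 h'0 hd h'd.
have dd : (Num.truncn d^-1).+1%:R^-1 < d.
  by rewrite invf_plt ?posrE//; exact: truncnS_gt.
have K s : s != 0 -> `|s| < (Num.truncn d^-1).+1%:R^-1 -> `|l - diff_quot i f s x| < k.+1%:R^-1 / 2.
  by move=> s0 sd; apply: H => //; rewrite /ball/= sub0r normrN (lt_trans sd).
rewrite (_ : _ - _ = (l - diff_quot i f h' x) - (l - diff_quot i f h x)); last by ring.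
apply: le_trans (ler_normB _ _) _; rewrite [leRHS]splitr; apply: lerD; apply: ltW; exact: K.
Qed.

Let measurable_line x :
  measurable_fun setT (fun t : measurableTypeR R => t *: unit_rV i + x).
Proof.
apply: measurable_fun_rV => j.
rewrite (_ : _ \o _ = (fun t => t * (unit_rV i : 'rV[R]_n) ord0 j + x ord0 j : measurableTypeR R)).
  by apply: measurable_funD => //; apply: measurable_funM => //; exact: measurable_id.
by apply/funext => t; rewrite /rV_coord /= !mxE.
Qed.

(* The points where the difference quotients are Cauchy form a Borel set, and by
   the one-dimensional case its complement is null on every line. *)
Lemma partial_derivable_ae : {ae lebesgue_rV R n, forall x, derivable f x (unit_rV i)}.
Proof.
have SC0 : lebesgue_borel R n (~` S) = 0%E.
  apply: (lebesgue_borel_lines (i := i)); first exact: measurableC.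
  move=> x; pose g t := f (t *: unit_rV i + x).
  have gL s t : `|g s - g t| <= L * `|s - t|.
    have := fL (t *: unit_rV i + x) (s - t).
    by rewrite addrA -scalerDl subrK.
  have [N [mN N0 gN]] := lipschitz_derivable_ae gL.
  apply: (@subset_measure0 _ _ _ lebesgue_measure _ N) => //.
    rewrite -[X in measurable X]setTI; apply: (measurable_line x) => //.
    exact: measurableC.
  move=> t /= nS; apply: gN => /= dg; apply: nS; apply: derivable_S.
  apply/derivable1P; move/derivable1P : dg.
  rewrite (_ : (fun h => g _) = (fun h => f (h *: unit_rV i + (t *: unit_rV i + x))))//.
  by apply/funext => h; rewrite /g [h%:A]mulr1 addrA -scalerDl.
apply: borel_ae; exists (~` S); split => //; first exact: measurableC.
by move=> x /= nd Sx; apply: nd; exact: S_derivable.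
Qed.

Lemma diff_quot_cvg x : derivable f x (unit_rV i) ->
  diff_quot i f k.+1%:R^-1 x @[k --> \oo] --> partial i f x.
Proof.
move=> df; have H : diff_quot i f h x @[h --> 0^'] --> partial i f x by exact: df.
apply/cvgrPdist_lt => e e0.
move/cvgrPdist_lt : (H) => /(_ e e0)/nbhs_ballP[d /= d0 Hd].
near=> k; apply: Hd; last by rewrite /= gt_eqF// invr_gt0.
rewrite /ball/= sub0r normrN gtr0_norm ?invr_gt0//.
by near: k; exact: (near_infty_natSinv_lt (PosNum d0)).
Unshelve. all: by end_near. Qed.

(** Almost everywhere the partial derivative is the upper limit of the continuous quotients with
    increments 1/(k+1); completeness of the sigma-algebra takes care of the exceptional set. *)
Lemma partial_measurable : lebesgue_measurable_fun setT (partial i f).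
Proof.
have [N [mN N0 hN]] := partial_derivable_ae.
apply/measurable_EFinP.
apply: (@ae_measurable_fun _ _ _ (lebesgue_rV R n) (@lebesgue_rV_complete R n) setT
  (fun x => limn_esup (fun k => (diff_quot i f k.+1%:R^-1 x)%:E))).
  exists N; split => // x /= h; apply: hN => /= df; apply: h => _.
  rewrite is_cvg_limn_esupE; last first.
    by apply/cvg_ex; exists (partial i f x)%:E; apply: cvg_EFin; [exact: nearW|exact: diff_quot_cvg].
  apply/cvg_lim => //; apply: cvg_EFin; [exact: nearW|exact: diff_quot_cvg].
apply: measurable_fun_limn_esup => k; apply/measurable_EFinP.
apply: continuous_lebesgue_fun; exact: diff_quot_continuous.
Qed.

Lemma partial_eq0 (U : set 'rV[R]_n) x : open U -> U x ->
  (forall y, U y -> f y = f x) -> partial i f x = 0.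
Proof.
move=> oU Ux H; rewrite (@near_eq_partial _ _ i f (fun=> f x)) ?partial_cst//.
by near=> y; apply: H; near: y; exact: open_near.
Unshelve. all: by end_near. Qed.

End partial_ae.

(** * Translation invariance and the integral of a partial derivative *)

Section integration_by_parts.
Context {R : realType} {n : nat}.
Notation mu := (lebesgue_rV R n).
Implicit Types (x y v : 'rV[R]_n) (i : 'I_n).

Lemma ge0_integral_shift v (f : 'rV[R]_n -> \bar R) :
  measurable_fun [set: 'rV[R]_n] f -> (forall x, 0 <= f x)%E ->
  (\int[mu]_x (f (x + v)%R) = \int[mu]_x (f x))%E.
Proof.
move=> mf f0; rewrite !ge0_integral_lebesgue_borel//; last first.
  exact: (measurableT_comp mf (measurable_rV_add v)).
transitivity (\int[pushforward (lebesgue_borel R n) (fun x => (x + v)%R)]_x f x)%E.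
  by rewrite (ge0_integral_pushforward (measurable_rV_add v)).
apply: (@eq_measure_integral _ _ _ setT (lebesgue_borel R n)) => [|mid A mA _].
  exact: measurable_rV_add.
exact: lebesgue_borel_shift.
Qed.

Lemma integral_shift v (f : 'rV[R]_n -> \bar R) :
  measurable_fun [set: 'rV[R]_n] f ->
  (\int[mu]_x (f (x + v)%R) = \int[mu]_x (f x))%E.
Proof.
move=> mf; rewrite integralE [RHS]integralE; congr (_ - _)%E.
  rewrite (_ : (fun x => f (x + v)%R)^\+%E = (fun x => f^\+%E (x + v)))%R; last exact: funepos_comp.
  apply: (@ge0_integral_shift v (f^\+)%E); last by move=> x; exact: funepos_ge0.
  exact: measurable_funepos.
rewrite (_ : (fun x => f (x + v)%R)^\-%E = (fun x => f^\-%E (x + v)))%R; last exact: funeneg_comp.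
apply: (@ge0_integral_shift v (f^\-)%E); last by move=> x; exact: funeneg_ge0.
exact: measurable_funeneg.
Qed.

Definition cube (r : R) : set 'rV[R]_n := [set x | `|x| <= r].

Lemma closed_cube r : closed (cube r).
Proof.
have -> : cube r = (fun x : 'rV[R]_n => `|x|) @^-1` [set t | t <= r] by [].
apply: closed_comp; last exact: closed_le.
by move=> x _; exact: norm_continuous.
Qed.

Lemma measurable_cube r : measurable (cube r : set (lebesgue_rVType R n)).
Proof. by apply: borel_lebesgue; apply: closed_measurable_rV; exact: closed_cube. Qed.

Lemma cube_lty r : (mu (cube r) < +oo)%E.
Proof.
have mc : measurable (cube r) by apply: closed_measurable_rV; exact: closed_cube.
rewrite lebesgue_rVE//; apply: le_lt_trans (lebesgue_borel_cube n r).
apply: le_measure; rewrite ?inE//; last first.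
  by move=> x /= xr j; exact: le_trans (coord_le_norm _ _) xr.
have -> : [set x : 'rV[R]_n | forall j, `|x ord0 j| <= r] =
    \bigcap_(j in [set: 'I_n]) ((fun x : 'rV[R]_n => `|x ord0 j|) @^-1` [set t | t <= r]).
  by apply/seteqP; split => x /= h j; [move=> _|]; exact: h.
apply: closed_measurable_rV; apply: closed_bigI => j _.
apply: closed_comp; last exact: closed_le.
move=> x _; apply: (@continuous_comp _ _ _ (fun x : 'rV[R]_n => x ord0 j) (fun t : R => `|t|)).
  exact: coord_continuous.
exact: norm_continuous.
Qed.

Lemma integrable_cube_indic r : rintegrable mu (\1_(cube r) : lebesgue_rVType R n -> R).
Proof. exact: rintegrable_indic (measurable_cube r) (cube_lty r). Qed.

Lemma bounded_support_integrable (f : 'rV[R]_n -> R) (C r : R) :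
  lebesgue_measurable_fun setT f -> (forall x, `|f x| <= C) ->
  (forall x, f x != 0 -> `|x| <= r) -> rintegrable mu (f : lebesgue_rVType R n -> R).
Proof.
exact: (@rintegrable_bounded_support _ _ R (lebesgue_rV R n) (cube r)
  (measurable_cube r) (cube_lty r) f C).
Qed.

Lemma unit_rV_norm i : `|unit_rV i : 'rV[R]_n| <= 1.
Proof.
apply: norm_rV_le => // j; rewrite mxE eqxx /=.
by case: (j == i); rewrite ?normr1 ?normr0.
Qed.

(** Difference quotients integrate to 0 by translation invariance. They are bounded by L and, for
    increments at most 1, supported in the cube of radius r + 1, so dominated convergence
    applies. *)
Lemma integral_partial_eq0 i (L r : R) (f : 'rV[R]_n -> R) :
  continuous f -> dir_lipschitz i L f -> (forall x, f x != 0 -> `|x| <= r) ->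
  rintegrable mu (partial i f : lebesgue_rVType R n -> R) /\
  (\int[mu]_x (partial i f x))%R = 0.
Proof.
move=> fc fL fr.
have L0 : 0 <= L by apply: le_trans (diff_quot_le fL 1 0).
have dr h x : `|h| <= 1 -> diff_quot i f h x != 0 -> `|x| <= r + 1.
  move=> h1; rewrite /diff_quot; apply: contraR; rewrite -ltNge => xr.
  have -> : f x = 0.
    by apply/eqP; apply: contraTT xr => /fr xr; rewrite -leNgt (le_trans xr)// lerDl.
  have -> : f (h *: unit_rV i + x) = 0.
    apply/eqP; apply: contraTT xr => /fr xr; rewrite -leNgt.
    rewrite -[x](addKr (h *: unit_rV i)) addrC; apply: le_trans (ler_normD _ _) _.
    apply: lerD => //; rewrite normrN normrZ.
    by apply: le_trans (ler_pM _ _ h1 (unit_rV_norm i)) _; rewrite ?mulr1.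
  by rewrite subrr mulr0.
(* A shift by 2r + 1 along the axis leaves the cube of radius r, so f vanishes at the shifted point
   and its Lipschitz constant bounds f x. *)
have fC x : `|f x| <= L * `|2 * r + 1|.
  have [->|fx] := eqVneq (f x) 0; first by rewrite normr0 mulr_ge0.
  have xr := fr x fx; have r0 : 0 <= r by exact: le_trans (normr_ge0 x) xr.
  suff f0 : f ((2 * r + 1) *: unit_rV i + x) = 0.
    by have := fL x (2 * r + 1); rewrite f0 sub0r normrN.
  apply/eqP; apply: contraT => /fr; have := coord_le_norm ((2 * r + 1) *: unit_rV i + x) i.
  rewrite !mxE !eqxx mulr1 => h1 h2.
  have := le_trans (coord_le_norm x i) xr; have := le_trans h1 h2.
  by rewrite !ler_norml => /andP[? ?] /andP[? ?]; lra.
have fi := bounded_support_integrable (continuous_lebesgue_fun fc) fC fr.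
have h1 (k : nat) : `|k.+1%:R^-1 : R| <= 1.
  by rewrite ger0_norm// invf_le1// ler1n.
have mdq k : lebesgue_measurable_fun setT (diff_quot i f k.+1%:R^-1).
  by apply: continuous_lebesgue_fun; exact: diff_quot_continuous.
have di k := bounded_support_integrable (mdq k) (diff_quot_le fL k.+1%:R^-1) (fun x => dr _ x (h1 k)).
have I0 k : (\int[mu]_x (diff_quot i f k.+1%:R^-1 x)%:E = 0)%E.
  set h : R := k.+1%:R^-1.
  have c1 : continuous (fun x => f (x + h *: unit_rV i)).
    move=> x; apply: (@continuous_comp _ _ _ (fun x => x + h *: unit_rV i) f); last exact: fc.
    by apply: continuousD; [exact: cvg_id|exact: cst_continuous].
  have i1 : rintegrable mu (fun x : lebesgue_rVType R n => f (x + h *: unit_rV i)).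
    apply: (@bounded_support_integrable _ (L * `|2 * r + 1|) (r + 1)) => //.
      exact: continuous_lebesgue_fun c1.
    move=> x /fr xr; rewrite -[x](addrK (h *: unit_rV i)).
    apply: le_trans (ler_normB _ _) _; apply: lerD => //; rewrite normrZ.
    by apply: le_trans (ler_pM _ _ (h1 k) (unit_rV_norm i)) _; rewrite ?mulr1.
  have E : diff_quot i f h = (fun x => h^-1 * (f (x + h *: unit_rV i) - f x)).
    by apply/funext => x; rewrite /diff_quot (addrC x).
  rewrite E; apply: (@rintegral_scaled_diff0 _ _ R (lebesgue_rV R n) f
    (fun x => f (x + h *: unit_rV i)) h^-1 fi i1).
  apply: (@integral_shift (h *: unit_rV i) (EFin \o f)).
  by apply/measurable_EFinP; exact: continuous_measurable_rV.
have h2 : {ae mu, forall x, diff_quot i f k.+1%:R^-1 x @[k --> \oo] --> partial i f x}.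
  by apply: ae_imp (partial_derivable_ae fc fL) => x; exact: diff_quot_cvg.
have h3 : {ae mu, forall x, forall k, `|diff_quot i f k.+1%:R^-1 x| <= L * \1_(cube (r + 1)) x}.
  apply: aeW => x k; rewrite indicE.
  have [->|xr] := eqVneq (diff_quot i f k.+1%:R^-1 x) 0.
    by rewrite normr0 mulr_ge0.
  by rewrite mem_set ?mulr1 ?diff_quot_le//; exact: dr (h1 k) xr.
have [pi _ C] := rintegral_dominated mdq (partial_measurable fc fL) h2
  (rintegrableZ L (integrable_cube_indic (r + 1))) h3.
have Z : (fun k : nat => \int[mu]_x diff_quot i f k.+1%:R^-1 x)%R = cst 0.
  by apply/funext => k; rewrite /Rintegral I0.
by split => //; rewrite Z in C; apply: (cvg_unique _ C (cvg_cst _)).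
Qed.

End integration_by_parts.

(** * Weak convergence to zero *)

Section weak_star.
Import HBSimple.
Context d (T : measurableType d) (R : realType) (mu : {measure set T -> \bar R}).
Variables (B : set T) (e : nat -> T -> R) (C : R).
Hypotheses (mB : measurable B) (Boo : (mu B < +oo)%E).
Hypothesis me : forall k, measurable_fun setT (e k).
Hypothesis eC : forall k x, `|e k x| <= C.
Hypothesis eB : forall k x, e k x != 0 -> B x.

Let C0 : (exists x : T, True) -> 0 <= C.
Proof. by move=> [x _]; exact: le_trans (normr_ge0 _) (eC 0 x). Qed.

Definition weak_null (H : T -> R) :=
  (\int[mu]_x (H x * e k x))%R @[k --> \oo] --> (0 : R).

Lemma weak_null_integrable (H : T -> R) k : rintegrable mu H ->
  rintegrable mu (fun x => H x * e k x).
Proof. by move=> Hi; exact: rintegrableM_bounded (eC k). Qed.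

(** The [e k] are bounded uniformly in k, so replacing H by [H_ m] changes all the integrals at once
    by at most a constant times the L^1 distance. *)
Lemma weak_null_L1 (H_ : nat -> T -> R) (H : T -> R) :
  (forall m, rintegrable mu (H_ m)) -> rintegrable mu H ->
  (\int[mu]_x `|(H_ m x)%:E - (H x)%:E|)%E @[m --> \oo] --> (0 : \bar R)%E ->
  (forall m, weak_null (H_ m)) -> weak_null H.
Proof.
move=> iH_ iH H_H wH.
have Di m : rintegrable mu (fun x => H x - H_ m x).
  exact: rintegrableB.
apply/cvgrPdist_le => eps eps0.
have [c c0 Cc] : exists2 c : R, 0 < c & C <= c.
  by exists (`|C| + 1); [rewrite ltr_wpDl|rewrite (le_trans (ler_norm _))// lerDl].
have [m hm] : exists m, (\int[mu]_x `|(H_ m x)%:E - (H x)%:E| <= (eps / 2 / c)%:E)%E.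
  have : \forall m \near \oo, (\int[mu]_x `|(H_ m x)%:E - (H x)%:E| < (eps / 2 / c)%:E)%E.
    have h0 : (0 < (eps / 2 / c)%:E)%E by rewrite lte_fin !divr_gt0.
    exact: (H_H [set y | (y < (eps / 2 / c)%:E)%E] (open_ereal_lt' h0)).
  by move=> [m _ hm]; exists m; apply: ltW; apply: hm => /=.
move/cvgrPdist_le : (wH m) => /(_ (eps / 2)) wm.
have e2 : 0 < eps / 2 by rewrite divr_gt0.
near=> k; rewrite sub0r normrN.
have Ek : (\int[mu]_x (H x * e k x) = \int[mu]_x ((H x - H_ m x) * e k x) +
    \int[mu]_x (H_ m x * e k x))%R.
  rewrite -RintegralD//; try exact: weak_null_integrable.
  by apply: eq_Rintegral => x _; rewrite -mulrDl subrK.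
rewrite Ek; apply: le_trans (ler_normD _ _) _; rewrite [leRHS]splitr; apply: lerD; last first.
  have : `|0 - \int[mu]_x (H_ m x * e k x)| <= eps / 2 by near: k; exact: wm.
  by rewrite sub0r normrN.
have iN : rintegrable mu (fun x => `|H x - H_ m x|) by exact: rintegrable_norm.
apply: le_trans (le_normr_Rintegral measurableT (weak_null_integrable k (Di m))) _.
apply: (@le_trans _ _ (\int[mu]_x (c * `|H x - H_ m x|))%R).
  apply: le_Rintegral => //.
  - by apply: rintegrable_norm; exact: weak_null_integrable.
  - exact: rintegrableZ.
  - by move=> x _; rewrite normrM mulrC ler_wpM2r// (le_trans (eC k x)).
rewrite RintegralZl// -ler_pdivlMl// mulrC -lee_fin fineK; last first.
  exact: integrable_fin_num.
apply: le_trans hm; rewrite le_eqVlt; apply/orP; left; apply/eqP.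
by apply: eq_integral => x _; rewrite -EFinB abse_EFin distrC.
Unshelve. all: by end_near. Qed.

Lemma weak_null_dominated (H_ : nat -> T -> R) (H G : T -> R) :
  (forall m, measurable_fun setT (H_ m)) -> measurable_fun setT H ->
  rintegrable mu G -> (forall m x, `|H_ m x| <= G x) ->
  (forall x, H_ m x @[m --> \oo] --> H x) ->
  (forall m, weak_null (H_ m)) -> weak_null H.
Proof.
move=> mH_ mH iG H_G H_H wH.
have [iH C1 _] := rintegral_dominated mH_ mH (aeW mu H_H) iG (aeW mu (fun x m => H_G m x)).
apply: weak_null_L1 iH C1 wH => m.
by apply: rintegrable_le iG => // x.
Qed.

Lemma eq_weak_null (H H' : T -> R) : (forall x, B x -> H x = H' x) ->
  weak_null H -> weak_null H'.
Proof.
move=> HH'; rewrite /weak_null.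
rewrite (_ : (fun k => _) = (fun k => \int[mu]_x (H' x * e k x))%R)//.
apply/funext => k; apply: eq_Rintegral => x _.
by have [->|/eB /HH' ->//] := eqVneq (e k x) 0; rewrite !mulr0.
Qed.

Lemma weak_nullD (H H' : T -> R) : rintegrable mu H ->
  rintegrable mu H' -> weak_null H -> weak_null H' ->
  weak_null (fun x => H x + H' x).
Proof.
move=> iH iH' wH wH'; rewrite /weak_null.
rewrite (_ : (fun k => _) = (fun k => \int[mu]_x (H x * e k x) + \int[mu]_x (H' x * e k x))%R).
  by rewrite -[X in _ --> X]addr0; exact: cvgD.
apply/funext => k; rewrite -RintegralD//; try exact: weak_null_integrable.
by apply: eq_Rintegral => x _; rewrite mulrDl.
Qed.

Lemma weak_nullZ (H : T -> R) (c : R) : rintegrable mu H ->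
  weak_null H -> weak_null (fun x => c * H x).
Proof.
move=> iH wH; rewrite /weak_null.
rewrite (_ : (fun k => _) = (fun k => c * \int[mu]_x (H x * e k x))%R).
  by rewrite -[X in _ --> X](mulr0 c); exact: cvgMr.
apply/funext => k; rewrite -RintegralZl//; last exact: weak_null_integrable.
by apply: eq_Rintegral => x _; rewrite mulrA.
Qed.

Let iindic A : measurable A -> rintegrable mu (\1_(A `&` B) : T -> R).
Proof.
move=> mA; apply: rintegrable_indic; first exact: measurableI.
by apply: le_lt_trans Boo; apply: le_measure; rewrite ?inE//; exact: measurableI.
Qed.

(** Multiplication by the indicator of B, which the pairing does not notice, supplies the integrable
    majorant. *)
Lemma weak_null_indic_limit (H_ : nat -> T -> R) A : measurable A ->
  (forall m, measurable_fun setT (H_ m)) -> (forall m x, `|H_ m x| <= 1) ->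
  (forall x, H_ m x @[m --> \oo] --> (\1_A x : R)) ->
  (forall m, weak_null (H_ m)) -> weak_null \1_(A `&` B).
Proof.
move=> mA mH H1 HA wH.
have HB m : weak_null (fun x => H_ m x * \1_B x).
  by apply: eq_weak_null (wH m) => x Bx; rewrite indicE mem_set// mulr1.
apply: (@weak_null_dominated (fun m x => H_ m x * \1_B x) _ \1_B) => //.
- by move=> m; apply: measurable_funM => //; exact: measurable_indic.
- by apply: measurable_indic; exact: measurableI.
- exact: rintegrable_indic.
- by move=> m x; rewrite normrM [X in _ * X]ger0_norm// ler_piMl.
- by move=> x; rewrite indicI; apply: cvgM; [exact: HA|exact: cvg_cst].
Qed.

Lemma weak_null_set0 : weak_null \1_(set0 `&` B).
Proof.
rewrite set0I /weak_null (_ : (fun k => _) = cst (0 : R)); first exact: cvg_cst.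
apply/funext => k; rewrite /Rintegral (eq_integral (cst 0%E)) ?integral0//.
by move=> x _; rewrite indic0 mul0r.
Qed.

Lemma weak_null_setU A1 A2 : measurable A1 -> measurable A2 -> A1 `&` A2 = set0 ->
  weak_null \1_(A1 `&` B) -> weak_null \1_(A2 `&` B) -> weak_null \1_((A1 `|` A2) `&` B).
Proof.
move=> m1 m2 A12 w1 w2; have := weak_nullD (iindic m1) (iindic m2) w1 w2.
apply: eq_weak_null => x Bx.
rewrite [in RHS]indicI [\1_(A1 `&` B)]indicI [\1_(A2 `&` B)]indicI /= !indicE in_setU (mem_set Bx) !mulr1.
case: (boolP (x \in A1)) => h1; case: (boolP (x \in A2)) => h2 //=; rewrite ?addr0 ?add0r//.
by exfalso; rewrite -[False]/(set0 x) -A12; split; exact: set_mem.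
Qed.

Lemma weak_null_setC A : measurable A -> weak_null \1_(setT `&` B) ->
  weak_null \1_(A `&` B) -> weak_null \1_(~` A `&` B).
Proof.
move=> mA wT wA.
have := weak_nullD (iindic measurableT) (rintegrableZ (-1) (iindic mA)) wT (weak_nullZ (-1) (iindic mA) wA).
apply: eq_weak_null => x Bx.
rewrite [in RHS]indicI [\1_(A `&` B)]indicI [\1_(setT `&` B)]indicI /= !indicE in_setC (mem_set Bx) !mulr1.
by rewrite in_setT mulN1r; case: (x \in A); rewrite /= ?subrr ?subr0.
Qed.

Lemma weak_null_bigcup (F : (set T)^nat) : (forall k, measurable (F k)) -> trivIset setT F ->
  (forall k, weak_null \1_(F k `&` B)) -> weak_null \1_((\bigcup_k F k) `&` B).
Proof.
move=> mF tF wF.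
have mU m : measurable (\big[setU/set0]_(k < m) F k) by exact: bigsetU_measurable.
have wU m : weak_null \1_((\big[setU/set0]_(k < m) F k) `&` B).
  elim: m => [|m IH]; first by rewrite big_ord0; exact: weak_null_set0.
  rewrite big_ord_recr/=; apply: (weak_null_setU (mU m) (mF m) _ IH (wF m)).
  by apply: (@trivIset_bigsetUI _ predT) => //; rewrite /predT /= trueE.
have wU' m : weak_null \1_(\big[setU/set0]_(k < m) F k).
  by apply: eq_weak_null (wU m) => x Bx; rewrite indicI /= [\1_B x]indicE mem_set// mulr1.
apply: weak_null_indic_limit wU' => //.
- exact: bigcupT_measurable.
- by move=> m x; rewrite indicE; case: (_ \in _); rewrite ?normr1 ?normr0.
move=> x; have E : \forall m \near \oo, \1_(\big[setU/set0]_(k < m) F k) x = \1_(\bigcup_k F k) x :> R.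
  rewrite indicE; have [[j _ Fjx]|nF] := pselect ((\bigcup_k F k) x); last first.
    apply: nearW => m; rewrite indicE !memNset// -bigcup_mkord => -[j _ Fjx].
    by apply: nF; exists j.
  rewrite mem_set; last by exists j.
  near=> m; rewrite indicE mem_set// -bigcup_mkord; exists j => //=.
  by near: m; exact: nbhs_infty_gt.
apply: cvg_trans (@cvg_cst _ (\1_(\bigcup_k F k) x : R) nat \oo _).
by apply: near_eq_cvg; apply: filterS E => m ->.
Unshelve. all: by end_near. Qed.

(** The L^1 distance of the indicators is the measure of the difference set, at most 1/(m+1). This
    is the passage from Borel sets to all Lebesgue measurable ones. *)
Lemma weak_null_outer (C_ : nat -> set T) A : measurable A -> (forall m, measurable (C_ m)) ->
  (forall m, A `&` B `<=` C_ m) ->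
  (forall m, (mu (C_ m) <= mu (A `&` B) + (m.+1%:R^-1)%:E)%E) ->
  (forall m, weak_null \1_(C_ m `&` B)) -> weak_null \1_(A `&` B).
Proof.
move=> mA mC AC hC wC.
have mAB : measurable (A `&` B) by exact: measurableI.
have ABoo : (mu (A `&` B) < +oo)%E.
  by apply: le_lt_trans Boo; apply: le_measure; rewrite ?inE.
apply: (@weak_null_L1 (fun m => \1_(C_ m `&` B))) => // [m||]; first exact: iindic.
  exact: iindic.
apply: (@squeeze_cvge _ _ _ _ (cst 0%E) _ (fun m : nat => (m.+1%:R^-1)%:E)).
- apply: nearW => m; apply/andP; split; first exact: integral_ge0.
  rewrite (eq_integral (fun x : T => (\1_((C_ m `&` B) `\` (A `&` B)) x)%:E)); last first.
    move=> x _; rewrite -EFinB abse_EFin; congr (_%:E).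
    rewrite !indicE in_setD; case: (boolP (x \in A `&` B)) => /= h.
      rewrite mem_set ?subrr ?normr0 ?andbF//; split; first by apply: AC; exact: set_mem.
      by have [] := set_mem h.
    by rewrite andbT subr0 ger0_norm.
  rewrite integral_indic ?setIT//; last by apply: measurableD => //; exact: measurableI.
  have CB : (mu (C_ m `\` (A `&` B)) <= (m.+1%:R^-1)%:E)%E.
    rewrite measureD//; last first.
      apply: le_lt_trans (hC m) _; rewrite -ge0_fin_numE// in ABoo.
      by rewrite -(fineK ABoo) -EFinD ltry.
    rewrite (_ : C_ m `&` _ = A `&` B); last by apply/setIidr; exact: AC.
    by rewrite leeBlDl; [exact: hC|rewrite ge0_fin_numE].
  apply: le_trans CB; apply: le_measure; rewrite ?inE; last by move=> x [[]].
  + by apply: measurableD => //; exact: measurableI.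
  + exact: measurableD.
- exact: cvg_cst.
- by apply: cvg_EFin; [exact: nearW|exact: cvg_harmonic].
Qed.

(** Simple functions are dense in L^1, and on B a simple function is a finite combination of the
    indicators of the hypothesis. *)
Lemma weak_null_integral : (forall A, measurable A -> weak_null \1_(A `&` B)) ->
  forall H, rintegrable mu H -> weak_null H.
Proof.
move=> wA H iH.
have [g [ig _ gH]] := approximation_sfun_integrable measurableT iH.
apply: (weak_null_L1 ig iH) => [|m].
    apply: cvg_trans gH; apply: near_eq_cvg; apply: nearW => j.
  by apply: eq_integral => x _; rewrite -EFinB !abse_EFin distrC.
have key (s : seq R) :
    rintegrable mu ((fun x => \sum_(v <- s) v * \1_((g m @^-1` [set v]) `&` B) x)) /\
    weak_null (fun x => \sum_(v <- s) v * \1_((g m @^-1` [set v]) `&` B) x).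
  elim: s => [|v s [IH1 IH2]].
    have E : (fun x : T => \sum_(v <- [::]) v * \1_((g m @^-1` [set v]) `&` B) x) = cst (0 : R).
      by apply/funext => x; rewrite big_nil.
    rewrite E; split; first exact: integrable0.
    rewrite /weak_null (_ : (fun k => _) = cst (0 : R)); first exact: cvg_cst.
    apply/funext => k; rewrite /Rintegral (eq_integral (cst 0%E)) ?integral0//.
    by move=> x _; rewrite mul0r.
  have E : (fun x : T => \sum_(v <- v :: s) v * \1_((g m @^-1` [set v]) `&` B) x) =
    (fun x => v * \1_((g m @^-1` [set v]) `&` B) x +
      \sum_(v <- s) v * \1_((g m @^-1` [set v]) `&` B) x).
    by apply/funext => x; rewrite big_cons.
  have mv : measurable (g m @^-1` [set v]) by exact: measurable_sfunP.
  have iv : rintegrable mu ((fun x => v * \1_((g m @^-1` [set v]) `&` B) x)).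
    by apply: rintegrableZ; exact: iindic.
  rewrite E; split; first exact: rintegrableD.
  by apply: weak_nullD => //; apply: weak_nullZ; [exact: iindic|exact: wA].
have [_] := key (finmap.enum_fset (fset_set (range (g m)))).
apply: eq_weak_null => x Bx.
rewrite (fimfunE (g m) x) fsbig_finite//=.
by apply: eq_bigr => v _; rewrite indicI/= [\1_B x]indicE mem_set// mulr1.
Qed.

End weak_star.

(** The outer measure is an infimum over countable covers; the union of a nearly optimal cover is
    the set C. *)
Lemma mu_ext_cover {d} {T : measurableType d} {R : realType}
    (nu : {measure set T -> \bar R}) (A : set T) (e : R) : 0 < e ->
  (mu_ext nu A < +oo)%E ->
  exists C, [/\ measurable C, A `<=` C & (nu C <= mu_ext nu A + e%:E)%E].
Proof.
move=> e0 Aoo.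
have Afin : mu_ext nu A \is a fin_num by rewrite ge0_fin_numE// mu_ext_ge0.
have [_ [F [mF AF] <-] hF] := lb_ereal_inf_adherent e0 Afin.
exists (\bigcup_k F k); split => //; first exact: bigcupT_measurable.
by apply: le_trans (ltW hF); apply: measure_sigma_subadditive => //; exact: bigcupT_measurable.
Qed.

Lemma lipschitz_continuous_rV {R : realType} {n : nat} (f : 'rV[R]_n -> R) (L : R) : 0 <= L ->
  (forall x y, `|f x - f y| <= L * `|x - y|) -> continuous f.
Proof.
move=> L0 fL x; apply/(@cvgrPdist_le _ _ _ (nbhs x) (nbhs_filter x)) => e e0.
have C : (L * `|x - y|) @[y --> x] --> (L * `|x - x| : R).
  apply: (@continuousM _ _ (cst L) (fun y : 'rV[R]_n => `|x - y|)); first exact: cst_continuous.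
  apply: (@continuous_comp _ _ _ (fun y : 'rV[R]_n => x - y) (fun y : 'rV[R]_n => `|y|)).
    by apply: continuousB; [exact: cst_continuous|exact: cvg_id].
  exact: norm_continuous.
move/(@cvgrPdist_le _ _ _ (nbhs x) (nbhs_filter x)) : C => /(_ e e0); apply: (@filterS _ (nbhs x) (nbhs_filter x)) => y.
rewrite subrr normr0 mulr0 sub0r normrN ger0_norm ?mulr_ge0//.
exact: le_trans.
Qed.

Section dir_lipschitz_facts.
Context {R : realType} {n : nat}.
Implicit Types (x y : 'rV[R]_n) (i : 'I_n) (f g : 'rV[R]_n -> R).

Lemma partial_le_everywhere i L f x : continuous f -> dir_lipschitz i L f -> `|partial i f x| <= L.
Proof.
move=> fc fL; have [df|ndf] := pselect (derivable f x (unit_rV i)).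
  have C : `|diff_quot i f k.+1%:R^-1 x| @[k --> \oo] --> `|partial i f x|.
    by apply: cvg_norm; exact: diff_quot_cvg.
  rewrite -(cvg_lim _ C)//; apply: limr_le; first by apply/cvg_ex; eexists; exact: C.
  by apply: nearW => k; exact: diff_quot_le.
(* Where the derivative does not exist, ['D] takes the default value 0. *)
have -> : partial i f x = 0 by exact: (dvgP ndf).
by rewrite normr0 (le_trans _ (diff_quot_le fL 0 x)).
Qed.

Lemma partial_support i f (r : R) x : (forall x, f x != 0 -> `|x| <= r) ->
  partial i f x != 0 -> `|x| <= r.
Proof.
move=> fr; apply: contraR; rewrite -ltNge => xr.
have f0 y : r < `|y| -> f y = 0.
  by move=> yr; apply/eqP; apply: contraTT yr => /fr; rewrite -leNgt.
apply/eqP; apply: (@partial_eq0 _ _ i f [set y : 'rV[R]_n | r < `|y|]) => //.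
  rewrite (_ : [set y | _] = (fun y : 'rV[R]_n => `|y|) @^-1` [set t | r < t])//.
  by apply: open_comp; [move=> y _; exact: norm_continuous|exact: open_gt].
by move=> y yr; rewrite !f0.
Qed.

Lemma lipschitz_dir_lipschitz i L f : (forall x y, `|f x - f y| <= L * `|x - y|) ->
  0 <= L -> dir_lipschitz i L f.
Proof.
move=> fL L0 x h; apply: le_trans (fL _ _) _; rewrite addrK normrZ.
by rewrite ler_wpM2l// ler_piMr// unit_rV_norm.
Qed.

Lemma dir_lipschitzB i L L' f g : dir_lipschitz i L f -> dir_lipschitz i L' g ->
  dir_lipschitz i (L + L') (fun x => f x - g x).
Proof.
move=> fL gL x h; rewrite (_ : _ - _ = (f (h *: unit_rV i + x) - f x) -
  (g (h *: unit_rV i + x) - g x)); last by ring.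
by apply: le_trans (ler_normB _ _) _; rewrite mulrDl; exact: lerD.
Qed.

Lemma dir_lipschitzM i L L' C C' f g : dir_lipschitz i L f -> dir_lipschitz i L' g ->
  (forall x, `|f x| <= C) -> (forall x, `|g x| <= C') ->
  dir_lipschitz i (C * L' + C' * L) (fun x => f x * g x).
Proof.
move=> fL gL fC gC x h; set y := h *: unit_rV i + x.
rewrite (_ : _ - _ = f y * (g y - g x) + g x * (f y - f x)); last by ring.
apply: le_trans (ler_normD _ _) _; rewrite !normrM mulrDl -!mulrA.
by apply: lerD; apply: ler_pM => //; [exact: gL|exact: fL].
Qed.

Lemma partialM i f g x : derivable f x (unit_rV i) -> derivable g x (unit_rV i) ->
  partial i (fun x => f x * g x) x = f x * partial i g x + g x * partial i f x.
Proof. by move=> df dg; have := deriveM df dg. Qed.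

Lemma smooth_dir_lipschitz i L f : smooth_on setT f ->
  (forall x, `|partial i f x| <= L) -> dir_lipschitz i L f.
Proof.
move=> sf fL x h; pose g (t : R) : R := f (t *: unit_rV i + x).
have dg (t : R) : is_derive t (1 : R) g (partial i f (t *: unit_rV i + x)).
  have df : derivable f (t *: unit_rV i + x) (unit_rV i) by exact: smooth_on_derivable sf I.
  have E : (fun s : R => s^-1 *: ((g \o shift t) (s *: (1 : R)) - g t)) =
        (fun s : R => s^-1 *: ((f \o shift (t *: unit_rV i + x)) (s *: unit_rV i) - f (t *: unit_rV i + x))).
    by apply/funext => s; rewrite /g /= [s%:A]mulr1 scalerDl addrA.
  apply: DeriveDef; first by rewrite /derivable E; exact: df.
  by rewrite /derive E.
have cg : continuous g.
  by move=> t; apply: differentiable_continuous; apply/derivable1_diffP; exact: ex_derive.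
have H (s t : R) : s <= t -> `|g t - g s| <= L * (t - s).
  move=> st; have [c _ ->] := MVT_segment st (fun t _ => dg t) (continuous_subspaceT cg).
  by rewrite normrM [X in _ * X]ger0_norm ?subr_ge0// ler_wpM2r// subr_ge0.
have -> : f (h *: unit_rV i + x) - f x = g h - g 0 by rewrite /g scale0r add0r.
have [h0|h0] := leP 0 h; first by apply: le_trans (H _ _ h0) _; rewrite subr0 ger0_norm.
by rewrite distrC; apply: le_trans (H _ _ (ltW h0)) _; rewrite sub0r ltr0_norm.
Qed.

End dir_lipschitz_facts.

Section weak_partial.
Context {R : realType} {n : nat}.
Local Notation mu := (lebesgue_rV R n).
Local Notation T := (lebesgue_rVType R n).
Variables (i : 'I_n) (eta : nat -> 'rV[R]_n -> R) (L r : R) (dl : nat -> R).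
Hypotheses (etac : forall k, continuous (eta k))
  (etaL : forall k, dir_lipschitz i L (eta k))
  (etar : forall k x, eta k x != 0 -> `|x| <= r)
  (etad : forall k x, `|eta k x| <= dl k) (dl0 : dl k @[k --> \oo] --> (0 : R)).
Let B : set T := cube r.
Let e k : T -> R := partial i (eta k).
Let mB : measurable B := measurable_cube r.
Let Boo : (mu B < +oo)%E := cube_lty r.
Let me k : measurable_fun setT (e k).
Proof. exact: partial_measurable (@etac k) (@etaL k). Qed.

Let eC k x : `|e k x| <= L.
Proof. exact: partial_le_everywhere (@etac k) (@etaL k). Qed.

Let eB k x : e k x != 0 -> B x.
Proof. by apply: partial_support; exact: etar. Qed.

(** [H * eta k] has bounded support, so its partial derivative integrates to 0. Up to sign the
    pairing is therefore the integral of [eta k] times the derivative of H, at most dl k * K times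
    the measure of the cube. *)
Let weak_lipschitz (H : 'rV[R]_n -> R) (K : R) : continuous H -> dir_lipschitz i K H ->
  (forall x, 0 <= H x <= 1) -> weak_null mu e (H : T -> R).
Proof.
move=> Hc HK H1.
have N1 x : `|H x| <= 1 by have /andP[a b] := H1 x; rewrite ger0_norm.
have K0 : 0 <= K by exact: le_trans (normr_ge0 _) (diff_quot_le HK 0 0).
have fin : mu B \is a fin_num by rewrite ge0_fin_numE.
pose b := fine (mu B).
have bnd k : `|\int[mu]_x (H x * e k x)|%R <= dl k * K * b.
  pose f x := H x * eta k x.
  have fc : continuous f by move=> x; apply: continuousM; [exact: Hc|exact: etac].
  have fL : dir_lipschitz i (1 * L + dl k * K) f.
    exact: dir_lipschitzM HK (@etaL k) N1 (@etad k).
  have fr x : f x != 0 -> `|x| <= r.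
    by move=> fx; apply: (@etar k); apply: contraNneq fx => ex; rewrite /f ex mulr0.
  have [fi f0] := integral_partial_eq0 fc fL fr.
  have iB : rintegrable mu (fun x : T => dl k * K * \1_B x).
    by apply: rintegrableZ; exact: integrable_cube_indic.
  have mHe : measurable_fun (setT : set T) (fun x => H x * e k x).
    by apply: measurable_funM => //; exact: continuous_lebesgue_fun.
  have mf := partial_measurable fc fL.
  have key : {ae mu, forall x, `|partial i f x - H x * e k x| <= dl k * K * \1_B x}.
    apply: ae_imp2 (partial_derivable_ae Hc HK) (partial_derivable_ae (@etac k) (@etaL k)).
    move=> x dH de.
    have -> : partial i f x - H x * e k x = eta k x * partial i H x.
      by rewrite /f partialM// /e addrAC subrr add0r.
    have [->|ex] := eqVneq (eta k x) 0.
      by rewrite mul0r normr0 !mulr_ge0// (le_trans (normr_ge0 _) (@etad k x)).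
    rewrite indicE mem_set ?mulr1; last exact: etar ex.
    by rewrite normrM ler_pM//; exact: partial_le_everywhere.
  have iHe : rintegrable mu (fun x : T => H x * e k x).
    apply: (@rintegrable_bounded_support _ _ R mu B mB Boo _ L) => // x.
      by rewrite normrM -[L]mul1r ler_pM.
    by move=> hx; apply: (@eB k); apply: contraNneq hx => ->; rewrite mulr0.
  have iD : rintegrable mu (fun x : T => partial i f x - H x * e k x).
    exact: rintegrableB.
  have -> : (\int[mu]_x (H x * e k x) = - \int[mu]_x (partial i f x - H x * e k x))%R.
    by rewrite RintegralB// f0 sub0r opprK.
  rewrite normrN; apply: le_trans (le_normr_Rintegral measurableT iD) _.
  apply: (@le_trans _ _ (\int[mu]_x (dl k * K * \1_B x))%R).
    by apply: ae_le_rintegral => //; exact: rintegrable_norm.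
  rewrite RintegralZl//; last exact: integrable_cube_indic.
  by rewrite /Rintegral integral_indic// setIT.
rewrite /weak_null; apply: norm_cvg0.
apply: (@squeeze_cvgr _ _ _ _ (cst 0) (fun k => dl k * (K * b))).
- by apply: nearW => k; rewrite /= normr_ge0 mulrA; exact: bnd.
- exact: cvg_cst.
- by rewrite -[X in _ --> X](mul0r (K * b)); apply: cvgM => //; exact: cvg_cst.
Qed.

(** A pi-system, since g + h vanishes exactly where both do. It generates the Borel sets: the
    half-space x_j <= b is the zero set of (x_j - b) + |x_j - b|. *)
Let zero_sets : set (set 'rV[R]_n) := [set A | exists g (K : R),
  [/\ continuous g, dir_lipschitz i K g, forall x, 0 <= g x & A = [set x | g x = 0]]].
Let setI_zero_sets : setI_closed zero_sets.
Proof.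
move=> _ _ [g [K [gc gK g0 ->]]] [h [K' [hc hK h0 ->]]].
exists (fun x => g x + h x), (K + K'); split.
- by move=> x; apply: continuousD; [exact: gc|exact: hc].
- move=> x t; rewrite opprD addrACA; apply: le_trans (ler_normD _ _) _.
  by rewrite mulrDl; exact: lerD.
- by move=> x; exact: addr_ge0.
- apply/seteqP; split => x /=; first by move=> [-> ->]; rewrite addr0.
  by move/eqP; rewrite paddr_eq0// => /andP[/eqP-> /eqP->].
Qed.

Let borel_zero_sets (A : set 'rV[R]_n) : measurable A -> <<s zero_sets >> A.
Proof.
suff : g_sigma_preimage (@rV_coord R n) `<=` <<s zero_sets >> by apply.
apply: smallest_sub; first exact: smallest_sigma_algebra.
rewrite -bigcup_seq/=; apply: bigcup_sub => j _ _ [D mD <-] /=; rewrite setTI.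
suff : <<s (@RGenOInfty.G R) >> `<=` [set D | <<s zero_sets >> (@rV_coord R n j @^-1` D)].
  by move=> h; apply: h; have := mD; rewrite RGenOInfty.measurableE.
apply: smallest_sub.
  split; rewrite /=.
  - by rewrite preimage_set0; exact: sigma_algebra0.
  - by move=> D' D'm; rewrite setTD preimage_setC -setTD; exact: sigma_algebraCD.
  - by move=> F mF; rewrite preimage_bigcup; exact: sigma_algebra_bigcup.
move=> _ [b ->] /=.
pose g (x : 'rV[R]_n) := (x ord0 j - b) + `|x ord0 j - b|.
have cg : continuous (fun x : 'rV[R]_n => x ord0 j - b).
  by move=> x; apply: continuousB; [exact: coord_continuous|exact: cst_continuous].
have -> : @rV_coord R n j @^-1` `]b, +oo[ = setT `\` [set x | g x = 0].
  apply/seteqP; split => x /=; rewrite /rV_coord /= in_itv/= andbT /g.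
    by move=> h; split => //; rewrite gtr0_norm ?subr_gt0//; lra.
  move=> [_ h]; rewrite ltNge; apply/negP => h'; apply: h.
  by rewrite ler0_norm ?subr_le0// subrr.
apply: sigma_algebraCD; apply: sub_gen_smallest; exists g, (1 + 1); split => //.
- move=> x; apply: (@continuousD _ _ _ (fun x : 'rV[R]_n => x ord0 j - b)
    (fun x : 'rV[R]_n => `|x ord0 j - b|)); first exact: cg.
  apply: (@continuous_comp _ _ _ (fun x : 'rV[R]_n => x ord0 j - b) (fun t : R => `|t|)).
    exact: cg.
  exact: norm_continuous.
- move=> x h; rewrite /g; set s := _ - b; set t := x ord0 j - b.
  have st : `|s - t| <= `|h|.
    rewrite /s /t opprB addrA subrK !mxE addrK normrM.
    by rewrite ler_piMr//; case: (_ && _); rewrite ?normr1 ?normr0.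
  rewrite opprD addrACA; apply: le_trans (ler_normD _ _) _; rewrite mulrDl mul1r.
  by apply: lerD => //; apply: le_trans (ler_dist_dist _ _) st.
- by move=> x; rewrite /g -lerBlDl sub0r -normrN ler_norm.
Qed.

(** The Lipschitz functions 1 / (1 + (m+1) g) take values in [0, 1] and converge pointwise to the
    indicator of the zero set of g. *)
Let weak_zero_sets A : zero_sets A -> weak_null mu e (\1_(A `&` B) : T -> R).
Proof.
move=> [g [K [gc gK g0 ->]]].
pose H (m : nat) x : R := (1 + m.+1%:R * g x)^-1.
have p0 m x : 0 < 1 + m.+1%:R * g x by rewrite ltr_pwDl// mulr_ge0.
have p1 m x : 1 <= 1 + m.+1%:R * g x by rewrite lerDl mulr_ge0.
have H01 m x : 0 <= H m x <= 1.
  by rewrite /H invr_ge0 (ltW (p0 m x)) /= invf_le1 ?p0//; exact: p1.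
have HL m : dir_lipschitz i (m.+1%:R * K) (H m).
  move=> x h; rewrite /H.
  set s := 1 + _ * g _; set t := 1 + _ * g x.
  have s0 : 0 < s by exact: p0.
  have t0 : 0 < t by exact: p0.
  have -> : s^-1 - t^-1 = (t - s) * (s * t)^-1.
    by field; rewrite !gt_eqF.
  rewrite normrM normfV ler_pdivrMr ?normr_gt0 ?mulf_neq0 ?gt_eqF//.
  have -> : t - s = - (m.+1%:R * (g (h *: unit_rV i + x) - g x)) by rewrite /s /t; ring.
  rewrite normrN normrM [X in X * _]ger0_norm//.
  apply: (@le_trans _ _ (m.+1%:R * (K * `|h|))); first by rewrite ler_wpM2l.
  rewrite -mulrA ler_peMr ?mulr_ge0//.
    by exact: le_trans (normr_ge0 _) (diff_quot_le gK 0 0).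
  by rewrite ger0_norm ?mulr_ge0 ?(ltW s0) ?(ltW t0)// -[leLHS]mulr1 ler_pM// p1.
have Hc m : continuous (H m).
  move=> x; apply: (@continuousV _ _ (fun x => 1 + m.+1%:R * g x)); first by rewrite gt_eqF.
  apply: continuousD; first exact: cst_continuous.
  by apply: (@continuousM _ _ (cst m.+1%:R) g); [exact: cst_continuous|exact: gc].
have mA : measurable ([set x | g x = 0] : set T).
  have -> : [set x | g x = 0] = g @^-1` [set 0] by [].
  rewrite -[X in measurable X]setTI.
  by apply: (continuous_lebesgue_fun gc) => //; exact: measurable_set1.
have HA x : H m x @[m --> \oo] --> (\1_[set x | g x = 0] x : R).
  rewrite indicE; have [gx|gx] := eqVneq (g x) 0.
    rewrite mem_set//; have E m : H m x = 1 by rewrite /H gx mulr0 addr0 invr1.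
    by apply: cvg_near_cst; exact: nearW.
  rewrite memNset; last by move=> h; rewrite h eqxx in gx.
  have gx0 : 0 < g x by rewrite lt_neqAle eq_sym gx g0.
  apply: (@squeeze_cvgr _ _ _ _ (cst 0) (fun m => (g x)^-1 * m.+1%:R^-1)).
  - apply: nearW => m; have /andP[-> _] /= := H01 m x.
    by rewrite /H -invfM lef_pV2 ?posrE ?p0 ?mulr_gt0// mulrC lerDr.
  - exact: cvg_cst.
  - rewrite -[X in _ --> X](mulr0 (g x)^-1); apply: cvgM; first exact: cvg_cst.
    exact: cvg_harmonic.
have N1 m x : `|H m x| <= 1 by have /andP[h0 h1] := H01 m x; rewrite ger0_norm.
have wH m := weak_lipschitz (Hc m) (HL m) (H01 m).
have mH m := continuous_lebesgue_fun (Hc m).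
exact: (@weak_null_indic_limit _ _ _ mu B e L mB Boo me eC eB H _ mA mH N1 HA wH).
Qed.

(** The sets with weakly null pairing are stable under complements and countable disjoint unions, so
    they contain the Dynkin class of a pi-system that generates the Borel sets. *)
Let weak_borel (A : set 'rV[R]_n) : measurable A -> weak_null mu e (\1_(A `&` B) : T -> R).
Proof.
pose P (A : set 'rV[R]_n) := measurable A /\ weak_null mu e (\1_(A `&` B) : T -> R).
suff : <<d zero_sets >> `<=` P.
  move=> dP mA; apply: (dP A _).2.
  by rewrite setI_closed_g_dynkin_g_sigma_algebra//; exact: borel_zero_sets.
have zP A' : zero_sets A' -> P A'.
  move=> zA; split; last exact: weak_zero_sets.
  case: zA => g [K [gc _ _ ->]].
  have -> : [set x | g x = 0] = g @^-1` [set 0] by [].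
  rewrite -[X in measurable X]setTI.
  by apply: (continuous_measurable_rV gc) => //; exact: measurable_set1.
have PT : P setT.
  apply: zP; exists (cst 0), 0; split.
  - by move=> x; exact: cst_continuous.
  - by move=> x h; rewrite subrr normr0 mul0r.
  - by [].
  - by apply/seteqP; split.
apply: smallest_sub; last exact: zP.
split; first exact: PT.
- move=> A' [mA' wA']; split; first exact: measurableC.
  exact: (@weak_null_setC _ _ _ mu B e L mB Boo me eC eB A' (borel_lebesgue mA') PT.2 wA').
- move=> F tF PF; have mF k : measurable (F k) by have [] := PF k.
  split; first exact: bigcupT_measurable.
  apply: (@weak_null_bigcup _ _ _ mu B e L mB Boo me eC eB F _ tF) => k.
    exact: borel_lebesgue.
  exact: (PF k).2.
Qed.

(* For Lipschitz H this is integration by parts; bounded functions are reached by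
   a Dynkin class argument from the zero sets of Lipschitz functions. *)
Lemma partial_weak_null (H : T -> R) : rintegrable mu H ->
  (\int[mu]_x (H x * partial i (eta k) x))%R @[k --> \oo] --> (0 : R).
Proof.
apply: (@weak_null_integral _ _ _ mu B e L mB Boo me eC eB) => A mA.
have mAB : measurable (A `&` B) by exact: measurableI.
have ABoo : (mu (A `&` B) < +oo)%E.
  by apply: le_lt_trans Boo; apply: le_measure; rewrite ?inE.
have cov (m : nat) : exists C : set 'rV[R]_n, [/\ measurable C, A `&` B `<=` C &
    (mu C <= mu (A `&` B) + (m.+1%:R^-1)%:E)%E].
  have [|C [mC AC hC]] := @mu_ext_cover _ _ R (lebesgue_borel R n) (A `&` B) m.+1%:R^-1 _ ABoo.
    by rewrite invr_gt0.
  by exists C; split => //; rewrite lebesgue_rVE.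
pose C m := sval (cid (cov m)).
have mC m : measurable (C m) by rewrite /C; case: cid => ? [].
have AC m : A `&` B `<=` C m by rewrite /C; case: cid => ? [].
have hC m : (mu (C m) <= mu (A `&` B) + (m.+1%:R^-1)%:E)%E by rewrite /C; case: cid => ? [].
have mC' m : measurable (C m : set T) by exact: borel_lebesgue.
exact: (@weak_null_outer _ _ _ mu B e L mB Boo me eC C A mA mC' AC hC
  (fun m => weak_borel (mC m))).
Qed.

End weak_partial.

(** [partial_weak_null] is applied to f k - psi, which tends to 0 uniformly, is supported in a fixed
    cube and has partial derivatives bounded by C + L. *)
Lemma lipschitz_smooth_weak_approx {R : realType} {n : nat} (psi : 'rV[R]_n -> R) (L rho : R) :
  0 <= L -> (forall x y, `|psi x - psi y| <= L * `|x - y|) ->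
  (forall x, 0 <= psi x) -> (forall x, psi x != 0 -> `|x| <= rho) ->
  exists (C : R) (f : nat -> 'rV[R]_n -> R),
    (forall k, [/\ smooth_on setT (f k), forall x, 0 <= f k x,
        forall x, f k x != 0 -> `|x| <= rho + 2,
        forall x, `|f k x - psi x| <= 2 * L / k.+1%:R &
        forall i x, `|partial i (f k) x| <= C]) /\
    forall i H, rintegrable (lebesgue_rV R n) (H : lebesgue_rVType R n -> R) ->
      (\int[lebesgue_rV R n]_x (H x * partial i (f k) x))%R @[k --> \oo] -->
      (\int[lebesgue_rV R n]_x (H x * partial i psi x))%R.
Proof.
move=> L0 psiL psi0 psir; have [C [f hf]] := lipschitz_smooth_approx L0 psiL psi0 psir.
exists C, f; split => // i H iH.
have fL k : dir_lipschitz i C (f k).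
  by have [sf _ _ _ fC] := hf k; apply: smooth_dir_lipschitz => // x; exact: fC.
have fc k : continuous (f k).
  by have [sf _ _ _ _] := hf k; move=> x; exact: smooth_on_continuous sf I.
have pL : dir_lipschitz i L psi by exact: lipschitz_dir_lipschitz.
have pc : continuous psi by exact: lipschitz_continuous_rV L0 psiL.
pose eta k x := f k x - psi x.
have etac k : continuous (eta k) by move=> x; apply: continuousB; [exact: fc|exact: pc].
have etaL k : dir_lipschitz i (C + L) (eta k) by exact: dir_lipschitzB.
have etar k x : eta k x != 0 -> `|x| <= rho + 2.
  have [_ _ fr _ _] := hf k; have [fx0|/fr//] := eqVneq (f k x) 0.
  rewrite /eta fx0 sub0r oppr_eq0 => /psir xr; apply: le_trans xr _; by rewrite lerDl.
have etad k x : `|eta k x| <= 2 * L / k.+1%:R by have [_ _ _ + _] := hf k; exact.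
have dl0 : 2 * L / k.+1%:R @[k --> \oo] --> (0 : R).
  by rewrite -[X in _ --> X](mulr0 (2 * L)); apply: cvgM; [exact: cvg_cst|exact: cvg_harmonic].
have W := partial_weak_null etac etaL etar etad dl0 iH.
have mH := rintegrable_measurable iH.
have iM (g : 'rV[R]_n -> R) K : continuous g -> dir_lipschitz i K g ->
    rintegrable (lebesgue_rV R n) (fun x : lebesgue_rVType R n => H x * partial i g x).
  move=> gc gK.
  apply: (@rintegrableM_bounded _ _ R (lebesgue_rV R n) H (partial i g) K iH
    (partial_measurable gc gK)) => x.
  exact: partial_le_everywhere.
have E k : (\int[lebesgue_rV R n]_x (H x * partial i (eta k) x) =
    \int[lebesgue_rV R n]_x (H x * partial i (f k) x) -
    \int[lebesgue_rV R n]_x (H x * partial i psi x))%R.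
  rewrite -RintegralB//; [|exact: iM (fc k) (fL k)|exact: iM pc pL].
  apply: ae_eq_rintegral.
  - exact: rintegrable_measurable (iM _ _ (etac k) (etaL k)).
  - exact: rintegrable_measurable (rintegrableB (iM _ _ (fc k) (fL k)) (iM _ _ pc pL)).
  apply: ae_imp2 (partial_derivable_ae (fc k) (fL k)) (partial_derivable_ae pc pL).
  move=> x df dp; rewrite -mulrBr; congr (_ * _).
  by have := deriveB df dp.
apply/subr_cvg0; under eq_fun do rewrite -E; exact: W.
Qed.

(** * Elementary inequalities *)

Section real_inequalities.
Context {R : realType}.
Implicit Types (t x y X Y : R).

Lemma powR_mul_self x (b : R) : 0 <= x -> b != 0 -> x `^ b = x `^ (b - 1) * x.
Proof.
rewrite le_eqVlt => /predU1P[<-|x0] b0; first by rewrite powR0// mulr0.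
have xn0 : x != 0 by rewrite gt_eqF.
by rewrite -[X in _ * X](powRr1 (ltW x0)) -powRD ?xn0 ?implybT// subrK.
Qed.

Lemma powR_superadd x y (q : R) : 0 <= x -> 0 <= y -> 1 < q ->
  x `^ q + y `^ q <= (x + y) `^ q.
Proof.
move=> x0 y0 q1; have q0 : q != 0 by rewrite gt_eqF// (lt_trans ltr01).
rewrite (powR_mul_self x0)// (powR_mul_self y0)// (powR_mul_self (addr_ge0 x0 y0))// mulrDr.
have q10 : 0 <= q - 1 by rewrite subr_ge0 ltW.
by apply: lerD; rewrite ler_wpM2r// ge0_ler_powR// ?nnegrE ?addr_ge0// ?lerDl ?lerDr.
Qed.

(** For x and y of the same sign, superadditivity of the power q gives the constant 1. For opposite
    signs the larger of x and -y is at least (x - y) / 2, whence the factor 2^-q. *)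
Lemma power_diff_ge x y (q : R) : 1 < q -> y <= x ->
  2 `^ (- q) * (x - y) `^ q <= `|x| `^ (q - 1) * x - `|y| `^ (q - 1) * y.
Proof.
move=> q1 yx; have q0 : q != 0 by rewrite gt_eqF// (lt_trans ltr01).
have qge0 : 0 <= q by rewrite ltW// (lt_trans ltr01).
have xy0 : 0 <= x - y by rewrite subr_ge0.
have c1 : 2 `^ (- q) <= 1.
  rewrite powRN invf_le1 ?powR_gt0//.
  have h21 : 1 <= 2 :> R by rewrite ler1n.
  by have := ler_powR h21 qge0; rewrite powRr0.
have [y0|y0] := leP 0 y.
  have x0 : 0 <= x by exact: le_trans yx.
  rewrite (ger0_norm x0) (ger0_norm y0) -(powR_mul_self x0 q0) -(powR_mul_self y0 q0).
  apply: (@le_trans _ _ ((x - y) `^ q)); first by rewrite ler_piMl// powR_ge0.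
  by rewrite lerBrDr; apply: le_trans (powR_superadd xy0 y0 q1) _; rewrite subrK.
have [x0|x0] := leP x 0.
  rewrite !ler0_norm ?(ltW y0)//.
  have E z : z <= 0 -> (- z) `^ (q - 1) * z = - (- z) `^ q.
    by move=> z0; rewrite (powR_mul_self _ q0) ?oppr_ge0// mulrN opprK.
  rewrite !E ?(ltW y0)//.
  apply: (@le_trans _ _ ((x - y) `^ q)); first by rewrite ler_piMl// powR_ge0.
  rewrite opprK [leRHS]addrC lerBrDr.
  have := @powR_superadd (x - y) (- x) q xy0; rewrite oppr_ge0 => /(_ x0 q1) h.
  by apply: le_trans h _; rewrite addrAC subrr add0r.
rewrite (gtr0_norm x0) (ltr0_norm y0).
have -> : (- y) `^ (q - 1) * y = - (- y) `^ q.
  by rewrite (powR_mul_self _ q0) ?oppr_ge0 ?(ltW y0)// mulrN opprK.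
rewrite -powR_mul_self ?(ltW x0)// opprK.
have ny0 : 0 <= - y by rewrite oppr_ge0 ltW.
have -> : 2 `^ (- q) * (x - y) `^ q = ((x - y) / 2) `^ q.
  by rewrite powRM ?invr_ge0// powRN -[in RHS]powR_inv1// -powRrM mulN1r powRN mulrC.
have [h|h] := leP (- y) x.
  apply: (@le_trans _ _ (x `^ q)); last by rewrite lerDl powR_ge0.
  apply: ge0_ler_powR => //; rewrite ?nnegrE ?divr_ge0// ?(ltW x0)//.
  by rewrite ler_pdivrMr//; lra.
apply: (@le_trans _ _ ((- y) `^ q)); last by rewrite lerDr powR_ge0.
apply: ge0_ler_powR => //; rewrite ?nnegrE ?divr_ge0//.
by rewrite ler_pdivrMr//; lra.
Qed.

(** Young's inequality with unsharp constants: if Y <= kap X the factor Y is replaced, otherwise X.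
    The parameter kap decides which of the two terms is made small. *)
Lemma interpolation_le X Y (th kap : R) : 0 <= X -> 0 <= Y -> 0 < th < 1 -> 0 < kap ->
  X `^ th * Y `^ (1 - th) <= kap `^ (1 - th) * X + kap `^ (- th) * Y.
Proof.
move=> X0 Y0 /andP[t0 t1] k0.
have t10 : 0 <= 1 - th by rewrite subr_ge0 ltW.
have split (Z : R) : 0 <= Z -> Z `^ th * Z `^ (1 - th) = Z.
  rewrite le_eqVlt => /predU1P[<-|z0]; first by rewrite powR0 ?gt_eqF// mul0r.
  have zn0 : Z != 0 by rewrite gt_eqF.
  by rewrite -powRD ?zn0 ?implybT// addrCA subrr addr0 powRr1// ltW.
have [h|h] := leP Y (kap * X).
  apply: (@le_trans _ _ (kap `^ (1 - th) * X)); last by rewrite lerDl mulr_ge0// powR_ge0.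
  apply: (@le_trans _ _ (X `^ th * (kap * X) `^ (1 - th))).
    by rewrite ler_wpM2l ?powR_ge0// ge0_ler_powR// nnegrE mulr_ge0// ltW.
  by rewrite powRM// ?(ltW k0)// mulrCA split.
apply: (@le_trans _ _ (kap `^ (- th) * Y)); last by rewrite lerDr mulr_ge0// powR_ge0.
have XY : X <= kap^-1 * Y by rewrite ler_pdivlMl// ltW.
apply: (@le_trans _ _ ((kap^-1 * Y) `^ th * Y `^ (1 - th))).
  by rewrite ler_wpM2r ?powR_ge0// ge0_ler_powR ?(ltW t0)// nnegrE mulr_ge0// invr_ge0 ltW.
rewrite powRM ?invr_ge0 ?(ltW k0)// -mulrA split//.
by rewrite -powR_inv1 ?(ltW k0)// -powRrM mulN1r.
Qed.

(* A smooth positive majorant of the positive part of t, tending to it with eps. *)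
Definition reg (eps t : R) : R := (t + (t * t + eps * eps) `^ 2^-1) / 2 + eps.

Definition reg' (eps t : R) : R := (1 + t * (t * t + eps * eps) `^ (2^-1 - 1)) / 2.

(** The substitute for w^-nu. It is defined on all reals because w_k, unlike w, may be negative, and
    for each eps > 0 it is bounded by eps^-nu. *)
Definition gfun (nu eps t : R) : R := reg eps t `^ (- nu).

Definition gfun' (nu eps t : R) : R := - nu * reg eps t `^ (- nu - 1) * reg' eps t.

Section regularisation.
Variables (nu eps : R).
Hypotheses (nu0 : 0 < nu) (eps0 : 0 < eps).

Lemma sum_sq_gt0 t : 0 < t * t + eps * eps.
Proof. by rewrite ltr_wpDl ?mulr_gt0// -expr2 sqr_ge0. Qed.

Lemma reg_root_sqr t : (t * t + eps * eps) `^ 2^-1 * (t * t + eps * eps) `^ 2^-1 = t * t + eps * eps.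
Proof.
rewrite -powRD ?gt_eqF ?sum_sq_gt0 ?implybT//.
by rewrite (_ : 2^-1 + 2^-1 = 1 :> R) ?powRr1 ?(ltW (sum_sq_gt0 _))//; field.
Qed.

Lemma reg_root_ge t : `|t| <= (t * t + eps * eps) `^ 2^-1.
Proof.
rewrite -ler_sqr ?nnegrE ?powR_ge0// !expr2 reg_root_sqr -normrM.
by rewrite ger0_norm -?expr2 ?sqr_ge0// lerDl sqr_ge0.
Qed.

Lemma reg_ge_eps t : eps <= reg eps t.
Proof.
rewrite /reg lerDr divr_ge0//.
have := reg_root_ge t; have := ler_norm (- t); rewrite normrN; lra.
Qed.

Lemma reg_gt0 t : 0 < reg eps t.
Proof. exact: lt_le_trans (reg_ge_eps t). Qed.

Lemma reg_ge t : 0 <= t -> t <= reg eps t.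
Proof. by move=> t0; rewrite /reg; have := reg_root_ge t; have := eps0; rewrite ger0_norm//; lra. Qed.

Lemma reg_le t : 0 <= t -> reg eps t <= t + 2 * eps.
Proof.
move=> t0; have h : (t * t + eps * eps) `^ 2^-1 <= t + eps.
  rewrite -ler_sqr ?nnegrE ?powR_ge0 ?addr_ge0 ?(ltW eps0)// !expr2 reg_root_sqr.
  by have := mulr_ge0 t0 (ltW eps0); lra.
by rewrite /reg; have := eps0; lra.
Qed.

Lemma reg'_root t : `|t * (t * t + eps * eps) `^ (2^-1 - 1)| <= 1.
Proof.
set z := t * t + eps * eps; have z0 : 0 < z by exact: sum_sq_gt0.
have E : z `^ (2^-1 - 1) = (z `^ 2^-1)^-1.
  by rewrite -powRN; congr (_ `^ _); field.
rewrite E normrM normfV ler_pdivrMr ?normr_gt0 ?gt_eqF ?powR_gt0// mul1r.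
by rewrite [leRHS]ger0_norm ?powR_ge0// reg_root_ge.
Qed.

Lemma reg'_ge0 t : 0 <= reg' eps t.
Proof. by rewrite /reg'; have := reg'_root t; rewrite ler_norml => /andP[]; lra. Qed.

Lemma reg'_le1 t : reg' eps t <= 1.
Proof. by rewrite /reg'; have := reg'_root t; rewrite ler_norml => /andP[]; lra. Qed.

Lemma reg'_ge t : 0 <= t -> 2^-1 <= reg' eps t.
Proof. by move=> t0; rewrite /reg' mulrDl mul1r lerDl divr_ge0// mulr_ge0// powR_ge0. Qed.

Lemma gfun_ge0 t : 0 <= gfun nu eps t. Proof. exact: powR_ge0. Qed.

Lemma reg_powRN (b : R) t : 0 <= b -> reg eps t `^ (- b) <= eps `^ (- b).
Proof.
move=> b0; rewrite !powRN lef_pV2 ?posrE ?powR_gt0 ?reg_gt0//.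
by rewrite ge0_ler_powR ?nnegrE ?(ltW eps0) ?(ltW (reg_gt0 t)) ?reg_ge_eps.
Qed.

Lemma gfun_norm_le t : `|gfun nu eps t| <= eps `^ (- nu).
Proof. by rewrite ger0_norm ?gfun_ge0// reg_powRN// ltW. Qed.

Lemma gfun'_norm_le t : `|gfun' nu eps t| <= nu * eps `^ (- nu - 1).
Proof.
rewrite /gfun' normrM [X in X * _]normrM normrN (gtr0_norm nu0) -mulrA ler_wpM2l ?(ltW nu0)//.
rewrite -[leRHS]mulr1 ler_pM//; last by rewrite ger0_norm ?reg'_ge0// reg'_le1.
by rewrite ger0_norm ?powR_ge0// -opprD reg_powRN// addr_ge0// ltW.
Qed.

Let reg_root_continuous (b : R) : continuous (fun t : R => (t * t + eps * eps) `^ b).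
Proof.
move=> t; apply: (@continuous_comp _ _ _ (fun t : R => t * t + eps * eps) (fun r : R => r `^ b)).
  by apply: continuousD; [apply: continuousM; exact: cvg_id|exact: cst_continuous].
by apply: powR_continuous_at; exact: sum_sq_gt0.
Qed.

Let reg_continuous : continuous (reg eps).
Proof.
move=> t; apply: (@continuousD _ _ _ (fun t : R => (t + (t * t + eps * eps) `^ 2^-1) / 2) (cst eps));
  last exact: cst_continuous.
apply: (@continuousM _ _ (fun t : R => t + (t * t + eps * eps) `^ 2^-1) (cst 2^-1));
  last exact: cst_continuous.
by apply: continuousD; [exact: cvg_id|exact: reg_root_continuous].
Qed.

Let reg_powR_continuous (b : R) : continuous (fun t : R => reg eps t `^ b).
Proof.
move=> t; apply: (@continuous_comp _ _ _ (reg eps) (fun r : R => r `^ b)).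
  exact: reg_continuous.
by apply: powR_continuous_at; exact: reg_gt0.
Qed.

Lemma gfun_continuous : continuous (gfun nu eps).
Proof. exact: reg_powR_continuous. Qed.

Lemma gfun'_continuous : continuous (gfun' nu eps).
Proof.
have c : continuous (reg' eps).
  move=> t; apply: (@continuousM _ _ (fun t : R => 1 + t * (t * t + eps * eps) `^ (2^-1 - 1)) (cst 2^-1));
    last exact: cst_continuous.
  apply: continuousD; first exact: cst_continuous.
  by apply: continuousM; [exact: cvg_id|exact: reg_root_continuous].
move=> t; apply: (@continuousM _ _ (fun t => - nu * reg eps t `^ (- nu - 1)) (reg' eps)); last exact: c.
apply: (@continuousM _ _ (cst (- nu)) (fun t => reg eps t `^ (- nu - 1))); first exact: cst_continuous.
exact: reg_powR_continuous.
Qed.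

End regularisation.

(* AM-GM: the cross term is absorbed by half of the term with gfun'. *)
Lemma absorb_cross (nu eps w phi d G2 W2 c F q : R) (s : nat) : 0 < nu -> 0 < eps -> 0 <= w ->
  0 <= phi -> (2 <= s)%N -> 0 <= W2 -> 0 <= G2 -> `|d| ^+ 2 <= W2 * G2 ->
  c * w `^ q <= F ->
  gfun nu eps w * (s%:R * phi ^+ s.-1 * d) + phi ^+ s * (gfun' nu eps w * W2) -
    F * phi ^+ s * gfun nu eps w <=
  s%:R ^+ 2 / (2 * nu) * (phi ^+ (s - 2) * reg eps w `^ (1 - nu) * G2) -
    c * (phi ^+ s * (w `^ q * gfun nu eps w)).
Proof.
move=> nu0 e0 w0 phi0 s2 W0 G0 dWG cF.
set g := gfun nu eps w; have g0 : 0 <= g by exact: gfun_ge0.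
have h3 : c * (phi ^+ s * (w `^ q * g)) <= F * phi ^+ s * g.
  rewrite (_ : c * _ = c * w `^ q * (phi ^+ s * g)); last by ring.
  by rewrite -[leRHS]mulrA ler_wpM2r// mulr_ge0// exprn_ge0.
set h := reg eps w; have h0 : 0 < h by exact: reg_gt0.
have gE : g = h `^ (- nu - 1) * h.
  by rewrite /g /gfun -/h (@powR_mul_self h (- nu) (ltW h0))// oppr_eq0 gt_eqF.
have hE : h `^ (1 - nu) = h `^ (- nu - 1) * h ^+ 2.
  rewrite expr2 mulrA -gE /g /gfun -/h -[X in _ * X]powRr1 ?(ltW h0)//.
  have hn0 : h != 0 by rewrite gt_eqF.
  by rewrite -powRD ?hn0 ?implybT// addrC.
set k := h `^ (- nu - 1) in gE hE *; have k0 : 0 < k by exact: powR_gt0.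
(* [reg'] is at least 1/2 for w >= 0, so at least nu / 2 of the good term is at hand; this fixes the
   constant s^2 / (2 nu). *)
have h2 : phi ^+ s * (gfun' nu eps w * W2) <= - (nu / 2 * (phi ^+ s * k * W2)).
  rewrite /gfun' -/h -/k -mulrN -subr_ge0.
  rewrite (_ : _ - _ = phi ^+ s * (nu * k * W2) * (reg' eps w - 2^-1)); last by field.
  rewrite mulr_ge0 ?subr_ge0 ?reg'_ge//.
  by rewrite !mulr_ge0 ?exprn_ge0// ltW.
have h1 : g * (s%:R * phi ^+ s.-1 * d) <= nu / 2 * (phi ^+ s * k * W2) +
    s%:R ^+ 2 / (2 * nu) * (phi ^+ (s - 2) * h `^ (1 - nu) * G2).
  case: s s2 {h2 h3} => [//|[//|s]] _.
  rewrite subn2 /= gE hE.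
  have [W00|W00] := eqVneq W2 0.
    have d0 : d = 0.
      apply/eqP; rewrite -normr_eq0 -sqrf_eq0 eq_le sqr_ge0 andbT.
      by apply: le_trans dWG _; rewrite W00 mul0r.
    rewrite d0 W00 !mulr0 add0r !mulr_ge0// ?invr_ge0 ?mulr_ge0 ?exprn_ge0 ?(ltW k0) ?(ltW nu0) ?(ltW h0)//.
  have {W0}W0 : 0 < W2 by rewrite lt_neqAle eq_sym W00.
  have G2d : d ^+ 2 / W2 <= G2.
    by rewrite ler_pdivrMr// mulrC -[d ^+ 2]ger0_norm ?sqr_ge0// normrX.
  set S : R := s.+2%:R.
  apply: (@le_trans _ _ (nu / 2 * (phi ^+ s.+2 * k * W2) +
     S ^+ 2 / (2 * nu) * (phi ^+ s * (k * h ^+ 2) * (d ^+ 2 / W2)))); last first.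
    rewrite lerD2l ler_wpM2l// ?divr_ge0 ?sqr_ge0 ?mulr_ge0 ?(ltW nu0)//.
    by rewrite ler_wpM2l// !mulr_ge0 ?exprn_ge0 ?(ltW k0) ?(ltW h0)//.
  (* The difference of the two sides is a positive multiple of the square of nu phi W2 - S h d. *)
  rewrite -subr_ge0.
  rewrite (_ : _ - _ = phi ^+ s * k / (2 * nu * W2) * (nu * phi * W2 - S * h * d) ^+ 2); last first.
    rewrite !exprS; field; rewrite !gt_eqF//.
  by rewrite mulr_ge0 ?sqr_ge0// divr_ge0 ?mulr_ge0 ?exprn_ge0 ?(ltW k0) ?(ltW nu0) ?(ltW W0).
by rewrite -/h; lra.
Qed.

End real_inequalities.

(** * Limits in the tested inequality *)

Lemma measurable_norm_powR d (T : measurableType d) (R : realType) (f : T -> R) (q : R) :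
  measurable_fun setT f -> measurable_fun setT (fun x => `|f x| `^ q).
Proof.
by move=> mf; apply: (measurableT_comp (measurable_powR q)); exact: measurableT_comp.
Qed.

Section ae_subsequence.
Context d (T : measurableType d) (R : realType) (mu : {measure set T -> \bar R}).

(** The integral of [f (s k)] is at most 2^-(k+1), so the series of these functions has finite
    integral, converges almost everywhere, and its terms tend to 0. *)
Lemma ae_cvg_subsequence (f : nat -> T -> R) :
  (forall k, measurable_fun setT (f k)) -> (forall k x, 0 <= f k x) ->
  (\int[mu]_x (f k x)%:E @[k --> \oo] --> 0)%E ->
  exists2 s : nat -> nat, (forall k, (k <= s k)%N) &
    {ae mu, forall x, f (s k) x @[k --> \oo] --> (0 : R)}.
Proof.
move=> mf f0 If.
pose c k : R := 1 / (2 ^ k.+1)%:R.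
have c0 k : 0 < c k by rewrite divr_gt0// ltr0n expn_gt0.
have ex k : exists m, (k <= m)%N /\ (\int[mu]_x (f m x)%:E <= (c k)%:E)%E.
  have h0 : (0 < (c k)%:E)%E by rewrite lte_fin.
  have [m _ hm] := If [set y | (y < (c k)%:E)%E] (open_ereal_lt' h0).
  exists (maxn k m); split; first exact: leq_maxl.
  by apply: ltW; apply: hm => /=; exact: leq_maxr.
pose s k := sval (cid (ex k)); exists s => [k|].
  by rewrite /s; case: cid => m [].
have Is k : (\int[mu]_x (f (s k) x)%:E <= (c k)%:E)%E.
  by rewrite /s; case: cid => m [].
have mfs k : measurable_fun setT (fun x => (f (s k) x)%:E) by exact/measurable_EFinP.
have fs0 k x : (0 <= (f (s k) x)%:E)%E by rewrite lee_fin.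
pose S x := (\sum_(k <oo) (f (s k) x)%:E)%E.
have S0 x : (0 <= S x)%E by apply: nneseries_ge0 => k _ _; exact: fs0.
have Soo : (\int[mu]_x S x < +oo)%E.
  rewrite integral_nneseries//.
  apply: (@le_lt_trans _ _ (\sum_(k <oo) (c k)%:E)%E).
    by apply: lee_nneseries => k *; [apply: integral_ge0 => x _; exact: fs0|exact: Is].
  apply: (@le_lt_trans _ _ (1%:E : \bar R)); last exact: ltry.
  exact: (@epsilon_trick0 R 1 xpredT).
have mS : measurable_fun setT S.
  by apply: ge0_emeasurable_sum.
have iS : mu.-integrable setT S.
  apply/integrableP; split => //.
  by under eq_integral do rewrite gee0_abs//.
have := integrable_ae measurableT iS; apply: ae_imp => x /(_ I) Sx.
have {}Sx : (S x < +oo)%E by rewrite -ge0_fin_numE.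
have tail := @nneseries_tail_cvg R (fun k => (f (s k) x)%:E) xpredT Sx (fun k _ => fs0 k x).
have C : (f (s k) x)%:E @[k --> \oo] --> (0 : \bar R)%E.
  apply: (squeeze_cvge _ (@cvg_cst _ (0 : \bar R)%E nat \oo _) tail).
  apply: nearW => k; rewrite fs0 /=.
  have := @nneseries_lim_ge R (fun k => (f (s k) x)%:E) xpredT k k.+1 (fun j _ _ => fs0 j x).
  by rewrite big_nat1.
by have C' : (f (s k) x)%:E @[k --> \oo] --> (0 : R)%:E by []; exact: fine_cvg C'.
Qed.

Lemma ae_cvg_power_subsequence (f : nat -> T -> R) (g : T -> R) (q : R) : 0 < q ->
  (forall k, measurable_fun setT (f k)) -> measurable_fun setT g ->
  (\int[mu]_x (`|f k x - g x| `^ q)%:E @[k --> \oo] --> 0)%E ->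
  exists2 s : nat -> nat, (forall k, (k <= s k)%N) &
    {ae mu, forall x, f (s k) x @[k --> \oo] --> g x}.
Proof.
move=> q0 mf mg If.
have [k||s ks H] := @ae_cvg_subsequence (fun k x => `|f k x - g x| `^ q) _ _ If.
- by apply: measurable_norm_powR; exact: measurable_funB.
- by move=> k x; exact: powR_ge0.
exists s => //; apply: ae_imp H => x /cvgrPdist_lt C.
apply/cvgrPdist_lt => e e0; have /C : 0 < e `^ q by rewrite powR_gt0.
apply: filterS => k; rewrite sub0r normrN ger0_norm ?powR_ge0// distrC.
by apply: contraTT; rewrite -!leNgt => h; rewrite ge0_ler_powR ?nnegrE ?(ltW e0) ?(ltW q0).
Qed.

End ae_subsequence.

Lemma cvg_subseq_ge {V : topologicalType} (u : nat -> V) (l : V) (s : nat -> nat) :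
  (forall k, (k <= s k)%N) -> u k @[k --> \oo] --> l -> u (s k) @[k --> \oo] --> l.
Proof.
move=> ks ul; apply: (cvg_comp s u _ ul) => A [N _ NA].
by exists N => // k /= Nk; apply: NA => /=; exact: leq_trans Nk (ks k).
Qed.

Lemma powR_norm_add_le {R : realType} (x y q : R) : 0 <= q ->
  `|x + y| `^ q <= 2 `^ q * (`|x| `^ q + `|y| `^ q).
Proof.
move=> q0; pose m := Num.max `|x| `|y|.
have m0 : 0 <= m by rewrite le_max normr_ge0.
have xm : `|x| <= m by rewrite le_max lexx.
have ym : `|y| <= m by rewrite le_max lexx orbT.
apply: (@le_trans _ _ ((2 * m) `^ q)).
  rewrite ge0_ler_powR ?nnegrE ?mulr_ge0//.
  by apply: le_trans (ler_normD _ _) _; rewrite mulrDl mul1r lerD.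
rewrite powRM// ler_wpM2l ?powR_ge0// /m.
by have [h|h] := leP `|x| `|y|; rewrite ?lerDr ?lerDl powR_ge0.
Qed.

Section vector_valued.
Context d (T : measurableType d) (R : realType) (mu : {measure set T -> \bar R}) (n : nat).
Implicit Types X Y : T -> 'rV[R]_n.

Definition vmeasurable X := forall i, measurable_fun setT (fun x => X x ord0 i).

Lemma vmeasurableB X Y : vmeasurable X -> vmeasurable Y -> vmeasurable (fun x => X x - Y x).
Proof.
move=> mX mY i; rewrite (_ : (fun x => _) = (fun x => X x ord0 i - Y x ord0 i)).
  exact: measurable_funB.
by apply/funext => x; rewrite !mxE.
Qed.

Lemma measurable_dot X Y : vmeasurable X -> vmeasurable Y ->
  measurable_fun setT (fun x => dot (X x) (Y x)).
Proof. by move=> mX mY; apply: measurable_sum => i; exact: measurable_funM. Qed.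

Lemma dot_young (x y : 'rV[R]_n) (c : R) : 0 < c ->
  `|dot x y| <= c * dot x x + c^-1 * dot y y.
Proof.
move=> c0; have h1 := dot_ge0 (c *: x + y); have h2 := dot_ge0 (c *: x - y).
have := dot_ge0 x; have := dot_ge0 y.
move: h1 h2; rewrite !(dotBl, dotBr, dotDl, dotDr, dotZl, dotZr) (dotC y x).
set a := dot x x; set b := dot x y; set e := dot y y => h1 h2 e0 a0.
have E : c * a + c^-1 * e = c^-1 * (c * c * a + e) by field; rewrite gt_eqF.
rewrite E ler_pdivlMl// -[c in c * `|b|]gtr0_norm// -normrM ler_norml.
have := mulr_ge0 (mulr_ge0 (ltW c0) (ltW c0)) a0.
by move=> h3; apply/andP; split; nra.
Qed.

Lemma rintegrable_dot X Y : vmeasurable X -> vmeasurable Y ->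
  rintegrable mu (fun x => dot (X x) (X x)) -> rintegrable mu (fun x => dot (Y x) (Y x)) ->
  rintegrable mu (fun x => dot (X x) (Y x)).
Proof.
move=> mX mY iX iY.
apply: (@rintegrable_le _ _ _ _ _ (fun x => 1 * dot (X x) (X x) + 1^-1 * dot (Y x) (Y x))).
- exact: measurable_dot.
- by move=> x; exact: dot_young.
- by apply: rintegrableD; exact: rintegrableZ.
Qed.

Lemma rintegrable_dotB X Y : vmeasurable X -> vmeasurable Y ->
  rintegrable mu (fun x => dot (X x) (X x)) -> rintegrable mu (fun x => dot (Y x) (Y x)) ->
  rintegrable mu (fun x => dot (X x - Y x) (X x - Y x)).
Proof.
move=> mX mY iX iY; have iXY := rintegrable_dot mX mY iX iY.
rewrite (_ : (fun x => _) = (fun x => dot (X x) (X x) - 2 * dot (X x) (Y x) + dot (Y x) (Y x))).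
  by apply: rintegrableD => //; apply: rintegrableB => //; exact: rintegrableZ.
by apply/funext => x; rewrite dotBl !dotBr (dotC (Y x) (X x)); ring.
Qed.

Lemma dot_integralB_cvg0 (X Y : nat -> T -> 'rV[R]_n) :
  (forall k, vmeasurable (X k)) -> (forall k, vmeasurable (Y k)) ->
  (forall k, rintegrable mu (fun x => dot (X k x) (X k x))) ->
  (forall k, rintegrable mu (fun x => dot (Y k x) (Y k x))) ->
  (\int[mu]_x (dot (X k x) (X k x)))%R @[k --> \oo] --> (0 : R) ->
  (\int[mu]_x (dot (Y k x) (Y k x)))%R @[k --> \oo] --> (0 : R) ->
  (\int[mu]_x (dot (X k x - Y k x) (X k x - Y k x)))%R @[k --> \oo] --> (0 : R).
Proof.
move=> mX mY iX iY X0 Y0.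
have C : 2 * (\int[mu]_x (dot (X k x) (X k x)))%R + 2 * (\int[mu]_x (dot (Y k x) (Y k x)))%R
    @[k --> \oo] --> (0 : R).
  have E0 : (0 : R) = 2 * 0 + 2 * 0 by ring.
  by rewrite [X in _ --> X]E0; apply: cvgD; apply: cvgM => //; exact: cvg_cst.
apply: (squeeze_cvgr _ (@cvg_cst _ (0 : R) nat \oo _) C).
apply: nearW => k; apply/andP; split; first by apply: Rintegral_ge0 => x _; exact: dot_ge0.
rewrite -(RintegralZl _ measurableT (iX k)) -(RintegralZl _ measurableT (iY k)).
have i1 := rintegrableZ 2 (iX k); have i2 := rintegrableZ 2 (iY k).
rewrite -RintegralD//; apply: le_Rintegral => //; first exact: rintegrable_dotB.
  exact: rintegrableD.
move=> x _; have := dot_ge0 (X k x + Y k x).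
rewrite !(dotBl, dotBr, dotDl, dotDr) (dotC (Y k x) (X k x)); lra.
Qed.

(** Cauchy-Schwarz through Young's inequality: with a weight of the order of the square root of the
    vanishing integral, both terms tend to 0. The summand 1/(k+1) keeps the weight positive. *)
Lemma dot_integral_cvg0 X (Y : nat -> T -> 'rV[R]_n) : vmeasurable X -> (forall k, vmeasurable (Y k)) ->
  rintegrable mu (fun x => dot (X x) (X x)) ->
  (forall k, rintegrable mu (fun x => dot (Y k x) (Y k x))) ->
  (\int[mu]_x (dot (Y k x) (Y k x)))%R @[k --> \oo] --> (0 : R) ->
  (\int[mu]_x `|dot (X x) (Y k x)|)%R @[k --> \oo] --> (0 : R).
Proof.
move=> mX mY iX iY Y0.
pose a := (\int[mu]_x (dot (X x) (X x)))%R.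
pose dk k := (\int[mu]_x (dot (Y k x) (Y k x)))%R.
have dk0 k : 0 <= dk k by apply: Rintegral_ge0 => x _; exact: dot_ge0.
pose del k : R := Num.sqrt (dk k) + k.+1%:R^-1.
have del0 k : 0 < del k by rewrite ltr_wpDl ?sqrtr_ge0.
have bnd k : (\int[mu]_x `|dot (X x) (Y k x)|)%R <= del k * a + Num.sqrt (dk k).
  apply: (@le_trans _ _ (\int[mu]_x (del k * dot (X x) (X x) + (del k)^-1 * dot (Y k x) (Y k x)))%R).
    apply: le_Rintegral => //.
    - by apply: rintegrable_norm; exact: rintegrable_dot.
    - by apply: rintegrableD; exact: rintegrableZ.
    - by move=> x _; exact: dot_young.
  rewrite RintegralD//; [|exact: rintegrableZ|exact: rintegrableZ].
  rewrite (RintegralZl _ measurableT iX) (RintegralZl _ measurableT (iY k)).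
  rewrite -/a -/(dk k) lerD2l ler_pdivrMl//.
  rewrite /del mulrDl -{1}(sqr_sqrtr (dk0 k)) expr2 lerDl mulr_ge0// sqrtr_ge0.
have sd : Num.sqrt (dk k) @[k --> \oo] --> (0 : R).
  by rewrite -[X in _ --> X]sqrtr0; apply: continuous_cvg => //; exact: sqrt_continuous.
have Cd : del k * a + Num.sqrt (dk k) @[k --> \oo] --> (0 : R).
  rewrite -[X in _ --> X]addr0; apply: cvgD => //; rewrite -[X in _ --> X](mul0r a).
  apply: cvgM; last exact: cvg_cst.
  by rewrite -[X in _ --> X]addr0; apply: cvgD => //; exact: cvg_harmonic.
apply: (squeeze_cvgr _ (@cvg_cst _ (0 : R) nat \oo _) Cd).
by apply: nearW => k; rewrite bnd andbT; apply: Rintegral_ge0.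
Qed.

End vector_valued.

(** * Limit along the approximating sequence *)

Section limit_of_test_functions.
Context d (T : measurableType d) (R : realType) (mu : {measure set T -> \bar R}) (n : nat).
Variables (g g' : R -> R) (C : R).
Hypotheses (gc : continuous g) (g'c : continuous g') (gC : forall t, `|g t| <= C)
  (g'C : forall t, `|g' t| <= C).

Let C0 : 0 <= C. Proof. exact: le_trans (gC 0). Qed.

Lemma measurable_cont_comp (h : R -> R) (w : T -> R) : continuous h -> measurable_fun setT w ->
  measurable_fun setT (fun x => h (w x)).
Proof. by move=> hc mw; apply: measurableT_comp => //; exact: continuous_measurable_fun. Qed.

(** What testing with psi g(w) produces. X comes from the inequality and Y from the gradient of w
    inside the test function; they coincide only in the limit. A stands for the pairing of X with
    a^{1/2} grad psi, F for the nonlinear term times psi. *)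
Definition test_integrand (psi A F w : T -> R) (X Y : T -> 'rV[R]_n) x :=
  g (w x) * A x + psi x * (g' (w x) * dot (X x) (Y x)) - F x * g (w x).

Lemma rintegrable_test (psi A F w : T -> R) (X Y : T -> 'rV[R]_n) (K : R) : measurable_fun setT psi -> (forall x, `|psi x| <= K) ->
  rintegrable mu A -> rintegrable mu F -> measurable_fun setT w ->
  vmeasurable X -> vmeasurable Y ->
  rintegrable mu (fun x => dot (X x) (X x)) -> rintegrable mu (fun x => dot (Y x) (Y x)) ->
  [/\ rintegrable mu (fun x => g (w x) * A x),
    rintegrable mu (fun x => psi x * (g' (w x) * dot (X x) (Y x))) &
    rintegrable mu (fun x => F x * g (w x))].
Proof.
move=> mpsi psiK iA iF mw mX mY iX iY.
have mg := measurable_cont_comp gc mw; have mg' := measurable_cont_comp g'c mw.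
split.
- under eq_fun do rewrite mulrC.
  exact: rintegrableM_bounded iA mg (fun x => gC (w x)).
- under eq_fun do rewrite mulrC.
  apply: rintegrableM_bounded mpsi psiK.
  under eq_fun do rewrite mulrC.
  by apply: rintegrableM_bounded mg' (fun x => g'C (w x)); exact: rintegrable_dot.
- exact: rintegrableM_bounded iF mg (fun x => gC (w x)).
Qed.

(** X stays fixed, so a multiple of dot X X is an integrable majorant as long as only [w_ k] varies;
    the remainder with X_k - X tends to 0 by Cauchy-Schwarz, psi and g' being bounded. *)
Lemma limit_in_k (psi A F w : T -> R) (w_ : nat -> T -> R) (X : T -> 'rV[R]_n)
    (X_ : nat -> T -> 'rV[R]_n) (K : R) :
  measurable_fun setT psi -> (forall x, `|psi x| <= K) ->
  rintegrable mu A -> rintegrable mu F ->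
  (forall k, measurable_fun setT (w_ k)) -> measurable_fun setT w ->
  {ae mu, forall x, w_ k x @[k --> \oo] --> w x} ->
  vmeasurable X -> (forall k, vmeasurable (X_ k)) ->
  rintegrable mu (fun x => dot (X x) (X x)) ->
  (forall k, rintegrable mu (fun x => dot (X_ k x) (X_ k x))) ->
  (forall k, rintegrable mu (fun x => dot (X_ k x - X x) (X_ k x - X x))) ->
  (\int[mu]_x (dot (X_ k x - X x) (X_ k x - X x)))%R @[k --> \oo] --> (0 : R) ->
  (\int[mu]_x test_integrand psi A F (w_ k) X (X_ k) x)%R @[k --> \oo] -->
  (\int[mu]_x test_integrand psi A F w X X x)%R.
Proof.
move=> mpsi psiK iA iF mw_ mw w_w mX mX_ iX iX_ iD D0.
have mg k := measurable_cont_comp gc (mw_ k); have mg' k := measurable_cont_comp g'c (mw_ k).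
have gcv (h : R -> R) : continuous h -> {ae mu, forall x, h (w_ k x) @[k --> \oo] --> h (w x)}.
  by move=> hc; apply: ae_imp w_w => x wx; apply: continuous_cvg => //; exact: hc.
have T1 (B : T -> R) : rintegrable mu B ->
    (\int[mu]_x (g (w_ k x) * B x))%R @[k --> \oo] --> (\int[mu]_x (g (w x) * B x))%R.
  move=> iB; have mB := rintegrable_measurable iB.
  have [//|||||//] := @rintegral_dominated _ _ _ mu (fun k x => g (w_ k x) * B x)
    (fun x => g (w x) * B x) (fun x => C * `|B x|).
  - by move=> k; exact: measurable_funM.
  - by apply: measurable_funM => //; exact: measurable_cont_comp.
  - by apply: ae_imp (gcv g gc) => x gx; apply: cvgM => //; exact: cvg_cst.
  - by apply: rintegrableZ; exact: rintegrable_norm.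
  - by apply: aeW => x k; rewrite normrM ler_wpM2r.
have iXX k := rintegrable_test mpsi psiK iA iF (mw_ k) mX mX iX iX.
have iXXk k := rintegrable_test mpsi psiK iA iF (mw_ k) mX (mX_ k) iX (iX_ k).
have [iw1 iw2 iw3] := rintegrable_test mpsi psiK iA iF mw mX mX iX iX.
have T2 : (\int[mu]_x (psi x * (g' (w_ k x) * dot (X x) (X x))))%R @[k --> \oo] -->
    (\int[mu]_x (psi x * (g' (w x) * dot (X x) (X x))))%R.
  have [//|||||//] := @rintegral_dominated _ _ _ mu
    (fun k x => psi x * (g' (w_ k x) * dot (X x) (X x)))
    (fun x => psi x * (g' (w x) * dot (X x) (X x))) (fun x => K * C * dot (X x) (X x)).
  - by move=> k; have [_ /rintegrable_measurable] := iXX k.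
  - exact: rintegrable_measurable iw2.
  - apply: ae_imp (gcv g' g'c) => x gx; apply: cvgM; first exact: cvg_cst.
    by apply: cvgM => //; exact: cvg_cst.
  - exact: rintegrableZ.
  - apply: aeW => x k; rewrite !normrM (ger0_norm (dot_ge0 _)) -mulrA ler_pM// ?mulr_ge0 ?dot_ge0//.
    by rewrite ler_wpM2r// dot_ge0.
have mD k := vmeasurableB (mX_ k) mX.
have iDk k := rintegrable_test mpsi psiK iA iF (mw_ k) mX (mD k) iX (iD k).
have T3 : (\int[mu]_x (psi x * (g' (w_ k x) * dot (X x) (X_ k x - X x))))%R @[k --> \oo] --> (0 : R).
  have Cd := dot_integral_cvg0 mX mD iX iD D0.
  have Cd' : (K * C) * (\int[mu]_x `|dot (X x) (X_ k x - X x)|)%R @[k --> \oo] --> (0 : R).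
    by rewrite -[X in _ --> X](mulr0 (K * C)); apply: cvgM => //; exact: cvg_cst.
  apply: norm_cvg0; apply: (squeeze_cvgr _ (@cvg_cst _ (0 : R) nat \oo _) Cd').
  apply: nearW => k; rewrite normr_ge0 /=.
  have [_ ik _] := iDk k.
  apply: le_trans (le_normr_Rintegral measurableT ik) _.
  have idot := rintegrable_norm (rintegrable_dot mX (mD k) iX (iD k)).
  rewrite -RintegralZl//; apply: le_Rintegral => //.
  - exact: rintegrable_norm.
  - exact: rintegrableZ.
  - move=> x _; rewrite !normrM -mulrA ler_pM// ?mulr_ge0//.
    by rewrite ler_wpM2r.
have T4 : (\int[mu]_x (psi x * (g' (w_ k x) * dot (X x) (X_ k x))))%R @[k --> \oo] -->
    (\int[mu]_x (psi x * (g' (w x) * dot (X x) (X x))))%R.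
  rewrite -[X in _ --> X]addr0.
  rewrite (_ : (fun k => _) = (fun k =>
    (\int[mu]_x (psi x * (g' (w_ k x) * dot (X x) (X x)))) +
    \int[mu]_x (psi x * (g' (w_ k x) * dot (X x) (X_ k x - X x))))%R); first exact: cvgD.
  apply/funext => k; have [_ i1 _] := iXX k; have [_ i2 _] := iDk k.
  rewrite -RintegralD//; apply: eq_Rintegral => x _.
  by rewrite dotBr; ring.
have E v Y : rintegrable mu (fun x => g (v x) * A x) ->
    rintegrable mu (fun x => psi x * (g' (v x) * dot (X x) (Y x))) ->
    rintegrable mu (fun x => F x * g (v x)) ->
    (\int[mu]_x test_integrand psi A F v X Y x =
     (\int[mu]_x (g (v x) * A x) + \int[mu]_x (psi x * (g' (v x) * dot (X x) (Y x)))) -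
     \int[mu]_x (g (v x) * F x))%R.
  move=> i1 i2 i3; rewrite RintegralB//; last exact: rintegrableD.
  rewrite RintegralD//; congr (_ - _).
  by apply: eq_Rintegral => x _; rewrite mulrC.
rewrite E//; rewrite (_ : (fun k => _) = (fun k =>
  (\int[mu]_x (g (w_ k x) * A x) + \int[mu]_x (psi x * (g' (w_ k x) * dot (X x) (X_ k x)))) -
     \int[mu]_x (g (w_ k x) * F x))%R); last first.
  by apply/funext => k; have [i1 i2 i3] := iXXk k; rewrite E.
by apply: cvgB; [apply: cvgD => //; exact: T1|exact: T1].
Qed.

End limit_of_test_functions.

(** * Removing the regularisation *)

Section regularisation_limit.
Context d (T : measurableType d) (R : realType) (mu : {measure set T -> \bar R}) (n : nat).

Lemma powR_cvg_pos (u : nat -> R) (t b : R) : 0 < t ->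
  u k @[k --> \oo] --> t -> u k `^ b @[k --> \oo] --> t `^ b.
Proof.
move=> t0 ut; have C : (fun r : R => r `^ b) @ t --> t `^ b by exact: powR_continuous_at.
exact: (cvg_comp _ _ ut C).
Qed.

Lemma powR_cvg (u : nat -> R) (t b : R) : 0 < b -> 0 <= t -> (forall k, 0 <= u k) ->
  u k @[k --> \oo] --> t -> u k `^ b @[k --> \oo] --> t `^ b.
Proof.
move=> b0; rewrite le_eqVlt => /predU1P[<-|t0] u0 ut; last first.
  exact: powR_cvg_pos.
rewrite powR0 ?gt_eqF//; apply/cvgrPdist_lt => e e0.
have e1 : 0 < e `^ b^-1 by rewrite powR_gt0.
move/cvgrPdist_lt : ut => /(_ _ e1); apply: filterS => k.
rewrite !sub0r !normrN !ger0_norm ?powR_ge0// => h.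
have -> : e = (e `^ b^-1) `^ b by rewrite -powRrM mulVf ?gt_eqF// powRr1// ltW.
by rewrite gt0_ltr_powR// nnegrE ?powR_ge0.
Qed.

Lemma powR_le1D (t b q : R) : 0 <= t -> 0 <= b <= q -> t `^ b <= 1 + t `^ q.
Proof.
move=> t0 /andP[b0 bq]; have [t1|t1] := leP t 1.
  apply: (@le_trans _ _ 1); last by rewrite lerDl powR_ge0.
  have [->|tn0] := eqVneq t 0; last first.
    by rewrite -(powRr0 t) ger_powR// lt_neqAle eq_sym tn0 t0.
  by have [->|b1] := eqVneq b 0; rewrite ?powRr0// powR0.
by apply: (@le_trans _ _ (t `^ q)); [rewrite ler_powR// ltW|rewrite lerDr].
Qed.

Variables (nu q c CG : R) (s : nat) (B : set T) (phi w F : T -> R) (P W : T -> 'rV[R]_n).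
Hypotheses (nu0 : 0 < nu) (nu1 : nu < 1) (q1 : 1 < q) (s2 : (2 < s)%N) (mB : measurable B)
  (Boo : (mu B < +oo)%E) (mphi : measurable_fun setT phi) (phi01 : forall x, 0 <= phi x <= 1)
  (phiB : forall x, phi x != 0 -> B x) (mw : measurable_fun setT w) (w0 : forall x, 0 <= w x)
  (iwq : rintegrable mu (fun x => \1_B x * w x `^ q))
  (Fw : {ae mu, forall x, c * w x `^ q <= F x})
  (mP : vmeasurable P) (PCG : forall x, dot (P x) (P x) <= CG)
  (iE : forall eps, 0 < eps -> rintegrable mu (test_integrand (gfun nu eps) (gfun' nu eps)
    (fun x => phi x ^+ s) (fun x => s%:R * phi x ^+ s.-1 * dot (W x) (P x))
    (fun x => F x * phi x ^+ s) w W W))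
  (E0 : forall eps, 0 < eps -> (0 <= \int[mu]_x test_integrand (gfun nu eps) (gfun' nu eps)
    (fun x => (phi x ^+ s)%R) (fun x => (s%:R * phi x ^+ s.-1 * dot (W x) (P x))%R)
    (fun x => (F x * phi x ^+ s)%R) w W W x)%R).

Let phi_ge0 x : 0 <= phi x. Proof. by have /andP[] := phi01 x. Qed.
Let phi_le1 x : phi x <= 1. Proof. by have /andP[] := phi01 x. Qed.
Let eps k : R := k.+1%:R^-1.
Let eps0 k : 0 < eps k. Proof. by rewrite invr_gt0. Qed.
Let eps1 k : eps k <= 1. Proof. by rewrite invf_le1// ler1n. Qed.
Let CG0 (x : T) : 0 <= CG. Proof. exact: le_trans (dot_ge0 _) (PCG x). Qed.

Let R1 k x := phi x ^+ (s - 2) * reg (eps k) (w x) `^ (1 - nu) * dot (P x) (P x).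
Let R2 k x := phi x ^+ s * (w x `^ q * gfun nu (eps k) (w x)).

Let reg_cvg x : reg (eps k) (w x) @[k --> \oo] --> w x.
Proof.
have C : w x + 2 * eps k @[k --> \oo] --> w x.
  rewrite -[X in _ --> X]addr0; apply: cvgD; first exact: cvg_cst.
  by rewrite -[X in _ --> X](mulr0 2); apply: cvgM; [exact: cvg_cst|exact: cvg_harmonic].
apply: (squeeze_cvgr _ (@cvg_cst _ (w x) nat \oo _) C).
by apply: nearW => k; rewrite reg_ge// reg_le.
Qed.

Let mreg k (b : R) : measurable_fun setT (fun x => reg (eps k) (w x) `^ b).
Proof.
have -> : (fun x => reg (eps k) (w x) `^ b) = (fun x => gfun (- b) (eps k) (w x)).
  by apply/funext => x; rewrite /gfun opprK.
apply: measurable_cont_comp => //; exact: gfun_continuous.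
Qed.

Let mphis j : measurable_fun setT (fun x => phi x ^+ j).
Proof. exact: measurable_funX. Qed.

Let mpow (b : R) : measurable_fun setT (fun x => w x `^ b).
Proof. by apply: (measurableT_comp (measurable_powR b)). Qed.

(** A majorant for all eps <= 1 at once: reg <= w + 2, hence reg^(1 - nu) <= 1 + (w + 2) <= 4 +
    w^q. *)
Let iG : rintegrable mu (fun x => 4 * \1_B x + \1_B x * w x `^ q).
Proof. by apply: rintegrableD => //; apply: rintegrableZ; exact: rintegrable_indic. Qed.

(** The exponent must be positive. It will be s - 2, which is why s > 2 is required and not merely s
    >= 2. *)
Let phi_indic j x : (0 < j)%N -> phi x ^+ j <= \1_B x.
Proof.
move=> j0; rewrite indicE; have [->|/phiB Bx] := eqVneq (phi x) 0.
  by rewrite expr0n; case: j j0.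
by rewrite mem_set// exprn_ile1.
Qed.

Let q0 : 0 < q. Proof. exact: lt_trans q1. Qed.

Let R1_le k x : `|R1 k x| <= CG * (4 * \1_B x + \1_B x * w x `^ q).
Proof.
have r0 := reg_gt0 (eps0 k) (w x).
rewrite ger0_norm; last by rewrite !mulr_ge0 ?exprn_ge0 ?powR_ge0 ?dot_ge0.
rewrite /R1 mulrC ler_pM ?mulr_ge0 ?exprn_ge0 ?powR_ge0 ?dot_ge0//.
apply: (@le_trans _ _ (\1_B x * (4 + w x `^ q))).
  apply: ler_pM; rewrite ?exprn_ge0 ?powR_ge0//.
    by rewrite phi_indic// subn_gt0.
  have w2 : 0 <= w x + 2 by rewrite addr_ge0.
  apply: (@le_trans _ _ ((w x + 2) `^ (1 - nu))).
    rewrite ge0_ler_powR ?nnegrE ?subr_ge0 ?(ltW nu1) ?(ltW r0)//.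
    apply: le_trans (reg_le (eps0 k) (w0 x)) _.
    by rewrite lerD2l -[leRHS]mulr1 ler_wpM2l.
  have b1 : 0 <= 1 - nu <= 1 by rewrite subr_ge0 (ltW nu1) lerBlDr lerDl ltW.
  apply: le_trans (powR_le1D w2 b1) _; rewrite powRr1//.
  have q1' : 0 <= (1 : R) <= q by rewrite ler01 ltW.
  by have := powR_le1D (w0 x) q1'; rewrite powRr1//; lra.
by rewrite mulrDr lerD2r mulrC.
Qed.

(** The tested integral is nonnegative, and [absorb_cross] bounds its integrand by a difference
    whose two parts converge under integrable majorants independent of eps. *)
Lemma regularisation_limit :
  [/\ rintegrable mu (fun x => phi x ^+ s * w x `^ (q - nu)),
      rintegrable mu (fun x => phi x ^+ (s - 2) * w x `^ (1 - nu) * dot (P x) (P x)) &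
      c * (\int[mu]_x (phi x ^+ s * w x `^ (q - nu)))%R <=
      s%:R ^+ 2 / (2 * nu) *
        (\int[mu]_x (phi x ^+ (s - 2) * w x `^ (1 - nu) * dot (P x) (P x)))%R].
Proof.
have mR1 k : measurable_fun setT (R1 k).
  by apply: measurable_funM; [exact: measurable_funM|exact: measurable_dot].
have mR2 k : measurable_fun setT (R2 k).
  by apply: measurable_funM => //; apply: measurable_funM => //; exact: mreg.
have m1 : measurable_fun setT (fun x => phi x ^+ (s - 2) * w x `^ (1 - nu) * dot (P x) (P x)).
  by apply: measurable_funM; [exact: measurable_funM|exact: measurable_dot].
have m2 : measurable_fun setT (fun x => phi x ^+ s * w x `^ (q - nu)) by exact: measurable_funM.
have nu10 : 0 < 1 - nu by rewrite subr_gt0.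
have cv1 x : R1 k x @[k --> \oo] --> phi x ^+ (s - 2) * w x `^ (1 - nu) * dot (P x) (P x).
  apply: cvgM; last exact: cvg_cst.
  apply: cvgM; first exact: cvg_cst.
  by apply: powR_cvg => // k; rewrite ltW// reg_gt0.
have cv2 x : R2 k x @[k --> \oo] --> phi x ^+ s * w x `^ (q - nu).
  apply: cvgM; first exact: cvg_cst.
  (* At w = 0 the factor w^q annihilates [gfun] for every eps, and w^(q - nu) is 0 as well since q >
     nu. *)
  have [wx|wx] := eqVneq (w x) 0.
    have qn : q != 0 by rewrite gt_eqF.
    have qnu : q - nu != 0 by rewrite gt_eqF// subr_gt0 (lt_trans nu1).
    rewrite wx !powR0//.
    rewrite (_ : (fun k => _) = cst 0); first exact: cvg_cst.
    by apply/funext => k; rewrite mul0r.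
  have wx0 : 0 < w x by rewrite lt_neqAle eq_sym wx w0.
  rewrite powRD ?wx ?implybT//; apply: cvgM; first exact: cvg_cst.
  by apply: powR_cvg_pos => //; exact: reg_cvg.
have R2_le k x : `|R2 k x| <= 4 * \1_B x + \1_B x * w x `^ q.
  rewrite ger0_norm; last by rewrite !mulr_ge0 ?exprn_ge0 ?powR_ge0 ?gfun_ge0.
  apply: (@le_trans _ _ (\1_B x * (1 + w x `^ q))).
    apply: ler_pM; rewrite ?exprn_ge0 ?mulr_ge0 ?powR_ge0 ?gfun_ge0//.
      by rewrite phi_indic// (leq_trans _ s2).
    have [wx|wx] := eqVneq (w x) 0.
      by rewrite wx powR0 ?gt_eqF// mul0r addr0.
    have wx0 : 0 < w x by rewrite lt_neqAle eq_sym wx w0.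
    apply: (@le_trans _ _ (w x `^ (q - nu))); last first.
      by apply: powR_le1D => //; rewrite lerBlDr lerDl (ltW nu0) andbT subr_ge0 ltW// (lt_trans nu1).
    rewrite powRD ?wx ?implybT// ler_wpM2l ?powR_ge0// /gfun !powRN.
    by rewrite lef_pV2 ?posrE ?powR_gt0 ?reg_gt0// ge0_ler_powR ?nnegrE ?(ltW nu0) ?(ltW (reg_gt0 _ _)) ?reg_ge.
  by rewrite mulrDr lerD2r mulrC ler_wpM2r// ler1n.
have [i1 _ C1] := rintegral_dominated mR1 m1 (aeW mu cv1) (rintegrableZ CG iG)
  (aeW mu (fun x k => R1_le k x)).
have [i2 _ C2] := rintegral_dominated mR2 m2 (aeW mu cv2) iG (aeW mu (fun x k => R2_le k x)).
split => //.
have iR1 k : rintegrable mu (R1 k).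
  by apply: rintegrable_le (mR1 k) (R1_le k) _; exact: rintegrableZ.
have iR2 k : rintegrable mu (R2 k) by exact: rintegrable_le (mR2 k) (R2_le k) iG.
set D := s%:R ^+ 2 / (2 * nu).
have key k : c * (\int[mu]_x R2 k x)%R <= D * (\int[mu]_x R1 k x)%R.
  rewrite -subr_ge0 -(RintegralZl _ measurableT (iR1 k)) -(RintegralZl _ measurableT (iR2 k)).
  rewrite -RintegralB//; try exact: rintegrableZ.
  apply: le_trans (E0 (eps0 k)) _; apply: ae_le_rintegral; first exact: iE.
    by apply: rintegrableB; exact: rintegrableZ.
  apply: ae_imp Fw => x Fx; apply: absorb_cross => //; rewrite ?dot_ge0//.
  - by rewrite ltnW.
  - rewrite -[leRHS]ger0_norm ?mulr_ge0 ?dot_ge0// -[dot (W x) (W x) * _]sqr_sqrtr ?mulr_ge0 ?dot_ge0//.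
    rewrite (ger0_norm (sqr_ge0 _)) lerXn2r ?nnegrE ?sqrtr_ge0// sqrtrM ?dot_ge0//.
    exact: normr_dot_le.
have C1' : D * (\int[mu]_x R1 k x)%R @[k --> \oo] -->
    D * (\int[mu]_x (phi x ^+ (s - 2) * w x `^ (1 - nu) * dot (P x) (P x)))%R.
  by apply: cvgM; [exact: cvg_cst|exact: C1].
have C2' : c * (\int[mu]_x R2 k x)%R @[k --> \oo] -->
    c * (\int[mu]_x (phi x ^+ s * w x `^ (q - nu)))%R.
  by apply: cvgM; [exact: cvg_cst|exact: C2].
by apply: (ler_cvg_to C2' C1'); apply: nearW; exact: key.
Qed.

End regularisation_limit.

(** * Measurability of the coefficients *)

Section psd_sqrt_facts.
Context {R : realType} {n : nat}.
Implicit Types A : 'M[R]_n.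

(** Valid for every A, including the values of a at the exceptional points, so that the bounds on
    the root hold everywhere and not only almost everywhere. *)
Lemma psd_sqrt_case A : psd_sqrt A = 0 \/
  (psd_sqrt A)^T = psd_sqrt A /\ psd_sqrt A *m psd_sqrt A = A.
Proof.
rewrite /psd_sqrt; set S := [set B | _].
have [[B SB]|nS] := pselect (exists B, S B).
  by right; have [sB _ BB] : S (xget 0 S) := xgetPex 0 (ex_intro _ B SB).
by left; apply: xgetPN => B SB; apply: nS; exists B.
Qed.

Lemma psd_sqrt_sym A : (psd_sqrt A)^T = psd_sqrt A.
Proof. by case: (psd_sqrt_case A) => [->|[]//]; rewrite trmx0. Qed.

(** The diagonal entry of A is the sum of the squares of the i-th row of a symmetric root. *)
Lemma psd_sqrt_entry_le A i j : psd_sqrt A i j ^+ 2 <= `|A i i|.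
Proof.
case: (psd_sqrt_case A) => [->|[sB BB]]; first by rewrite mxE expr2 mulr0 normr_ge0.
set B := psd_sqrt A in sB BB *.
apply: le_trans (ler_norm _); rewrite -[in leRHS]BB mxE (bigD1 j)//=.
have E k : B k i = B i k by rewrite -[in LHS]sB mxE.
by rewrite E -expr2 lerDl sumr_ge0// => k _; rewrite E -expr2 sqr_ge0.
Qed.

End psd_sqrt_facts.

Section matrix_measurable.
Context d (T : measurableType d) (R : realType) (n : nat).
Implicit Types M N : T -> 'M[R]_n.

Definition mmeasurable M := forall i j, measurable_fun setT (fun x => M x i j).

Lemma mmeasurable_cst (A : 'M[R]_n) : mmeasurable (fun=> A).
Proof. by move=> i j; exact: measurable_cst. Qed.

Lemma mmeasurableB M N : mmeasurable M -> mmeasurable N -> mmeasurable (fun x => M x - N x).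
Proof.
move=> mM mN i j; rewrite (_ : (fun x => _) = (fun x => M x i j - N x i j)).
  exact: measurable_funB.
by apply/funext => x; rewrite !mxE.
Qed.

Lemma mmeasurableD M N : mmeasurable M -> mmeasurable N -> mmeasurable (fun x => M x + N x).
Proof.
move=> mM mN i j; rewrite (_ : (fun x => _) = (fun x => M x i j + N x i j)).
  exact: measurable_funD.
by apply/funext => x; rewrite !mxE.
Qed.

Lemma mmeasurableZ (c : T -> R) M : measurable_fun setT c -> mmeasurable M ->
  mmeasurable (fun x => c x *: M x).
Proof.
move=> mc mM i j; rewrite (_ : (fun x => _) = (fun x => c x * M x i j)).
  exact: measurable_funM.
by apply/funext => x; rewrite !mxE.
Qed.

Lemma mmeasurable_mul M N : mmeasurable M -> mmeasurable N -> mmeasurable (fun x => M x *m N x).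
Proof.
move=> mM mN i j; rewrite (_ : (fun x => _) = (fun x => \sum_k M x i k * N x k j)).
  by apply: measurable_sum => k; exact: measurable_funM.
by apply/funext => x; rewrite !mxE.
Qed.

Lemma vmeasurable_mulmx (X : T -> 'rV[R]_n) M : vmeasurable X -> mmeasurable M ->
  vmeasurable (fun x => X x *m M x).
Proof.
move=> mX mM i; rewrite (_ : (fun x => _) = (fun x => \sum_k X x ord0 k * M x k i)).
  by apply: measurable_sum => k; exact: measurable_funM.
by apply/funext => x; rewrite !mxE.
Qed.

Lemma mmeasurable_sqrt_approx M k : mmeasurable M -> mmeasurable (fun x => rn_sqrt_approx k (M x)).
Proof.
move=> mM.
have mb : measurable_fun setT (fun x => mx_bound (M x)).
  apply: measurable_funD; first exact: measurable_cst.
  by apply: measurable_sum => i; apply: measurable_sum => j; exact: measurableT_comp.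
have b0 x : 0 < mx_bound (M x) by exact: mx_bound_gt0.
have mbi : measurable_fun setT (fun x => (mx_bound (M x))^-1).
  rewrite (_ : (fun x => _) = (fun x => mx_bound (M x) `^ (-1))).
    exact: (measurableT_comp (measurable_powR (-1)) mb).
  by apply/funext => x; rewrite powR_inv1// ltW.
have mbs : measurable_fun setT (fun x => Num.sqrt (mx_bound (M x))).
  rewrite (_ : (fun x => _) = (fun x => mx_bound (M x) `^ 2^-1)).
    exact: (measurableT_comp (measurable_powR 2^-1) mb).
  by apply/funext => x; rewrite powR12_sqrt// ltW.
pose Z x := 1%:M - (mx_bound (M x))^-1 *: M x.
have mZ : mmeasurable Z.
  by apply: mmeasurableB; [exact: mmeasurable_cst|exact: mmeasurableZ].
apply: mmeasurableZ => //; apply: mmeasurableB; first exact: mmeasurable_cst.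
elim: k => [|k IH]; first exact: mmeasurable_cst.
apply: mmeasurableZ; first exact: measurable_cst.
by apply: mmeasurableD => //; exact: mmeasurable_mul.
Qed.

End matrix_measurable.

Section coefficient_matrix.
Context {R : realType} {n : nat} (a : 'rV[R]_n -> 'M[R]_n).
Local Notation mu := (lebesgue_rV R n).
Local Notation T := (lebesgue_rVType R n).
Hypotheses (a_meas : forall i j, lebesgue_measurable_fun setT (fun x => a x i j))
  (a_bnd : forall i j, [locally [bounded a x i j | x in setT]])
  (a_sym : forall i j x, a x i j = a x j i)
  (a_psd : {ae mu, forall x, forall xi, 0 <= quad_form (a x) xi xi}).

Lemma ae_psd : {ae mu, forall x, psd (a x)}.
Proof. by apply: ae_imp a_psd => x px; apply: psd_quad_form => // i j; exact: a_sym. Qed.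

(** The measurable approximants converge to the root wherever a is positive semidefinite, and null
    sets are absorbed by completeness. *)
Lemma measurable_psd_sqrt : @mmeasurable _ T R n (fun x => psd_sqrt (a x)).
Proof.
move=> i j; have [N [mN N0 hN]] := ae_psd.
have mk k := @mmeasurable_sqrt_approx _ T R n a k (fun i j => @a_meas i j).
apply/measurable_EFinP.
apply: (@ae_measurable_fun _ _ _ mu (@lebesgue_rV_complete R n) setT
  (fun x => limn_esup (fun k => (rn_sqrt_approx k (a x) i j)%:E))).
  exists N; split => // x /= h; apply: hN => /= px; apply: h => _.
  have C : (rn_sqrt_approx k (a x) i j)%:E @[k --> \oo] --> (psd_sqrt (a x) i j)%:E.
    by apply: cvg_EFin; [exact: nearW|exact: psd_sqrt_cvg].
  rewrite is_cvg_limn_esupE; last by apply/cvg_ex; exists (psd_sqrt (a x) i j)%:E.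
  exact/cvg_lim.
by apply: measurable_fun_limn_esup => k; apply/measurable_EFinP; exact: mk.
Qed.

(** Local bounds become uniform on a compact cube: [compact_near_coveringP] is used with the bound
    itself, tending to infinity, as the parameter. *)
Lemma coefficient_bounded (r : R) : exists2 C : R, 0 <= C &
  forall x, `|x| <= r -> forall i j, `|a x i j| <= C.
Proof.
have cK : compact (cube r : set 'rV[R]_n).
  apply: bounded_closed_compact; last exact: closed_cube.
  exists r; split; first exact: num_real.
  by move=> M rM x xr; exact: le_trans xr (ltW rM).
have key i j : exists2 C : R, 0 <= C & forall x, `|x| <= r -> `|a x i j| <= C.
  have := (@compact_near_coveringP _ (cube r)).1 cK R (+oo)%R (fun M x => `|a x i j| <= M).
  case.
    move=> x _; have [M [_ hM]] := @a_bnd i j x Logic.I.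
    have hx : nbhs x [set y | `|a y i j| <= M + 1].
      have := hM (M + 1); rewrite ltrDl ltr01 => /(_ isT).
      by apply: (@filterS _ (nbhs x) (nbhs_filter x)) => y /(_ Logic.I).
    exists ([set y | `|a y i j| <= M + 1], [set t | M + 1 < t]) => /=.
      split => //; exists (M + 1); split; first exact: num_real.
      by [].
    by move=> [y t] /= [h1 h2]; exact: le_trans h1 (ltW h2).
  move=> M [_ hM]; exists (`|M| + 1); first by rewrite addr_ge0.
  by move=> x xr; apply: (hM (`|M| + 1)) => //; rewrite (le_lt_trans (ler_norm _))// ltrDl.
pose C i j := s2val (cid2 (key i j)).
have C0 i j : 0 <= C i j by rewrite /C; case: cid2.
have CP i j x : `|x| <= r -> `|a x i j| <= C i j by rewrite /C; case: cid2 => /= ? _; exact.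
exists (\sum_i \sum_j C i j).
  by apply: sumr_ge0 => i _; apply: sumr_ge0.
move=> x xr i j; apply: le_trans (CP i j x xr) _.
rewrite (bigD1 i)//= (bigD1 j)//= -addrA lerDl addr_ge0//.
  by apply: sumr_ge0.
by apply: sumr_ge0 => i' _; apply: sumr_ge0.
Qed.

End coefficient_matrix.

Section domain.
Context {R : realType} {n : nat}.
Local Notation T := (lebesgue_rVType R n).

Definition open_cube (r : R) : set 'rV[R]_n := [set x | `|x| < r].

Lemma open_open_cube r : open (open_cube r).
Proof.
have -> : open_cube r = (fun x : 'rV[R]_n => `|x|) @^-1` [set t | t < r] by [].
by apply: open_comp; [move=> x _; exact: norm_continuous|exact: open_lt].
Qed.

Lemma measurable_open_cube r : measurable (open_cube r : set T).
Proof. by apply: borel_lebesgue; apply: open_measurable_rV; exact: open_open_cube. Qed.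

Lemma open_cube_domain r : 0 < r -> bounded_domain (open_cube r).
Proof.
move=> r0; split.
- by exists 0; rewrite /open_cube /= normr0.
- exact: open_open_cube.
- have -> : open_cube r = \bigcup_(x in open_cube r) ((fun t : R => t *: x) @` `[0, 1]).
    apply/seteqP; split=> [x xr|y [x xr [t]]] /=.
      by exists x => //; exists 1 => //=; rewrite ?scale1r// in_itv/= ler01 lexx.
    rewrite in_itv/= => /andP[t0 t1] <-; rewrite /open_cube /= normrZ ger0_norm//.
    by apply: le_lt_trans xr; rewrite ler_piMl.
  apply: bigcup_connected.
    exists 0 => x _; exists 0; rewrite ?scale0r//=.
    by rewrite in_itv/= lexx ler01.
  move=> x _; apply: connected_continuous_connected; first exact: segment_connected.
  apply: continuous_subspaceT => t.
  by apply: scalel_continuous.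
- exists r; split; first exact: num_real.
  by move=> M rM x xr; exact: ltW (lt_trans xr rM).
Qed.

Lemma open_cube_lty r : (lebesgue_rV R n (open_cube r) < +oo)%E.
Proof.
apply: le_lt_trans (cube_lty r); apply: le_measure; rewrite ?inE.
- exact: measurable_open_cube.
- exact: measurable_cube.
- by move=> x /ltW.
Qed.

Lemma continuous_on_measurable (Q : set 'rV[R]_n) (f : 'rV[R]_n -> R) : open Q ->
  (forall x, Q x -> {for x, continuous f}) -> lebesgue_measurable_fun Q f.
Proof.
move=> oQ cf; have mQ : measurable (Q : set T).
  by apply: borel_lebesgue; exact: open_measurable_rV.
apply: (measurability _ (RGenOpens.measurableE R)).
move=> _ [_ [a [b ->] <-]].
apply: borel_lebesgue; apply: open_measurable_rV.
rewrite openE => x [Qx fx]; rewrite /interior.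
have h1 : nbhs x Q by apply: open_nbhs_nbhs.
have h2 : nbhs x (f @^-1` `]a, b[%classic).
  apply: (cf x Qx); apply: open_nbhs_nbhs; split => //; exact: interval_open.
exact: filterI h1 h2.
Qed.

Lemma smooth_on_measurable (Q : set 'rV[R]_n) f : open Q -> smooth_on Q f ->
  lebesgue_measurable_fun Q f.
Proof. by move=> oQ sf; apply: continuous_on_measurable => // x; exact: smooth_on_continuous. Qed.

Lemma measurable_indicM (Q : set T) (f : T -> R) : measurable Q ->
  measurable_fun Q f -> measurable_fun setT (fun x => \1_Q x * f x).
Proof.
move=> mQ mf; have := (@measurable_restrictT _ _ T (measurableTypeR R) Q f mQ).1 mf.
rewrite (_ : (f \_ Q) = (fun x => \1_Q x * f x))//.
apply/funext => x; rewrite patchE indicE; case: ifPn => _; by rewrite ?mul1r ?mul0r.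
Qed.

End domain.

(** * Approximation in W^{L,q} *)

Lemma poweR_cvg0 {R : realType} (x : nat -> \bar R) (b : R) : 0 < b -> (forall k, 0 <= x k)%E ->
  (x k `^ b @[k --> \oo] --> 0)%E -> (x k @[k --> \oo] --> 0)%E.
Proof.
move=> b0 x0 xb.
have xb' : (x k `^ b)%E @[k --> \oo] --> (0 : R)%:E by [].
have [fin C] := (fine_cvgP _ _).1 xb'.
apply/fine_cvgP; split.
  apply: filterS fin => k; rewrite !ge0_fin_numE ?poweR_ge0//.
  by apply: lty_poweRy; rewrite gt_eqF.
have E k : fine (x k) = (fine (x k `^ b)%E) `^ b^-1.
  by rewrite fine_poweR -powRrM divff ?gt_eqF// powRr1// fine_ge0.
have b10 : 0 < b^-1 by rewrite invr_gt0.
have := @powR_cvg R (fun k => fine (x k `^ b)%E) 0 b^-1 b10 (lexx 0)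
  (fun k => fine_ge0 (poweR_ge0 _ _)) C.
rewrite powR0 ?gt_eqF//.
by under eq_fun do rewrite -E.
Qed.

Section truncation.
Context {R : realType} {n : nat} (a : 'rV[R]_n -> 'M[R]_n).
Local Notation mu := (lebesgue_rV R n).
Local Notation T := (lebesgue_rVType R n).
Hypotheses (a_meas : forall i j, lebesgue_measurable_fun setT (fun x => a x i j))
  (a_sym : forall i j x, a x i j = a x j i)
  (a_psd : {ae mu, forall x, forall xi, 0 <= quad_form (a x) xi xi}).
Implicit Types (Q : set 'rV[R]_n) (f g : 'rV[R]_n -> R) (F G : 'rV[R]_n -> 'rV[R]_n).

(** Elements of W^{L,q}(Q) are controlled on Q only; multiplied by the indicator they become
    measurable on the whole space, and all integrals are over one space. *)
Definition trunc Q F : T -> 'rV[R]_n := fun x => \1_Q x *: F x.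

Lemma truncB Q F G x : trunc Q (fun x => F x - G x) x = trunc Q F x - trunc Q G x.
Proof. exact: scalerBr. Qed.

Lemma dot_trunc Q F x : dot (trunc Q F x) (trunc Q F x) = \1_Q x * dot (F x) (F x).
Proof.
rewrite dotZl dotZr mulrA indicE; case: (_ \in _); rewrite ?mul0r//.
by rewrite mulr1.
Qed.

Lemma integral_restrict Q (f : T -> R) : (\int[mu]_(x in (Q : set T)) (f x)%:E = \int[mu]_x (\1_Q x * f x)%:E)%E.
Proof.
rewrite integral_mkcond; apply: eq_integral => x _; rewrite patchE indicE.
by case: ifPn => _; rewrite ?mul1r ?mul0r.
Qed.

Lemma vmeasurable_trunc Q F : measurable (Q : set T) ->
  (forall i, lebesgue_measurable_fun Q (fun x => F x ord0 i)) -> @vmeasurable _ T R n (trunc Q F).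
Proof.
move=> mQ mF i; rewrite (_ : (fun x => _) = (fun x => \1_Q x * F x ord0 i)).
  exact: (@measurable_indicM R n Q (fun x => F x ord0 i) mQ (mF i)).
by apply/funext => x; rewrite mxE.
Qed.

Lemma vmeasurable_trunc_sqrt_grad Q f : open Q -> smooth_on Q f ->
  @vmeasurable _ T R n (trunc Q (sqrt_grad a f)).
Proof.
move=> oQ sf.
have mQ : measurable (Q : set T) by apply: borel_lebesgue; exact: open_measurable_rV.
have -> : trunc Q (sqrt_grad a f) = (fun x => trunc Q (grad f) x *m psd_sqrt (a x)).
  by apply/funext => x; rewrite /trunc /sqrt_grad scalemxAl.
apply: vmeasurable_mulmx; last exact: measurable_psd_sqrt.
apply: vmeasurable_trunc => // i.
rewrite (_ : (fun x => _) = partial i f); last by apply/funext => x; rewrite mxE.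
by apply: smooth_on_measurable => //; exact: smooth_on_partial.
Qed.

Definition WL_approx Q f F (fk : nat -> 'rV[R]_n -> R) :=
  [/\ forall k, smooth_on Q (fk k),
      {ae mu, forall x, \1_Q x * fk k x @[k --> \oo] --> \1_Q x * f x},
      rintegrable mu (fun x : T => dot (trunc Q F x) (trunc Q F x)),
      (forall k, rintegrable mu (fun x : T =>
        dot (trunc Q (sqrt_grad a (fk k)) x) (trunc Q (sqrt_grad a (fk k)) x))) /\
      (forall k, rintegrable mu (fun x : T =>
        dot (trunc Q (sqrt_grad a (fk k)) x - trunc Q F x)
            (trunc Q (sqrt_grad a (fk k)) x - trunc Q F x))) &
      (\int[mu]_x dot (trunc Q (sqrt_grad a (fk k)) x - trunc Q F x)
            (trunc Q (sqrt_grad a (fk k)) x - trunc Q F x))%R @[k --> \oo] --> (0 : R)].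

Lemma rintegrable_of_lty (f : T -> R) : measurable_fun setT f -> (forall x, 0 <= f x) ->
  (\int[mu]_x (f x)%:E < +oo)%E -> rintegrable mu f.
Proof.
move=> mf f0 foo; apply/integrableP; split; first exact/measurable_EFinP.
by under eq_integral do rewrite gee0_abs ?lee_fin//.
Qed.

(** The errors are finite from some k0 on. Since f_k0 has finite norm, F is the difference of two
    fields in L^2, namely a^{1/2} grad f_k0 and the error; f is in L^q for the same reason. *)
Lemma in_WL_approx (q : R) Q f F : open Q -> 1 < q -> in_WL a q Q f F ->
  (exists fk, WL_approx Q f F fk) /\ rintegrable mu (fun x : T => \1_Q x * `|f x| `^ q).
Proof.
move=> oQ q1 [mf mF [fk [sfk fkc]]].
have q0 : 0 < q by exact: lt_trans q1.
have qE : qhat q = q by rewrite /qhat max_r// ltW.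
have mQ : measurable (Q : set T) by apply: borel_lebesgue; exact: open_measurable_rV.
have mQf : measurable_fun setT (fun x : T => \1_Q x * f x) by exact: measurable_indicM.
have mQF := vmeasurable_trunc mQ mF.
have sk k : smooth_on Q (fk k) by have [] := sfk k.
have mQfk k : measurable_fun setT (fun x : T => \1_Q x * fk k x).
  by apply: measurable_indicM => //; exact: smooth_on_measurable.
have mG k := vmeasurable_trunc_sqrt_grad oQ (sk k).
pose A k := (\int[mu]_(x in (Q : set T)) (dot (sqrt_grad a (fk k) x - F x) (sqrt_grad a (fk k) x - F x))%:E)%E.
pose B k := (\int[mu]_(x in (Q : set T)) (`|fk k x - f x| `^ q)%:E)%E.
have A0 k : (0 <= A k)%E by apply: integral_ge0 => x _; rewrite lee_fin dot_ge0.
have B0 k : (0 <= B k)%E by apply: integral_ge0 => x _; rewrite lee_fin powR_ge0.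
have C k : WL_pair_norm q Q (fun x => fk k x - f x) (fun x => sqrt_grad a (fk k) x - F x) =
  (A k `^ 2^-1 + B k `^ q^-1)%E by rewrite /WL_pair_norm qE.
have cA : (A k @[k --> \oo] --> 0)%E.
  apply: (@poweR_cvg0 _ A 2^-1) => //.
  apply: (squeeze_cvge _ (@cvg_cst _ (0 : \bar R)%E nat \oo _) fkc).
  by apply: nearW => k; rewrite C poweR_ge0/= leeDl// poweR_ge0.
have cB : (B k @[k --> \oo] --> 0)%E.
  apply: (@poweR_cvg0 _ B q^-1); rewrite ?invr_gt0//.
  apply: (squeeze_cvge _ (@cvg_cst _ (0 : \bar R)%E nat \oo _) fkc).
  by apply: nearW => k; rewrite C poweR_ge0/= leeDr// poweR_ge0.
have A_E k : A k = (\int[mu]_x (dot (trunc Q (sqrt_grad a (fk k)) x - trunc Q F x)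
    (trunc Q (sqrt_grad a (fk k)) x - trunc Q F x))%:E)%E.
  rewrite /A integral_restrict; apply: eq_integral => x _; congr (_%:E).
  by rewrite -truncB dot_trunc.
have B_E k : B k = (\int[mu]_x (`|\1_Q x * fk k x - \1_Q x * f x| `^ q)%:E)%E.
  rewrite /B integral_restrict; apply: eq_integral => x _; congr (_%:E).
  rewrite -mulrBr normrM powRM// indicE; case: (_ \in _).
    by rewrite normr1 powR1.
  by rewrite normr0 powR0 ?gt_eqF// !mul0r.
have fin : \forall k \near \oo, ((A k < +oo) && (B k < +oo))%E.
  have h : ((0 : \bar R) < 1)%E by rewrite lte_fin.
  have hA := cA _ (open_ereal_lt' h); have hB := cB _ (open_ereal_lt' h).
  near=> k; apply/andP; split.
    by apply: (@lt_trans _ _ 1%E); [near: k; exact: hA|exact: ltry].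
  by apply: (@lt_trans _ _ 1%E); [near: k; exact: hB|exact: ltry].
case: fin => k0 _ hfin.
have iD k : (k0 <= k)%N -> rintegrable mu (fun x : T => dot (trunc Q (sqrt_grad a (fk k)) x - trunc Q F x)
    (trunc Q (sqrt_grad a (fk k)) x - trunc Q F x)).
  move=> kk; apply: rintegrable_of_lty.
  - by apply: measurable_dot; exact: vmeasurableB.
  - by move=> x; exact: dot_ge0.
  - by rewrite -A_E; have /andP[] := hfin k kk.
have iBk k : (k0 <= k)%N -> rintegrable mu (fun x : T => `|\1_Q x * fk k x - \1_Q x * f x| `^ q).
  move=> kk; apply: rintegrable_of_lty.
  - exact: (@measurable_norm_powR _ T R _ q (measurable_funB (mQfk k) mQf)).
  - by move=> x; exact: powR_ge0.
  - by rewrite -B_E; have /andP[] := hfin k kk.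
have WLfin k : ((\int[mu]_(x in (Q : set T)) (quad_form (a x) (grad (fk k) x) (grad (fk k) x))%:E < +oo) /\
    (\int[mu]_(x in (Q : set T)) (`|fk k x| `^ q)%:E < +oo))%E.
  have [_] := sfk k; rewrite /WL_norm qE => h.
  have h1 := le_lt_trans (leeDl _ (poweR_ge0 _ _)) h.
  have h2 := le_lt_trans (leeDr _ (poweR_ge0 _ _)) h.
  split; first by apply: lty_poweRy h1; rewrite invr_eq0.
  by apply: lty_poweRy h2; rewrite invr_eq0 gt_eqF.
have iG k : rintegrable mu (fun x : T =>
    dot (trunc Q (sqrt_grad a (fk k)) x) (trunc Q (sqrt_grad a (fk k)) x)).
  have mg : @vmeasurable _ T R n (trunc Q (grad (fk k))).
    apply: vmeasurable_trunc => // i.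
    rewrite (_ : (fun x => _) = partial i (fk k)); last by apply/funext => x; rewrite mxE.
    by apply: smooth_on_measurable => //; exact: smooth_on_partial.
  have ma := vmeasurable_mulmx mg (fun i j => @a_meas i j).
  apply: rintegrable_of_lty; [exact: measurable_dot|by move=> x; exact: dot_ge0|].
  have [] := WLfin k; rewrite integral_restrict => + _; apply: le_lt_trans.
  rewrite le_eqVlt; apply/orP; left; apply/eqP.
  (* [WL_norm] is written with the quadratic form of a, which agrees with |a^{1/2} grad|^2 only
     where a is positive semidefinite. *)
  apply: (@ae_eq_integral _ T R mu setT _ _ measurableT).
  - by apply/measurable_EFinP; exact: measurable_dot.
  - apply/measurable_EFinP.
    have -> : (fun x : T => \1_Q x * quad_form (a x) (grad (fk k) x) (grad (fk k) x)) =
        (fun x : T => dot (trunc Q (grad (fk k)) x *m a x) (trunc Q (grad (fk k)) x)).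
      apply/funext => x; rewrite /trunc -scalemxAl dotZl dotZr mulrA -quad_formE indicE.
      by case: (_ \in _); rewrite ?mul1r ?mul0r.
    exact: measurable_dot.
  - apply: ae_imp (ae_psd a_sym a_psd) => x px _; congr (_%:E).
    by rewrite dot_trunc /sqrt_grad dot_psd_sqrt.
have iF : rintegrable mu (fun x : T => dot (trunc Q F x) (trunc Q F x)).
  have := rintegrable_dotB (mG k0) (vmeasurableB (mG k0) mQF) (iG k0) (iD k0 (leqnn _)).
  rewrite (_ : (fun x => _) = (fun x : T => dot (trunc Q F x) (trunc Q F x)))//.
  by apply/funext => x; rewrite subKr.
split; last first.
  have ifk : rintegrable mu (fun x : T => `|\1_Q x * fk k0 x| `^ q).
    apply: rintegrable_of_lty; [exact: (@measurable_norm_powR _ T R _ q (mQfk k0))|by move=> x; exact: powR_ge0|].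
    have [_] := WLfin k0; rewrite (integral_restrict Q); congr (_ < _)%E.
    apply: eq_integral => x _; congr (_%:E); rewrite normrM powRM// indicE; case: (_ \in _).
      by rewrite normr1 powR1.
    by rewrite normr0 powR0 ?gt_eqF// !mul0r.
  have E : (fun x : T => \1_Q x * `|f x| `^ q) = (fun x : T => `|\1_Q x * f x| `^ q).
    apply/funext => x; rewrite normrM powRM// indicE; case: (_ \in _).
      by rewrite normr1 powR1.
    by rewrite normr0 powR0 ?gt_eqF// !mul0r.
  rewrite E; apply: (rintegrable_le _ _ (rintegrableZ (2 `^ q) (rintegrableD ifk (iBk k0 (leqnn _))))).
    exact: (@measurable_norm_powR _ T R _ q mQf).
  move=> x; rewrite ger0_norm ?powR_ge0//.
  have := powR_norm_add_le (\1_Q x * fk k0 x) (- (\1_Q x * fk k0 x - \1_Q x * f x)) (ltW q0).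
  by rewrite subKr normrN.
have cB' : (\int[mu]_x (`|\1_Q x * fk (k0 + k)%N x - \1_Q x * f x| `^ q)%:E @[k --> \oo] --> 0)%E.
  have -> : (fun k => \int[mu]_x (`|\1_Q x * fk (k0 + k)%N x - \1_Q x * f x| `^ q)%:E)%E =
    (fun k => B (k + k0)%N) by apply/funext => k; rewrite B_E addnC.
  exact: (@cvg_subseq_ge _ B 0%E (fun k => (k + k0)%N) (fun k => leq_addr k0 k) cB).
have [s ks S] := @ae_cvg_power_subsequence _ T R mu (fun k x => \1_Q x * fk (k0 + k)%N x)
  (fun x => \1_Q x * f x) q q0 (fun k => mQfk _) mQf cB'.
have k0s k : (k0 <= k0 + s k)%N by exact: leq_addr.
(* The sequence starts at k0, from where all errors are finite, and is thinned out to converge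
   almost everywhere. *)
exists (fun k => fk (k0 + s k)%N); split.
- by move=> k; exact: sk.
- exact: S.
- exact: iF.
- by split => k; [exact: iG|exact: iD].
have cA' : fine (A k) @[k --> \oo] --> (0 : R).
  have cA1 : A k @[k --> \oo] --> (0 : R)%:E by exact: cA.
  exact: fine_cvg cA1.
have := @cvg_subseq_ge _ _ _ (fun k => (k0 + s k)%N) (fun k => leq_trans (ks k) (leq_addl _ _)) cA'.
apply: cvg_trans; apply: near_eq_cvg; apply: nearW => k.
by rewrite A_E.
Unshelve. all: by end_near. Qed.

Lemma WL_approxB Q f F g G fk gk : open Q -> @vmeasurable _ T R n (trunc Q F) ->
  @vmeasurable _ T R n (trunc Q G) -> WL_approx Q f F fk -> WL_approx Q g G gk ->
  WL_approx Q (fun x => f x - g x) (fun x => F x - G x) (fun k x => fk k x - gk k x).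
Proof.
move=> oQ mF mG [sf cf iF [if1 if2] If] [sg cg iG [ig1 ig2] Ig].
have mSf k := vmeasurable_trunc_sqrt_grad oQ (sf k).
have mSg k := vmeasurable_trunc_sqrt_grad oQ (sg k).
have E k x : trunc Q (sqrt_grad a (fun x => fk k x - gk k x)) x =
    trunc Q (sqrt_grad a (fk k)) x - trunc Q (sqrt_grad a (gk k)) x.
  have [Qx|nQx] := pselect (Q x); last first.
    by rewrite /trunc indicE memNset// !scale0r subr0.
  rewrite -truncB /trunc; congr (_ *: _); rewrite /sqrt_grad -mulmxBl; congr (_ *m _).
  apply/rowP => i; rewrite !mxE /partial.
  exact: (deriveB (smooth_on_derivable (sf k) Qx) (smooth_on_derivable (sg k) Qx)).
have E' k : (fun x : T => trunc Q (sqrt_grad a (fun x => fk k x - gk k x)) x) =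
    (fun x : T => trunc Q (sqrt_grad a (fk k)) x - trunc Q (sqrt_grad a (gk k)) x).
  by apply/funext => x; exact: E.
have D k x : trunc Q (sqrt_grad a (fun x => fk k x - gk k x)) x - trunc Q (fun x => F x - G x) x =
    (trunc Q (sqrt_grad a (fk k)) x - trunc Q F x) - (trunc Q (sqrt_grad a (gk k)) x - trunc Q G x).
  by rewrite E truncB !opprB addrACA [RHS]addrAC -!addrA; congr (_ + _); rewrite addrCA !addrA [RHS]addrC !addrA.
split.
- move=> k; have sN : smooth_on Q (fun x => -1 * gk k x).
    by exact: (smooth_onM oQ (smooth_on_cst (-1) oQ) (sg k)).
  have := smooth_onD oQ (sf k) sN; congr (smooth_on Q _).
  by apply/funext => x; rewrite mulN1r.
- apply: ae_imp2 cf cg => x cfx cgx.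
  under eq_fun do rewrite mulrBr; rewrite mulrBr; exact: cvgB.
- have := rintegrable_dotB mF mG iF iG; congr (rintegrable mu _).
  by apply/funext => x; rewrite truncB.
- split => k.
    have := rintegrable_dotB (mSf k) (mSg k) (if1 k) (ig1 k); congr (rintegrable mu _).
    by apply/funext => x; rewrite E.
  have := rintegrable_dotB (vmeasurableB (mSf k) mF) (vmeasurableB (mSg k) mG) (if2 k) (ig2 k).
  congr (rintegrable mu _).
  by apply/funext => x; rewrite D.
- have := dot_integralB_cvg0 (fun k => vmeasurableB (mSf k) mF) (fun k => vmeasurableB (mSg k) mG)
    if2 ig2 If Ig.
  apply: cvg_trans; apply: near_eq_cvg; apply: nearW => k.
  by apply: eq_Rintegral => x _; rewrite D.
Qed.

End truncation.

(** * Smooth test functions *)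

Section chain_rule.
Context {R : realType} {n : nat}.
Variables (nu eps : R).
Hypotheses (eps0 : 0 < eps).

Lemma is_derive_gfun (w : 'rV[R]_n -> R) x i : derivable w x (unit_rV i) ->
  is_derive x (unit_rV i) (fun y => gfun nu eps (w y)) (gfun' nu eps (w x) * partial i w x).
Proof.
move=> dw; have Dw : is_derive x (unit_rV i) w (partial i w x) by exact: derivableP.
pose z y := w y * w y + eps * eps.
have Dz : is_derive x (unit_rV i) z (2 * w x * partial i w x).
  have h := is_deriveD (is_deriveM Dw Dw) (is_derive_cst (eps * eps) x (unit_rV i)).
  apply: is_derive_eq h _; rewrite /GRing.scale /=; ring.
have z0 : 0 < z x by exact: sum_sq_gt0.
have Dr := @partial_powR R n z 2^-1 x i z0 (@ex_derive _ _ _ _ _ _ _ Dz).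
have pz : partial i z x = 2 * w x * partial i w x by exact: (@derive_val _ _ _ _ _ _ _ Dz).
rewrite pz in Dr.
have Dh : is_derive x (unit_rV i) (fun y => reg eps (w y)) (reg' eps (w x) * partial i w x).
  have h := is_deriveD (is_deriveM (is_deriveD Dw Dr) (is_derive_cst (2^-1 : R) x (unit_rV i)))
    (is_derive_cst eps x (unit_rV i)).
  by apply: is_derive_eq h _; rewrite /GRing.scale /= /reg' -/(z x); field.
have h0 : 0 < reg eps (w x) by exact: reg_gt0.
have Dg := @partial_powR R n (fun y => reg eps (w y)) (- nu) x i h0 (@ex_derive _ _ _ _ _ _ _ Dh).
have ph : partial i (fun y => reg eps (w y)) x = reg' eps (w x) * partial i w x.
  exact: (@derive_val _ _ _ _ _ _ _ Dh).
rewrite ph in Dg.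
by apply: is_derive_eq Dg _; rewrite /gfun' mulrA.
Qed.

Lemma smooth_on_gfun (Q : set 'rV[R]_n) w : open Q -> smooth_on Q w ->
  smooth_on Q (fun x => gfun nu eps (w x)).
Proof.
move=> oQ sw.
have sz : smooth_on Q (fun x => w x * w x + eps * eps).
  exact: (smooth_onD oQ (smooth_onM oQ sw sw) (smooth_on_cst _ oQ)).
have sr := smooth_on_powR 2^-1 oQ sz (fun x _ => sum_sq_gt0 eps0 (w x)).
have sh := smooth_onD oQ (smooth_onM oQ (smooth_onD oQ sw sr) (smooth_on_cst 2^-1 oQ))
  (smooth_on_cst eps oQ).
exact: (smooth_on_powR (- nu) oQ sh (fun x _ => reg_gt0 eps0 (w x))).
Qed.

End chain_rule.

Section test_functions.
Context {R : realType} {n : nat} (a : 'rV[R]_n -> 'M[R]_n).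
Local Notation mu := (lebesgue_rV R n).
Local Notation T := (lebesgue_rVType R n).
Hypotheses (a_meas : forall i j, lebesgue_measurable_fun setT (fun x => a x i j))
  (a_bnd : forall i j, [locally [bounded a x i j | x in setT]])
  (a_sym : forall i j x, a x i j = a x j i)
  (a_psd : {ae mu, forall x, forall xi, 0 <= quad_form (a x) xi xi}).

Lemma psd_sqrt_bounded (r : R) : exists2 K : R, 0 <= K &
  forall x, `|x| <= r -> forall i j, `|psd_sqrt (a x) i j| <= K.
Proof.
have [C C0 aC] := coefficient_bounded a_bnd r; exists (1 + C); first by rewrite addr_ge0.
move=> x xr i j; have h := le_trans (psd_sqrt_entry_le (a x) i j) (aC x xr i i).
have [h1|h1] := leP `|psd_sqrt (a x) i j| 1; first by rewrite (le_trans h1)// lerDl.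
apply: le_trans (_ : C <= _); last by rewrite lerDr.
apply: le_trans h; rewrite -real_normK ?num_real// expr2.
by rewrite ler_peMl// ltW.
Qed.

Lemma sqrt_grad_bounded psi (C r : R) :
  (forall i, lebesgue_measurable_fun setT (partial i psi)) ->
  (forall i x, `|partial i psi x| <= C) ->
  (forall i x, partial i psi x != 0 -> `|x| <= r) ->
  [/\ @vmeasurable _ T R n (sqrt_grad a psi),
      exists K, forall x, dot (sqrt_grad a psi x) (sqrt_grad a psi x) <= K &
      rintegrable mu (fun x : T => dot (sqrt_grad a psi x) (sqrt_grad a psi x))].
Proof.
move=> mp pC pr.
have mg : @vmeasurable _ T R n (grad psi).
  move=> i; rewrite (_ : (fun x => _) = partial i psi); first exact: mp.
  by apply/funext => x; rewrite mxE.
have mP : @vmeasurable _ T R n (sqrt_grad a psi).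
  exact: vmeasurable_mulmx mg (measurable_psd_sqrt a_meas a_sym a_psd).
have [K K0 hK] := psd_sqrt_bounded r.
have P0 x : ~ `|x| <= r -> sqrt_grad a psi x = 0.
  move=> xr; rewrite /sqrt_grad (_ : grad psi x = 0) ?mul0mx//.
  apply/rowP => i; rewrite !mxE; apply/eqP; apply: contra_notT xr => h; exact: pr h.
pose M := \sum_(j < n) C * K.
have PM x i : `|sqrt_grad a psi x ord0 i| <= `|M|.
  have [xr|/negP xr] := boolP (`|x| <= r); last by rewrite P0// mxE normr0.
  apply: le_trans (ler_norm _); rewrite /M mxE.
  apply: le_trans (ler_norm_sum _ _ _) _; apply: ler_sum => j _.
  by rewrite mxE normrM ler_pM// hK.
pose K' := \sum_(j < n) `|M| * `|M|.
have PK x : dot (sqrt_grad a psi x) (sqrt_grad a psi x) <= K'.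
  apply: ler_sum => j _; apply: le_trans (ler_norm _) _.
  by rewrite normrM ler_pM.
split => //; first by exists K'.
apply: (@bounded_support_integrable _ _ _ K' r).
- exact: (measurable_dot mP mP).
- by move=> x; rewrite ger0_norm// dot_ge0.
- move=> x h; apply: contrapT => xr; move: h.
  by rewrite P0// /dot big1 ?eqxx// => j _; rewrite mxE mul0r.
Qed.

Variables (q nu eps : R) (u v : 'rV[R]_n -> R) (U V : 'rV[R]_n -> 'rV[R]_n).
Hypotheses (q1 : 1 < q) (nu0 : 0 < nu) (eps0 : 0 < eps) (huv : entire_solution a q u U v V).

Local Notation g := (gfun nu eps).
Local Notation g' := (gfun' nu eps).

Definition pw (t : R) : R := `|t| `^ (q - 1) * t.

Section fixed_cube.
Variables (r' r : R).
Hypotheses (r0 : 0 < r) (r'r : r' < r).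
Let Q : set 'rV[R]_n := open_cube r.
Let oQ : open Q := @open_open_cube R n r.
Let mQ : measurable (Q : set T) := @measurable_open_cube R n r.

Lemma trunc_pw f x : \1_Q x * pw (f x) = pw (\1_Q x * f x).
Proof.
rewrite /pw indicE; case: (_ \in _); rewrite ?mul1r//.
by rewrite !mul0r mulr0.
Qed.

Lemma rintegrable_trunc_pw f : lebesgue_measurable_fun Q f ->
  rintegrable mu (fun x : T => \1_Q x * `|f x| `^ q) ->
  rintegrable mu (fun x : T => \1_Q x * pw (f x)).
Proof.
move=> mf; have mQf := @measurable_indicM R n Q f mQ mf.
apply: rintegrable_le.
  under eq_fun do rewrite trunc_pw.
  exact: (measurable_funM (measurable_norm_powR (q - 1) mQf) mQf).
move=> x; rewrite normrM ger0_norm// ler_wpM2l//.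
rewrite /pw normrM ger0_norm ?powR_ge0// -powR_mul_self//.
by rewrite gt_eqF// (lt_trans _ q1).
Qed.

Let C0 : R := eps `^ (- nu) + nu * eps `^ (- nu - 1).
Let gC t : `|g t| <= C0.
Proof.
apply: le_trans (gfun_norm_le nu0 eps0 t) _.
by rewrite lerDl mulr_ge0 ?powR_ge0// ltW.
Qed.
Let g'C t : `|g' t| <= C0.
Proof.
apply: le_trans (gfun'_norm_le nu0 eps0 t) _.
by rewrite lerDr powR_ge0.
Qed.
Let gc : continuous g. Proof. exact: gfun_continuous. Qed.
Let g'c : continuous g'. Proof. exact: gfun'_continuous. Qed.

Let inU : in_WL a q Q u U. Proof. by have [h _ _] := huv; apply: h; exact: open_cube_domain. Qed.
Let inV : in_WL a q Q v V. Proof. by have [_ h _] := huv; apply: h; exact: open_cube_domain. Qed.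
Let mu_ : lebesgue_measurable_fun Q u. Proof. by case: inU. Qed.
Let mv_ : lebesgue_measurable_fun Q v. Proof. by case: inV. Qed.
Let mU : @vmeasurable _ T R n (trunc Q U).
Proof. by apply: vmeasurable_trunc => //; case: inU. Qed.
Let mV : @vmeasurable _ T R n (trunc Q V).
Proof. by apply: vmeasurable_trunc => //; case: inV. Qed.
Let wd x := u x - v x.
Let W x := U x - V x.
Let F x := \1_Q x * (pw (u x) - pw (v x)).
Let tw : T -> R := fun x => \1_Q x * wd x.

Let mW : @vmeasurable _ T R n (trunc Q W).
Proof.
rewrite (_ : trunc Q W = (fun x => trunc Q U x - trunc Q V x)); first exact: vmeasurableB.
by apply/funext => x; rewrite truncB.
Qed.

Let mtw : measurable_fun setT tw.
Proof. exact: (@measurable_indicM R n Q wd mQ (measurable_funB mu_ mv_)). Qed.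

Lemma trunc_facts :
  [/\ @vmeasurable _ T R n (trunc Q W), measurable_fun setT tw,
      rintegrable mu (fun x : T => dot (trunc Q W x) (trunc Q W x)),
      rintegrable mu (F : T -> R) & rintegrable mu (fun x : T => \1_Q x * `|wd x| `^ q)].
Proof.
have [[fk [_ _ iU _ _]] iu] := in_WL_approx a_meas a_sym a_psd oQ q1 inU.
have [[gk [_ _ iV _ _]] iv] := in_WL_approx a_meas a_sym a_psd oQ q1 inV.
split => //.
- have := rintegrable_dotB mU mV iU iV; congr (rintegrable mu _).
  by apply/funext => x; rewrite truncB.
- have := rintegrableB (rintegrable_trunc_pw mu_ iu) (rintegrable_trunc_pw mv_ iv).
  by congr (rintegrable mu _); apply/funext => x; rewrite /F mulrBr.
- have q0 : 0 <= q by rewrite ltW// (lt_trans _ q1).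
  have qn0 : q != 0 by rewrite gt_eqF// (lt_trans _ q1).
  have E f x : \1_Q x * `|f x| `^ q = `|\1_Q x * f x| `^ q.
    rewrite normrM powRM// indicE; case: (_ \in _).
      by rewrite normr1 powR1.
    by rewrite normr0 powR0// !mul0r.
  apply: (rintegrable_le _ _ (rintegrableZ (2 `^ q) (rintegrableD iu iv))).
    under eq_fun do rewrite E.
    exact: (@measurable_norm_powR _ T R _ q mtw).
  move=> x; rewrite E ger0_norm ?powR_ge0// !E mulrBr.
  by have := powR_norm_add_le (\1_Q x * u x) (- (\1_Q x * v x)) q0; rewrite normrN.
Qed.

Section test.
Variables (psi : 'rV[R]_n -> R) (C : R).
Hypotheses (spsi : smooth_on setT psi) (psi0 : forall x, 0 <= psi x)
  (psir : forall x, psi x != 0 -> `|x| <= r').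

Let psi_out x : ~ Q x -> psi x = 0.
Proof.
move=> nQ; apply/eqP; apply: contra_notT nQ => /psir h.
exact: le_lt_trans h r'r.
Qed.

Let zeta (w : 'rV[R]_n -> R) x := psi x * g (w x).

Let zeta_supp w x : zeta w x != 0 -> `|x| <= r'.
Proof.
by move=> h; apply: psir; apply: contraNneq h => p0; rewrite /zeta p0 mul0r.
Qed.

(** w is smooth only on Q. Near a point outside Q the product vanishes, because psi is supported in
    the closed cube of radius r' < r. *)
Let zeta_smooth w : smooth_on Q w -> smooth_on setT (zeta w).
Proof.
move=> sw; apply: smooth_on_local => x.
have [Qx|nQx] := pselect (Q x).
  exists Q; first exact: open_nbhs_nbhs.
  exists (zeta w) => //.
  exact: (smooth_onM oQ (smooth_onW (@subsetT _ Q) spsi) (smooth_on_gfun nu eps0 oQ sw)).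
pose O := [set y : 'rV[R]_n | r' < `|y|].
have oO : open O.
  rewrite (_ : O = (fun y : 'rV[R]_n => `|y|) @^-1` [set t | r' < t])//.
  by apply: open_comp; [move=> y _; exact: norm_continuous|exact: open_gt].
have Ox : O x.
  by rewrite /O /=; apply: (lt_le_trans r'r); rewrite leNgt; apply/negP.
exists O; first exact: open_nbhs_nbhs.
exists (fun=> 0); first exact: smooth_on_cst.
move=> y Oy; apply/eqP; apply: contraTT Oy => /zeta_supp h.
by apply/negP; rewrite /O /= ltNge h.
Qed.

Let zeta_compact w : compactly_supported (zeta w).
Proof.
have cK : compact (cube r' : set 'rV[R]_n).
  apply: bounded_closed_compact; last exact: closed_cube.
  exists r'; split; first exact: num_real.
  by move=> M rM x xr; exact: le_trans xr (ltW rM).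
apply: (subclosed_compact _ cK); first exact: closed_closure.
rewrite [X in _ `<=` X](closure_id (cube r')).1; last exact: closed_cube.
by apply: closure_subset => x /zeta_supp.
Qed.

(** Product rule and chain rule on Q; outside Q both sides are 0, whatever the values of X, f and w
    there. *)
Lemma test_pointwise f X w x : smooth_on Q w ->
  dot (X x) (sqrt_grad a (zeta w) x) - pw (f x) * zeta w x =
  test_integrand g g' psi (fun x => dot (trunc Q X x) (sqrt_grad a psi x))
    (fun x => \1_Q x * pw (f x) * psi x) (fun x => \1_Q x * w x)
    (trunc Q X) (trunc Q (sqrt_grad a w)) x.
Proof.
move=> sw; have [Qx|nQx] := pselect (Q x); last first.
  have d0 (y : 'rV[R]_n) : dot (0 : 'rV[R]_n) y = 0.
    by rewrite /dot big1// => j _; rewrite mxE mul0r.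
  have z0 : sqrt_grad a (zeta w) x = 0.
    rewrite /sqrt_grad (_ : grad _ x = 0) ?mul0mx//; apply/rowP => i; rewrite !mxE.
    apply/eqP; apply: contra_notT nQx => h.
    apply: le_lt_trans r'r; exact: (partial_support (@zeta_supp w) h).
  rewrite /test_integrand z0 /zeta psi_out// /trunc indicE memNset// !scale0r dotC !d0.
  by rewrite !(mul0r, mulr0) !subr0 addr0.
have E : sqrt_grad a (zeta w) x = g (w x) *: sqrt_grad a psi x + (psi x * g' (w x)) *: sqrt_grad a w x.
  rewrite /sqrt_grad !scalemxAl -mulmxDl; congr (_ *m _); apply/rowP => i; rewrite !mxE.
  have Dg := is_derive_gfun nu eps0 (smooth_on_derivable (i := i) sw Qx).
  rewrite (partialM (smooth_on_derivable (i := i) spsi I) (@ex_derive _ _ _ _ _ _ _ Dg)).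
  have -> : partial i (fun y => g (w y)) x = g' (w x) * partial i w x.
    exact: (@derive_val _ _ _ _ _ _ _ Dg).
  by ring.
rewrite /test_integrand E /trunc indicE mem_set// !scale1r !mul1r dotDr !dotZr /zeta.
by ring.
Qed.

Variable K : R.
Hypotheses (psiC : forall i x, `|partial i psi x| <= C) (psiK : forall x, psi x <= K).

Let mpsi : lebesgue_measurable_fun setT psi := smooth_on_measurable openT spsi.
Let psiK' x : `|psi x| <= K. Proof. by rewrite ger0_norm. Qed.

Let grad_psi := @sqrt_grad_bounded psi C r'
  (fun i => smooth_on_measurable openT (smooth_on_partial i spsi)) psiC
  (fun i x => @partial_support _ _ i psi r' x psir).

Let iA (X : 'rV[R]_n -> 'rV[R]_n) : @vmeasurable _ T R n (trunc Q X) ->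
  rintegrable mu (fun x : T => dot (trunc Q X x) (trunc Q X x)) ->
  rintegrable mu (fun x : T => dot (trunc Q X x) (sqrt_grad a psi x)).
Proof. by move=> mX iX; have [mP _ iP] := grad_psi; exact: rintegrable_dot mX mP iX iP. Qed.

Let iFpsi (f : T -> R) : rintegrable mu f -> rintegrable mu (fun x : T => f x * psi x).
Proof. by move=> iF; exact: (rintegrableM_bounded iF mpsi psiK'). Qed.

(** The test function contains w_k while the fields U and V are kept. Both weak forms are finite, so
    their difference is a single integral with U - V in the linear slot, and [limit_in_k] applies to
    it. *)
Lemma smooth_test_ge0 :
  (0 <= \int[mu]_x test_integrand g g' psi (fun x => dot (trunc Q W x) (sqrt_grad a psi x))
    (fun x => (F x * psi x)%R) tw (trunc Q W) (trunc Q W) x)%R.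
Proof.
have [[fk WLu] iu] := in_WL_approx a_meas a_sym a_psd oQ q1 inU.
have [[gk WLv] iv] := in_WL_approx a_meas a_sym a_psd oQ q1 inV.
have [sk ck iW [ik iDk] Dk] := WL_approxB a_meas a_sym a_psd oQ mU mV WLu WLv.
have [_ _ _ iF _] := trunc_facts.
have iU : rintegrable mu (fun x : T => dot (trunc Q U x) (trunc Q U x)) by case: WLu.
have iV : rintegrable mu (fun x : T => dot (trunc Q V x) (trunc Q V x)) by case: WLv.
pose wk k x := fk k x - gk k x.
have mk k := vmeasurable_trunc_sqrt_grad a_meas a_sym a_psd oQ (sk k).
have mwk k : measurable_fun setT (fun x : T => \1_Q x * wk k x).
  exact: (@measurable_indicM R n Q _ mQ (smooth_on_measurable oQ (sk k))).
have iu' := iFpsi (rintegrable_trunc_pw mu_ iu).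
have iv' := iFpsi (rintegrable_trunc_pw mv_ iv).
pose TI f X k := test_integrand g g' psi (fun x => dot (trunc Q X x) (sqrt_grad a psi x))
    (fun x => \1_Q x * pw (f x) * psi x) (fun x => \1_Q x * wk k x)
    (trunc Q X) (trunc Q (sqrt_grad a (wk k))).
have iTIu k : rintegrable mu (TI u U k : T -> R).
  have [h1 h2 h3] := rintegrable_test gc g'c gC g'C mpsi psiK' (iA mU iU) iu' (mwk k) mU (mk k) iU (ik k).
  exact: rintegrableB (rintegrableD h1 h2) h3.
have iTIv k : rintegrable mu (TI v V k : T -> R).
  have [h1 h2 h3] := rintegrable_test gc g'c gC g'C mpsi psiK' (iA mV iV) iv' (mwk k) mV (mk k) iV (ik k).
  exact: rintegrableB (rintegrableD h1 h2) h3.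
have wf f X k : weak_form a q f X (zeta (wk k)) = (\int[mu]_x (TI f X k x)%:E)%E.
  rewrite /weak_form; apply: eq_integral => x _; congr (_%:E).
  exact: (test_pointwise f X x (sk k)).
have ineq k : (0 <= \int[mu]_x test_integrand g g' psi (fun x => dot (trunc Q W x) (sqrt_grad a psi x))
    (fun x => (F x * psi x)%R) (fun x => (\1_Q x * wk k x)%R) (trunc Q W) (trunc Q (sqrt_grad a (wk k))) x)%R.
  have [_ _ /(_ (zeta (wk k)))] := huv.
  move=> /(_ (zeta_smooth (sk k)) (@zeta_compact _) (fun x => mulr_ge0 (psi0 x) (gfun_ge0 nu eps _))).
  rewrite !wf -(fine_rintegral (iTIu k)) -(fine_rintegral (iTIv k)) lee_fin -subr_ge0.
  rewrite -RintegralB; [|exact: measurableT|exact: iTIu|exact: iTIv].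
  congr (0 <= _); apply: eq_Rintegral => x _; rewrite /TI /test_integrand /F /W truncB !dotBl.
  by ring.
have lim := limit_in_k gc g'c gC g'C mpsi psiK' (iA mW iW) (iFpsi iF) mwk mtw ck mW mk iW ik iDk Dk.
by apply: (ler_cvg_to (@cvg_cst _ (0 : R) nat \oo _) lim); apply: nearW; exact: ineq.
Qed.

End test.
End fixed_cube.
End test_functions.

(** * The energy estimate *)

Section powers.
Context {R : realType} {n : nat}.
Implicit Types (f : 'rV[R]_n -> R).

Lemma exp_diff_le (x y : R) s : 0 <= x <= 1 -> 0 <= y <= 1 -> `|x ^+ s - y ^+ s| <= s%:R * `|x - y|.
Proof.
move=> /andP[x0 x1] /andP[y0 y1]; elim: s => [|s IH]; first by rewrite !expr0 subrr normr0 mul0r.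
rewrite !exprS (_ : _ - _ = x * (x ^+ s - y ^+ s) + y ^+ s * (x - y)); last by ring.
apply: le_trans (ler_normD _ _) _; rewrite !normrM (ger0_norm x0) (ger0_norm (exprn_ge0 s y0)).
rewrite -natr1 mulrDl mul1r; apply: lerD.
  by apply: le_trans IH; rewrite ler_piMl.
by rewrite ler_piMl// exprn_ile1.
Qed.

Lemma is_derive_exp f x i s : derivable f x (unit_rV i) ->
  is_derive x (unit_rV i) (fun y => f y ^+ s) (s%:R * f x ^+ s.-1 * partial i f x).
Proof.
move=> df; have Df : is_derive x (unit_rV i) f (partial i f x) by exact: derivableP.
elim: s => [|s IH].
  rewrite (_ : (fun y => _) = cst 1); last by apply/funext => y; rewrite expr0.
  have h : is_derive x (unit_rV i) (cst (1 : R)) (0 : R) by exact: is_derive_cst.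
  by apply: is_derive_eq h _; rewrite !mul0r.
rewrite (_ : (fun y => _) = f * (fun y => f y ^+ s)); last by apply/funext => y; rewrite exprS.
apply: is_derive_eq (is_deriveM Df IH) _.
rewrite /GRing.scale /=; case: s {IH} => [|s]; first by rewrite !expr0; ring.
by rewrite /= -!natr1 !exprS; ring.
Qed.

End powers.

Section lipschitz_tests.
Context {R : realType} {n : nat} (a : 'rV[R]_n -> 'M[R]_n).
Local Notation mu := (lebesgue_rV R n).
Local Notation T := (lebesgue_rVType R n).
Hypotheses (a_meas : forall i j, lebesgue_measurable_fun setT (fun x => a x i j))
  (a_bnd : forall i j, [locally [bounded a x i j | x in setT]])
  (a_sym : forall i j x, a x i j = a x j i)
  (a_psd : {ae mu, forall x, forall xi, 0 <= quad_form (a x) xi xi}).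
Variables (q nu : R) (u v : 'rV[R]_n -> R) (U V : 'rV[R]_n -> 'rV[R]_n).
Hypotheses (q1 : 1 < q) (nu0 : 0 < nu) (nu1 : nu < 1) (huv : entire_solution a q u U v V)
  (u_ge_v : {ae mu, forall x, v x <= u x}).

Section fixed_support.
Variable rho : R.
Hypothesis rho0 : 0 <= rho.
(** Smooth approximations of a cut-off supported in the cube of radius rho live in the cube of
    radius rho + 2, which has to lie strictly inside the cube where w_k is smooth. *)
Let Q : set 'rV[R]_n := open_cube (rho + 3).
Let r0 : 0 < rho + 3. Proof. by rewrite ltr_wpDl. Qed.
Let r'r : rho + 2 < rho + 3. Proof. by rewrite ltrD2l ltr_nat. Qed.
Let mQ : measurable (Q : set T) := @measurable_open_cube R n (rho + 3).
Let W : T -> 'rV[R]_n := trunc Q (fun x => U x - V x).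
Let tw : T -> R := fun x => \1_Q x * (u x - v x).
Let F : T -> R := fun x => \1_Q x * (pw q (u x) - pw q (v x)).
Let facts := trunc_facts a_meas a_sym a_psd q1 huv r0.
Let mW : @vmeasurable _ T R n W. Proof. by case: facts. Qed.
Let mtw : measurable_fun setT tw. Proof. by case: facts. Qed.
Let iW : rintegrable mu (fun x : T => dot (W x) (W x)). Proof. by case: facts. Qed.
Let iF : rintegrable mu F. Proof. by case: facts. Qed.
Let iwq : rintegrable mu (fun x : T => \1_Q x * `|u x - v x| `^ q). Proof. by case: facts. Qed.

(** Square integrability on a set of finite measure, through |t| <= 1 + t^2. *)
Let iW1 j : rintegrable mu (fun x : T => W x ord0 j).
Proof.
have iQ : rintegrable mu (\1_Q : T -> R).
  by apply: rintegrable_indic => //; exact: open_cube_lty.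
apply: (rintegrable_le _ _ (rintegrableD iQ iW)); first exact: mW.
move=> x; have h : `|W x ord0 j| ^+ 2 <= dot (W x) (W x).
  rewrite real_normK ?num_real// /dot (bigD1 j)//= -expr2 lerDl sumr_ge0// => k _.
  by rewrite -expr2 sqr_ge0.
have [Qx|nQx] := pselect (Q x).
  have -> : \1_Q x = 1 :> R by rewrite indicE mem_set.
  have := dot_ge0 (W x); have := sqr_ge0 (`|W x ord0 j| - 1); rewrite !expr2 in h *; nra.
rewrite {1}/W /trunc indicE memNset// scale0r mxE normr0 addr_ge0 ?dot_ge0//.
Qed.

Let WB j i x := W x ord0 j * psd_sqrt (a x) j i.

Let iWB j i : rintegrable mu (WB j i : T -> R).
Proof.
have [K K0 hK] := psd_sqrt_bounded a_bnd (rho + 3).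
apply: (rintegrable_le _ _ (rintegrableZ K (rintegrable_norm (iW1 j)))).
  exact: (measurable_funM (mW j) (measurable_psd_sqrt a_meas a_sym a_psd j i)).
move=> x; rewrite /WB normrM mulrC; have [Qx|nQx] := pselect (Q x).
  by rewrite ler_wpM2r// hK// ltW.
by rewrite /W /trunc indicE memNset// scale0r mxE normr0 !mulr0.
Qed.

Section fixed_eps.
Variable eps : R.
Hypothesis eps0 : 0 < eps.
Local Notation g := (gfun nu eps).
Local Notation g' := (gfun' nu eps).

Let H i x := \sum_j WB j i x * g (tw x).
Let h x := g' (tw x) * dot (W x) (W x) - F x * g (tw x).

Let mg : measurable_fun setT (fun x : T => g (tw x)).
Proof. exact: (measurable_cont_comp (@gfun_continuous _ nu eps eps0) mtw). Qed.
Let mg' : measurable_fun setT (fun x : T => g' (tw x)).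
Proof. exact: (measurable_cont_comp (@gfun'_continuous _ nu eps eps0) mtw). Qed.

Let iH i : rintegrable mu (H i : T -> R).
Proof.
apply: rintegrable_sum => j.
exact: (rintegrableM_bounded (iWB j i) mg (fun x => gfun_norm_le nu0 eps0 (tw x))).
Qed.

Let ih : rintegrable mu (h : T -> R).
Proof.
apply: rintegrableB.
  under eq_fun do rewrite mulrC.
  exact: (rintegrableM_bounded iW mg' (fun x => gfun'_norm_le nu0 eps0 (tw x))).
exact: (rintegrableM_bounded iF mg (fun x => gfun_norm_le nu0 eps0 (tw x))).
Qed.

Let TI (psi : 'rV[R]_n -> R) : T -> R := test_integrand g g' psi
  (fun x => dot (W x) (sqrt_grad a psi x)) (fun x => F x * psi x) tw W W.

(** Linear in psi and its partial derivatives with integrable coefficients [H i] and h, the form in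
    which weak convergence of partial derivatives passes to the limit. *)
Let TI_E psi x : TI psi x = \sum_i H i x * partial i psi x + h x * psi x.
Proof.
rewrite /TI /test_integrand.
have -> : dot (W x) (sqrt_grad a psi x) = \sum_i (\sum_j WB j i x) * partial i psi x.
  rewrite dotC /sqrt_grad dot_mulmx psd_sqrt_sym /dot; apply: eq_bigr => i _.
  by rewrite !mxE mulrC; congr (_ * _); apply: eq_bigr.
rewrite /h mulrBl [psi x * _]mulrC -addrA; congr (_ + _); last by ring.
rewrite mulr_sumr; apply: eq_bigr => i _; rewrite mulrA; congr (_ * _).
by rewrite mulr_sumr; apply: eq_bigr => j _; rewrite mulrC.
Qed.

Let TI_int psi L K : continuous psi -> (forall i, dir_lipschitz i L psi) -> (forall x, `|psi x| <= K) ->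
  [/\ rintegrable mu (TI psi), (forall i, rintegrable mu (fun x : T => H i x * partial i psi x)),
    rintegrable mu (fun x : T => h x * psi x) &
    (\int[mu]_x TI psi x = \sum_i \int[mu]_x (H i x * partial i psi x) + \int[mu]_x (h x * psi x))%R].
Proof.
move=> cp pL pK.
have i1 i : rintegrable mu (fun x : T => H i x * partial i psi x).
  exact: (rintegrableM_bounded (iH i) (partial_measurable cp (pL i))
    (fun x => partial_le_everywhere x cp (pL i))).
have i2 : rintegrable mu (fun x : T => h x * psi x).
  exact: (rintegrableM_bounded ih (continuous_lebesgue_fun cp) pK).
have E : TI psi = (fun x => \sum_i H i x * partial i psi x + h x * psi x).
  by apply/funext => x; exact: TI_E.
have i3 : rintegrable mu (fun x : T => \sum_i H i x * partial i psi x).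
  exact: rintegrable_sum.
split => //; first by rewrite E; exact: rintegrableD.
by rewrite E RintegralD// rintegral_sum.
Qed.

(** Uniform convergence handles the term with h, weak convergence of the partial derivatives the
    terms with [H i]. *)
Lemma lipschitz_test_ge0 psi L : 0 <= L -> (forall x y, `|psi x - psi y| <= L * `|x - y|) ->
  (forall x, 0 <= psi x <= 1) -> (forall x, psi x != 0 -> `|x| <= rho) ->
  rintegrable mu (TI psi) /\ (0 <= \int[mu]_x TI psi x)%R.
Proof.
move=> L0 pL p01 pr.
have p0 x : 0 <= psi x by have /andP[] := p01 x.
have [C [f [hf wf]]] := lipschitz_smooth_weak_approx L0 pL p0 pr.
have fL k i : dir_lipschitz i C (f k).
  by have [sf _ _ _ fC] := hf k; apply: smooth_dir_lipschitz => // x; exact: fC.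
have fc k : continuous (f k).
  by have [sf _ _ _ _] := hf k; move=> x; exact: smooth_on_continuous sf I.
have pc : continuous psi by exact: lipschitz_continuous_rV L0 pL.
have pdL i : dir_lipschitz i L psi by exact: lipschitz_dir_lipschitz.
have pK x : `|psi x| <= 1 by have /andP[? ?] := p01 x; rewrite ger0_norm.
have fK k x : f k x <= 1 + 2 * L.
  have [_ _ _ /(_ x) fp _] := hf k; have /andP[_ p1] := p01 x.
  have L2 : 2 * L / k.+1%:R <= 2 * L.
    by rewrite ler_pdivrMr// ler_peMr ?mulr_ge0// ler1n.
  have := le_trans (le_trans (ler_norm _) fp) L2; lra.
have fK' k x : `|f k x| <= 1 + 2 * L.
  by have [_ f0 _ _ _] := hf k; rewrite ger0_norm.
have [iT ip1 ip2 Ep] := TI_int pc pdL pK; split => //.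
have ge0 k : (0 <= \int[mu]_x TI (f k) x)%R.
  have [sf f0 fr _ fC] := hf k.
  exact: (smooth_test_ge0 a_meas a_bnd a_sym a_psd q1 nu0 eps0 huv r0 r'r sf f0 fr fC (fK k)).
have lim2 : (\int[mu]_x (h x * f k x))%R @[k --> \oo] --> (\int[mu]_x (h x * psi x))%R.
  have C1 : (2 * L * (\int[mu]_x `|h x|)%R) * k.+1%:R^-1 @[k --> \oo] --> (0 : R).
    rewrite -[X in _ --> X](mulr0 (2 * L * (\int[mu]_x `|h x|)%R)).
    by apply: cvgM; [exact: cvg_cst|exact: cvg_harmonic].
  apply/subr_cvg0; apply: norm_cvg0.
  apply: (squeeze_cvgr _ (@cvg_cst _ (0 : R) nat \oo _) C1).
  apply: nearW => k; rewrite normr_ge0 /=.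
  have [_ _ if2 _] := TI_int (fc k) (fL k) (fK' k).
  rewrite -RintegralB//.
  have iD := rintegrableB if2 ip2.
  apply: le_trans (le_normr_Rintegral measurableT iD) _.
  have ihn := rintegrable_norm ih.
  rewrite mulrAC -(RintegralZl _ measurableT ihn).
  apply: le_Rintegral => //; [exact: rintegrable_norm|exact: rintegrableZ|].
  move=> x _; rewrite -mulrBr normrM mulrC ler_wpM2r//.
  by have [_ _ _ /(_ x) fp _] := hf k; apply: le_trans fp _; rewrite mulrC.
have lim : (\int[mu]_x TI (f k) x)%R @[k --> \oo] --> (\int[mu]_x TI psi x)%R.
  rewrite Ep.
  rewrite (_ : (fun k => _) = (fun k =>
    (\sum_i \int[mu]_x (H i x * partial i (f k) x) + \int[mu]_x (h x * f k x))%R)).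
    by apply: cvgD => //; apply: cvg_sumR => i _; exact: (wf i (H i) (iH i)).
  by apply/funext => k; have [_ _ _ ->] := TI_int (fc k) (fL k) (fK' k).
by apply: (ler_cvg_to (@cvg_cst _ (0 : R) nat \oo _) lim); apply: nearW; exact: ge0.
Qed.

End fixed_eps.

(** The test is made with phi^s, again Lipschitz, whose gradient is s phi^(s-1) grad phi almost
    everywhere; [regularisation_limit] then removes eps. *)
Lemma energy_estimate phi L (s : nat) : (2 < s)%N -> 0 <= L ->
  (forall x y, `|phi x - phi y| <= L * `|x - y|) ->
  (forall x, 0 <= phi x <= 1) -> (forall x, phi x != 0 -> `|x| <= rho) ->
  [/\ rintegrable mu (fun x : T => phi x ^+ s * `|u x - v x| `^ (q - nu)),
      rintegrable mu (fun x : T => phi x ^+ (s - 2) * `|u x - v x| `^ (1 - nu) *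
        dot (sqrt_grad a phi x) (sqrt_grad a phi x)) &
      2 `^ (- q) * (\int[mu]_x (phi x ^+ s * `|u x - v x| `^ (q - nu)))%R <=
      s%:R ^+ 2 / (2 * nu) *
        (\int[mu]_x (phi x ^+ (s - 2) * `|u x - v x| `^ (1 - nu) *
          dot (sqrt_grad a phi x) (sqrt_grad a phi x)))%R].
Proof.
move=> s2 L0 pL p01 pr.
have pc : continuous phi by exact: lipschitz_continuous_rV L0 pL.
have pdL i : dir_lipschitz i L phi by exact: lipschitz_dir_lipschitz.
have phiQ x : phi x != 0 -> Q x.
  by move=> /pr h; apply: le_lt_trans h _; rewrite ltrDl.
(* u - v is nonnegative only almost everywhere; the absolute value makes w nonnegative everywhere,
   as the pointwise estimates require. *)
pose w (x : T) : R := \1_Q x * `|u x - v x|.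
have mw : measurable_fun setT w.
  rewrite (_ : w = (fun x => `|tw x|)); first exact: measurableT_comp.
  by apply/funext => x; rewrite /w /tw normrM ger0_norm.
have w0 x : 0 <= w x by rewrite mulr_ge0.
have wE x : Q x -> w x = `|u x - v x| by move=> Qx; rewrite /w indicE mem_set// mul1r.
have [mP [K PK] iP] := sqrt_grad_bounded a_meas a_bnd a_sym a_psd
  (fun i => partial_measurable pc (pdL i)) (fun i x => partial_le_everywhere x pc (pdL i))
  (fun i x => @partial_support _ _ i phi rho x pr).
have iwq' : rintegrable mu (fun x : T => \1_Q x * w x `^ q).
  have := iwq; congr (rintegrable mu _); apply/funext => x.
  have [Qx|nQx] := pselect (Q x); first by rewrite wE.
  by rewrite indicE memNset// !mul0r.
have Fw : {ae mu, forall x, 2 `^ (- q) * w x `^ q <= F x}.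
  apply: ae_imp u_ge_v => x vu; have [Qx|nQx] := pselect (Q x).
    rewrite wE// /F indicE mem_set// mul1r ger0_norm ?subr_ge0//.
    exact: power_diff_ge.
  by rewrite /w /F indicE memNset// !mul0r powR0 ?mulr0// gt_eqF// (lt_trans _ q1).
pose psi x := phi x ^+ s.
have psiL x y : `|psi x - psi y| <= s%:R * L * `|x - y|.
  by apply: le_trans (exp_diff_le s (p01 x) (p01 y)) _; rewrite -mulrA ler_wpM2l.
have psi01 x : 0 <= psi x <= 1.
  by have /andP[p0 p1] := p01 x; rewrite exprn_ge0// exprn_ile1.
have s0 : (0 < s)%N by exact: leq_trans s2.
have psir x : psi x != 0 -> `|x| <= rho.
  move=> h; apply: pr; apply: contraNneq h => p0.
  by rewrite /psi p0 expr0n eqn0Ngt s0.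
have dphi : {ae mu, forall x, forall i, derivable phi x (unit_rV i)}.
  by apply: ae_forall => i; exact: partial_derivable_ae pc (pdL i).
have gP x : (forall i, derivable phi x (unit_rV i)) ->
    sqrt_grad a psi x = (s%:R * phi x ^+ s.-1) *: sqrt_grad a phi x.
  move=> dx; rewrite /sqrt_grad scalemxAl; congr (_ *m _); apply/rowP => i; rewrite !mxE.
  exact: (@derive_val _ _ _ _ _ _ _ (is_derive_exp s (dx i))).
have mphi : measurable_fun (setT : set T) phi by exact: continuous_lebesgue_fun.
have mphis j : measurable_fun (setT : set T) (fun x => phi x ^+ j) by exact: measurable_funX.
have phisK j x : `|phi x ^+ j| <= 1.
  by have /andP[p0 p1] := p01 x; rewrite ger0_norm ?exprn_ge0// exprn_ile1.
have iA : rintegrable mu (fun x : T => s%:R * phi x ^+ s.-1 * dot (W x) (sqrt_grad a phi x)).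
  have i1 := rintegrableM_bounded (rintegrable_dot mW mP iW iP) (mphis s.-1) (phisK s.-1).
  have := rintegrableZ s%:R i1; congr (rintegrable mu _).
  by apply/funext => x; rewrite [in RHS]mulrAC mulrA.
have iFs := rintegrableM_bounded iF (mphis s) (phisK s).
have iE eps : 0 < eps -> rintegrable mu (test_integrand (gfun nu eps) (gfun' nu eps)
    (fun x => phi x ^+ s) (fun x => s%:R * phi x ^+ s.-1 * dot (W x) (sqrt_grad a phi x))
    (fun x => F x * phi x ^+ s) w W W).
  move=> e0; pose C0 : R := eps `^ (- nu) + nu * eps `^ (- nu - 1).
  have gC t : `|gfun nu eps t| <= C0.
    by apply: le_trans (gfun_norm_le nu0 e0 t) _; rewrite lerDl mulr_ge0 ?powR_ge0// ltW.
  have g'C t : `|gfun' nu eps t| <= C0.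
    by apply: le_trans (gfun'_norm_le nu0 e0 t) _; rewrite lerDr powR_ge0.
  have [h1 h2 h3] := rintegrable_test (@gfun_continuous _ nu eps e0) (@gfun'_continuous _ nu eps e0)
    gC g'C (mphis s) (phisK s) iA iFs mw mW mW iW iW.
  exact: rintegrableB (rintegrableD h1 h2) h3.
have E0 eps : 0 < eps -> (0 <= \int[mu]_x test_integrand (gfun nu eps) (gfun' nu eps)
    (fun x => (phi x ^+ s)%R) (fun x => (s%:R * phi x ^+ s.-1 * dot (W x) (sqrt_grad a phi x))%R)
    (fun x => (F x * phi x ^+ s)%R) w W W x)%R.
  move=> e0; have [it t0] := lipschitz_test_ge0 e0 (mulr_ge0 (ler0n _ s) L0) psiL psi01 psir.
  apply: (le_trans t0); apply: (@ae_le_rintegral _ T R mu _ _ it (iE eps e0)).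
  apply: ae_imp2 dphi u_ge_v => x dx vu.
  have tE : tw x = w x by rewrite /tw /w ger0_norm ?subr_ge0.
  rewrite /test_integrand tE (gP x dx) dotZr; exact: lexx.
have [k1 k2 k3] := @regularisation_limit _ T R mu n nu q (2 `^ (- q)) K s Q phi w F
  (sqrt_grad a phi) W nu0 nu1 q1 s2 mQ (@open_cube_lty R n (rho + 3)) mphi p01 phiQ mw w0 iwq'
  Fw mP PK iE E0.
have wphi j b : (0 < j)%N -> (fun x : T => phi x ^+ j * w x `^ b) =
    (fun x : T => phi x ^+ j * `|u x - v x| `^ b).
  move=> j0; apply/funext => x; have [p0|/phiQ Qx] := eqVneq (phi x) 0; last by rewrite wE.
  by rewrite p0 expr0n eqn0Ngt j0 !mul0r.
have E2 : (fun x : T => phi x ^+ (s - 2) * w x `^ (1 - nu) * dot (sqrt_grad a phi x) (sqrt_grad a phi x)) =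
  (fun x : T => phi x ^+ (s - 2) * `|u x - v x| `^ (1 - nu) * dot (sqrt_grad a phi x) (sqrt_grad a phi x)).
  apply/funext => x; congr (_ * _).
  by have := congr1 (fun h => h x) (wphi (s - 2)%N (1 - nu) _); apply; rewrite subn_gt0.
rewrite wphi// in k1 k3; rewrite E2 in k2 k3; exact: And3 k1 k2 k3.
Qed.

End fixed_support.
End lipschitz_tests.

(** * Two passes of interpolation *)

Section monotone_integrable.
Context d (T : measurableType d) (R : realType) (mu : {measure set T -> \bar R}).

Lemma rintegrable_monotone_limit (f : nat -> T -> R) (g : T -> R) (M : R) :
  (forall k, rintegrable mu (f k)) -> (forall k x, 0 <= f k x) ->
  (forall x, {homo (fun k => f k x) : i j / (i <= j)%N >-> i <= j}) ->
  (forall x, f k x @[k --> \oo] --> g x) ->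
  (forall k, (\int[mu]_x f k x)%R <= M) -> rintegrable mu g.
Proof.
move=> fi f0 fnd fg fM.
have mf k : measurable_fun setT (fun x => (f k x)%:E).
  by apply/measurable_EFinP; exact: rintegrable_measurable (fi k).
have gE x : (g x)%:E = limn (fun k => (f k x)%:E).
  by apply/esym/cvg_lim => //; apply: cvg_EFin; [exact: nearW|exact: fg].
have g0 x : 0 <= g x.
  have : limn (fun k => f k x) = g x by exact/cvg_lim.
  by move=> <-; apply: limr_ge; [apply/cvg_ex; exists (g x); exact: fg|exact: nearW].
have mg : measurable_fun setT g.
  apply: (@measurable_fun_cvg _ _ _ setT f g) => [k|x _]; last exact: fg.
  exact: rintegrable_measurable (fi k).
apply/integrableP; split; first exact/measurable_EFinP.
rewrite (eq_integral (fun x => limn (fun k => (f k x)%:E))); last first.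
  by move=> x _; rewrite -gE gee0_abs// lee_fin.
rewrite monotone_convergence//.
- apply: (@le_lt_trans _ _ M%:E); last exact: ltry.
  apply: lime_le.
    apply: ereal_nondecreasing_is_cvgn => i j ij; apply: ge0_le_integral => //.
    + by move=> x _; rewrite lee_fin.
    + by move=> x _; rewrite lee_fin; exact: fnd.
  by apply: nearW => k; rewrite -(fine_rintegral (fi k)) lee_fin.
- by move=> k x _; rewrite lee_fin.
- by move=> x _ i j ij; rewrite lee_fin; exact: fnd.
Qed.

Lemma rintegral_le0_ae (f : T -> R) : rintegrable mu f -> (forall x, 0 <= f x) ->
  (\int[mu]_x f x)%R <= 0 -> {ae mu, forall x, f x = 0}.
Proof.
move=> fi f0 If.
have mf : measurable_fun setT (EFin \o f) by apply/measurable_EFinP; exact: rintegrable_measurable fi.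
have I0 : (\int[mu]_x `|(EFin \o f) x| = 0)%E.
  apply/eqP; rewrite eq_le integral_ge0// andbT.
  rewrite (eq_integral (fun x => (f x)%:E)); last by move=> x _; rewrite /= ger0_norm.
  by rewrite -(fine_rintegral fi) lee_fin.
have := (ae_eq_integral_abs mu measurableT mf).1 I0.
by apply: ae_imp => x /(_ I) [].
Qed.

End monotone_integrable.

Section two_pass.
Context d (T : measurableType d) (R : realType) (mu : {measure set T -> \bar R}).
Variables (z : T -> R) (B : nat -> set T) (c D M th : R).
Hypotheses (z0 : forall x, 0 <= z x) (mB : forall N, measurable (B N))
  (ndB : forall i j, (i <= j)%N -> B i `<=` B j) (covB : forall x, exists N, B N x)
  (c0 : 0 < c) (D0 : 0 <= D) (th01 : 0 < th < 1).
(** f is the power phi^s of a competitor, G its energy density |a^{1/2} grad phi|^p, h the integrand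
    on the right of the energy estimate, and th the interpolation weight. The bound M is the same
    for all N. *)
Hypothesis competitor : forall N, exists f G h : T -> R,
  [/\ rintegrable mu (fun x => f x * z x), rintegrable mu G /\ (\int[mu]_x G x)%R <= M,
    rintegrable mu h /\ c * (\int[mu]_x (f x * z x))%R <= D * (\int[mu]_x h x)%R,
    forall x, [/\ 0 <= f x <= 1, 0 <= G x & B N x -> f x = 1 /\ h x = 0] &
    forall kap x, 0 < kap -> h x <= kap `^ (1 - th) * (f x * z x) + kap `^ (- th) * G x].

Let th0 : 0 < th. Proof. by case/andP: th01. Qed.
Let th1 : 0 < 1 - th. Proof. by rewrite subr_gt0; case/andP: th01. Qed.

Let M0 : 0 <= M.
Proof.
have [f [G [h [_ [_ GM] _ H _]]]] := competitor 0%N.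
by apply: le_trans GM; apply: Rintegral_ge0 => x _; have [] := H x.
Qed.

Let zB N : T -> R := fun x => \1_(B N) x * z x.

Let zB0 N x : 0 <= zB N x. Proof. by rewrite mulr_ge0. Qed.

Let izB N : rintegrable mu (zB N).
Proof.
have [f [G [h [ifz _ _ H _]]]] := competitor N.
have E : zB N = (fun x => f x * z x * \1_(B N) x).
  apply/funext => x; rewrite /zB indicE; have [Bx|nBx] := pselect (B N x).
    by have [_ _ /(_ Bx)[-> _]] := H x; rewrite mem_set// mulr1.
  by rewrite memNset// mul0r mulr0.
rewrite E; apply: (@rintegrableM_bounded _ _ _ _ _ _ 1) => //.
by move=> x; rewrite ger0_norm// indicE; case: (_ \in _).
Qed.

Let zB_le N f : (forall x, 0 <= f x) -> (forall x, B N x -> f x = 1) -> forall x, zB N x <= f x * z x.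
Proof.
move=> f0 f1 x; rewrite /zB indicE; have [Bx|nBx] := pselect (B N x).
  by rewrite mem_set// f1.
by rewrite memNset// mul0r mulr_ge0.
Qed.

(** kap is chosen so that D kap^(1 - th) <= c / 2, with D + 1 in the denominator in case D = 0. Half
    of the left side then absorbs the interpolated term, which is legitimate as the integral of f z
    is already known to be finite. *)
Let first_bound : exists M1 : R, forall N, (\int[mu]_x zB N x)%R <= M1.
Proof.
pose kap : R := (c / (2 * (D + 1))) `^ (1 - th)^-1.
have D1 : 0 < 2 * (D + 1) by rewrite mulr_gt0// ltr_wpDl.
have kap0 : 0 < kap by rewrite powR_gt0// divr_gt0.
have kE : kap `^ (1 - th) = c / (2 * (D + 1)).
  by rewrite -powRrM mulVf ?gt_eqF// powRr1// ltW// divr_gt0.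
have Dk : D * kap `^ (1 - th) <= c / 2.
  rewrite kE mulrA ler_pdivrMr// (_ : c / 2 * (2 * (D + 1)) = D * c + c); last by field.
  by rewrite lerDl ltW.
exists (2 * (D * (kap `^ (- th) * M)) / c) => N.
have [f [G [h [ifz [iG GM] [ih E] H hk]]]] := competitor N.
have f0 x : 0 <= f x by have [/andP[]] := H x.
have f1 x : B N x -> f x = 1 by have [_ _ h1] := H x => /h1 [].
have fz0 : 0 <= (\int[mu]_x (f x * z x))%R by apply: Rintegral_ge0 => x _; rewrite mulr_ge0.
have i1 := rintegrableZ (kap `^ (1 - th)) ifz; have i2 := rintegrableZ (kap `^ (- th)) iG.
have h1 : (\int[mu]_x h x)%R <= kap `^ (1 - th) * (\int[mu]_x (f x * z x))%R + kap `^ (- th) * M.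
  apply: (@le_trans _ _ (\int[mu]_x (kap `^ (1 - th) * (f x * z x) + kap `^ (- th) * G x))%R).
    by apply: le_Rintegral => // [|x _]; [exact: rintegrableD|exact: hk].
  rewrite RintegralD// (RintegralZl _ measurableT ifz) (RintegralZl _ measurableT iG).
  by rewrite lerD2l ler_wpM2l// powR_ge0.
apply: (@le_trans _ _ (\int[mu]_x (f x * z x))%R).
  by apply: le_Rintegral => //; [exact: izB|move=> x _; exact: zB_le].
rewrite ler_pdivlMr// mulrC.
have h2 := le_trans E (ler_wpM2l D0 h1).
have h3 := ler_wpM2r fz0 Dk.
move: h2; rewrite mulrDr mulrA => h2; lra.
Qed.

Let zB_cvg x : zB N x @[N --> \oo] --> z x.
Proof.
have [N BN] := covB x.
apply: cvg_trans (@cvg_cst _ (z x) nat \oo _); apply: near_eq_cvg.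
near=> k; rewrite /zB indicE mem_set ?mul1r//.
by apply: ndB BN; near: k; exact: nbhs_infty_ge.
Unshelve. all: by end_near. Qed.

Let iz : rintegrable mu z.
Proof.
have [M1 hM1] := first_bound.
apply: (rintegrable_monotone_limit izB zB0 _ zB_cvg hM1) => x i j ij.
rewrite /zB ler_wpM2r// !indicE ler_nat.
by have [Bx|nBx] := boolP (x \in B i); [rewrite mem_set//; apply: ndB ij _ (set_mem Bx)|case: (_ \in _)].
Qed.

Let tail N := (\int[mu]_x (z x - zB N x))%R.

Let tail0 : tail N @[N --> \oo] --> (0 : R).
Proof.
have mz := rintegrable_measurable iz.
have m0 : measurable_fun (setT : set T) (cst 0 : T -> R) by exact: measurable_cst.
have ca : {ae mu, forall x, z x - zB k x @[k --> \oo] --> (cst 0 : T -> R) x}.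
  apply: aeW => x; rewrite -[X in _ --> X](subrr (z x)).
  by apply: cvgB; [exact: cvg_cst|exact: zB_cvg].
have bd : {ae mu, forall x, forall k, `|z x - zB k x| <= z x}.
  apply: aeW => x k; rewrite ger0_norm; first by rewrite gerBl zB0.
  rewrite subr_ge0 /zB indicE; case: (_ \in _); rewrite ?mul1r// mul0r; exact: z0.
have [_ _] := @rintegral_dominated _ _ _ mu (fun N x => z x - zB N x) (cst 0) z
  (fun N => measurable_funB mz (rintegrable_measurable (izB N))) m0 ca iz bd.
by rewrite Rintegral_cst// mul0r.
Qed.

(** N tends to infinity before kap does: for fixed kap the tail disappears and c A <= D kap^-th M
    remains, which a large kap contradicts if A > 0. *)
Lemma two_pass_ae : {ae mu, forall x, z x = 0}.
Proof.
apply: rintegral_le0_ae => //; set A := (\int[mu]_x z x)%R.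
rewrite leNgt; apply/negP => A0.
have key kap : 0 < kap -> c * A <= D * (kap `^ (- th) * M).
  move=> kap0.
  have step N : c * A <= D * (kap `^ (- th) * M) + (c + D * kap `^ (1 - th)) * tail N.
    have [f [G [h [ifz [iG GM] [ih E] H hk]]]] := competitor N.
    have f0 x : 0 <= f x by have [/andP[]] := H x.
    have f1 x : B N x -> f x = 1 by have [_ _ h1] := H x => /h1 [].
    have it := rintegrableB iz (izB N).
    have i1 := rintegrableZ (kap `^ (1 - th)) it; have i2 := rintegrableZ (kap `^ (- th)) iG.
    have h1 : (\int[mu]_x h x)%R <= kap `^ (1 - th) * tail N + kap `^ (- th) * M.
      apply: (@le_trans _ _ (\int[mu]_x (kap `^ (1 - th) * (z x - zB N x) + kap `^ (- th) * G x))%R).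
        apply: le_Rintegral => // [|x _]; first exact: rintegrableD.
        have [/andP[fx0 fx1] Gx0 BH] := H x; have [Bx|nBx] := pselect (B N x).
          have [_ ->] := BH Bx; rewrite /zB indicE mem_set// mul1r subrr mulr0 add0r.
          by rewrite mulr_ge0// powR_ge0.
        apply: le_trans (hk kap x kap0) _; rewrite lerD2r ler_wpM2l ?powR_ge0//.
        by rewrite /zB indicE memNset// mul0r subr0 ler_piMl.
      rewrite RintegralD// (RintegralZl _ measurableT it) (RintegralZl _ measurableT iG).
      by rewrite lerD2l ler_wpM2l// powR_ge0.
    have h2 : A - tail N <= (\int[mu]_x (f x * z x))%R.
      have -> : tail N = A - (\int[mu]_x zB N x)%R.
        by rewrite /tail RintegralB//; exact: izB.
      rewrite subKr.
      by apply: le_Rintegral => //; [exact: izB|move=> x _; exact: zB_le].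
    have h3 := ler_wpM2l (ltW c0) h2.
    have h4 := le_trans (le_trans h3 E) (ler_wpM2l D0 h1).
    move: h4; rewrite mulrBr !mulrDr mulrDl mulrA; lra.
  have lim : D * (kap `^ (- th) * M) + (c + D * kap `^ (1 - th)) * tail N @[N --> \oo] -->
      D * (kap `^ (- th) * M).
    rewrite -[X in _ --> X]addr0; apply: cvgD; first exact: cvg_cst.
    by rewrite -[X in _ --> X](mulr0 (c + D * kap `^ (1 - th))); apply: cvgM => //; exact: cvg_cst.
  by apply: (ler_cvg_to (@cvg_cst _ (c * A) nat \oo _) lim); apply: nearW; exact: step.
(* kap is taken with kap^-th = b, so that D M b < c A; the 1 added to D M keeps the denominator
   positive. *)
pose b : R := c * A / (2 * (D * M + 1)).
have DM0 : 0 <= D * M by rewrite mulr_ge0.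
have DM1 : 0 < 2 * (D * M + 1) by rewrite mulr_gt0// ltr_wpDl.
have cA : 0 < c * A by rewrite mulr_gt0.
have b0 : 0 < b by rewrite divr_gt0.
have kap0 : 0 < b `^ (- th^-1) by rewrite powR_gt0.
have := key _ kap0.
have -> : (b `^ (- th^-1)) `^ (- th) = b.
  by rewrite -powRrM mulrNN mulVf ?gt_eqF// powRr1// ltW.
rewrite mulrCA /b mulrAC ler_pdivlMr// => h.
have := mulr_ge0 (ltW cA) DM0; nra.
Qed.

End two_pass.

(** * Competitors for the capacity *)

Section competitor.
Context {R : realType} {n : nat}.

(** Outside the cube of radius r + 1 the function vanishes, and such points are at distance at least
    1 from the support, where phi <= 1. The constant valid on the cube, raised to at least 1,
    therefore works globally. *)
Lemma lipschitz_of_compact_support (phi : 'rV[R]_n -> R) (r : R) :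
  (forall K, compact K -> [lipschitz phi x | x in K]) ->
  (forall x, 0 <= phi x <= 1) -> (forall x, phi x != 0 -> `|x| <= r) ->
  exists2 L : R, 0 <= L & forall x y, `|phi x - phi y| <= L * `|x - y|.
Proof.
move=> philip phi01 phir.
have cK : compact (cube (r + 1) : set 'rV[R]_n).
  apply: bounded_closed_compact; last exact: closed_cube.
  exists (r + 1); split; first exact: num_real.
  by move=> e re x /= xr; apply: le_trans (ltW re).
have [L0 [_ hL]] := philip _ cK.
pose L : R := Num.max (L0 + 1) 1.
have Lip x y : cube (r + 1) x -> cube (r + 1) y -> `|phi x - phi y| <= L * `|x - y|.
  move=> Kx Ky; have L0L : L0 < L by rewrite lt_max ltrDl ltr01.
  exact: (hL _ L0L (x, y)).
have L1 : 1 <= L by rewrite le_max lexx orbT.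
have far x y : ~ cube (r + 1) y -> `|phi x - phi y| <= L * `|x - y|.
  move=> nKy; have ry : r + 1 < `|y| by rewrite ltNge; apply/negP.
  have -> : phi y = 0.
    by apply/eqP; apply: contraTT ry => /phir yr; rewrite -leNgt (le_trans yr)// lerDl.
  rewrite subr0; have [->|nx0] := eqVneq (phi x) 0.
    by rewrite normr0 mulr_ge0// (le_trans _ L1).
  have [p0 p1] := andP (phi01 x); rewrite ger0_norm//; apply: le_trans p1 _.
  have xr := phir x nx0; have h := lerB_dist y x.
  have h1 : 1 <= `|x - y| by rewrite distrC; lra.
  by apply: le_trans L1 _; rewrite ler_peMr// /L le_max ler01 orbT.
exists L; first exact: le_trans L1.
move=> x y; have [Ky|nKy] := pselect (cube (r + 1) y); last exact: far.
have [Kx|nKx] := pselect (cube (r + 1) x); first exact: Lip.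
by rewrite distrC (distrC x y); exact: far.
Qed.

Lemma limf_einf_ltP (f : R -> \bar R) : (limf_einf f +oo%R < +oo)%E ->
  exists M : R, forall r0, exists2 r, r0 < r & (f r < M%:E)%E.
Proof.
rewrite limf_einfE => sf; set s := ereal_sup _ in sf.
have [M sM] : exists M : R, (s < M%:E)%E.
  case: s sf => [s _|//|_]; last by exists 0; exact: ltNyr.
  by exists (s + 1); rewrite lte_fin ltrDl.
exists M => r0.
have h : (ereal_inf (f @` [set r : R | (r0 < r)%R]) < M%:E)%E.
  apply: le_lt_trans sM; apply: ereal_sup_ubound; exists [set r : R | r0 < r] => //.
  by exists r0; split; first exact: num_real.
have [_ [r r0r <-] frM] := ereal_inf_lt h.
by exists r.
Qed.

Lemma norm_le_enorm (x : 'rV[R]_n) : `|x| <= enorm x.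
Proof. by apply: norm_rV_le; [exact: enorm_ge0|move=> i; exact: coord_le_enorm]. Qed.

Lemma enorm_le_norm (x : 'rV[R]_n) : enorm x <= n%:R * `|x|.
Proof.
have nx0 : 0 <= n%:R * `|x| by rewrite mulr_ge0.
rewrite /enorm -(ger0_norm nx0) -sqrtr_sqr ler_sqrt ?sqr_ge0//.
apply: (@le_trans _ _ (n%:R * `|x| ^+ 2)).
  rewrite -[n in n%:R]card_ord -sum1_card natr_sum mulr_suml; apply: ler_sum => i _.
  by rewrite mul1r -expr2 -real_normK ?num_real// ler_pXn2r ?nnegrE// coord_le_norm.
rewrite exprMn ler_wpM2r// expr2 -natrM ler_nat; case: n => // k.
by rewrite leq_pmulr.
Qed.

End competitor.

(** * The exponents of the interpolation *)

Section exponents.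
Context {R : realType} (q nu p : R).
Hypotheses (q1 : 1 < q) (nu01 : 0 < nu < 1) (hp : p = 2 * (q - nu) / (q - 1)).
Let th := (1 - nu) / (q - nu).

Let qnu : 0 < q - nu.
Proof. by have := q1; case/andP: nu01; lra. Qed.

Lemma interpolation_exponent_lt1 : 0 < th < 1.
Proof.
case/andP: nu01 => nu0 nu1; apply/andP; split.
  by rewrite /th divr_gt0 ?subr_gt0//; have := q1; lra.
by rewrite /th ltr_pdivrMr// mul1r; have := q1; lra.
Qed.

(** 1 - th = (q - 1) / (q - nu): the exponent p is chosen precisely for this. *)
Lemma capacity_exponent_conj : p / 2 * (1 - th) = 1.
Proof.
have qn0 : q - nu != 0 by rewrite gt_eqF.
have q10 : q - 1 != 0 by rewrite gt_eqF// subr_gt0.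
by rewrite hp /th; field; rewrite qn0 q10.
Qed.

(** As 0 <= t <= 1, the bound t^(s-2) <= t^(s th) asks for s (1 - th) >= 2, and p (1 - th) = 2 turns
    this into s >= p. *)
Lemma cutoff_interpolation (s : nat) (t w E : R) : (2 < s)%N -> p <= s%:R ->
  0 <= t <= 1 -> 0 <= w -> 0 <= E ->
  t ^+ (s - 2) * w `^ (1 - nu) * E <=
    (t ^+ s * w `^ (q - nu)) `^ th * (E `^ (p / 2)) `^ (1 - th).
Proof.
move=> s2 ps /andP[t0 t1] w0 E0.
have /andP[th0 th1] := interpolation_exponent_lt1.
rewrite -(powRrM E) capacity_exponent_conj powRr1// ler_wpM2r//.
rewrite powRM ?exprn_ge0 ?powR_ge0// -powRrM.
have -> : (q - nu) * th = 1 - nu by rewrite /th mulrC divfK// gt_eqF.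
rewrite ler_wpM2r ?powR_ge0//.
rewrite -!powR_mulrn// -powRrM.
have [->|tn0] := eqVneq t 0.
  by rewrite [leLHS]powR0 ?powR_ge0// pnatr_eq0 subn_eq0 -ltnNge.
apply: ger_powR; first by rewrite lt0r tn0 t0.
rewrite natrB 1?ltnW//.
have sp : 2 <= s%:R * (1 - th).
  apply: (@le_trans _ _ (p * (1 - th))); first by have := capacity_exponent_conj; lra.
  by rewrite ler_wpM2r// subr_ge0 ltW.
lra.
Qed.

End exponents.

Lemma rintegrable_ae_bound d (T : measurableType d) (R : realType)
    (mu : {measure set T -> \bar R}) (f g : T -> R) (M : R) :
  measurable_fun setT f -> measurable_fun setT g -> (forall x, 0 <= f x) ->
  {ae mu, forall x, f x = g x} -> (\int[mu]_x (g x)%:E < M%:E)%E ->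
  rintegrable mu f /\ (\int[mu]_x f x)%R <= M.
Proof.
move=> mf mg f0 fg gM.
have E : (\int[mu]_x (f x)%:E = \int[mu]_x (g x)%:E)%E.
  apply: ae_eq_integral => //; [exact/measurable_EFinP|exact/measurable_EFinP|].
  by apply: ae_imp fg => x -> _.
have fi : rintegrable mu f.
  apply/integrableP; split; first exact/measurable_EFinP.
  under eq_integral do rewrite gee0_abs ?lee_fin//.
  by rewrite E (lt_trans gM)// ltry.
by split=> //; rewrite -lee_fin fine_rintegral// E ltW.
Qed.

Section capacity_competitor.
Context {R : realType} {n : nat} (a : 'rV[R]_n -> 'M[R]_n).
Local Notation mu := (lebesgue_rV R n).
Local Notation T := (lebesgue_rVType R n).
Hypotheses (a_meas : forall i j, lebesgue_measurable_fun setT (fun x => a x i j))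
  (a_bnd : forall i j, [locally [bounded a x i j | x in setT]])
  (a_sym : forall i j x, a x i j = a x j i)
  (a_psd : {ae mu, forall x, forall xi, 0 <= quad_form (a x) xi xi}).

Lemma sqrt_grad_eq0 f (U : set 'rV[R]_n) x : open U -> U x -> (forall y, U y -> f y = f x) ->
  sqrt_grad a f x = 0.
Proof.
move=> oU Ux H; rewrite /sqrt_grad (_ : grad f x = 0) ?mul0mx//.
by apply/rowP => i; rewrite !mxE (partial_eq0 i oU Ux H).
Qed.

(** The capacity is written with the quadratic form of a, the energy estimate with a^{1/2}; the two
    agree where a is positive semidefinite. *)
Lemma competitor_energy phi L rho p M : 0 <= L ->
  (forall x y, `|phi x - phi y| <= L * `|x - y|) ->
  (forall x, phi x != 0 -> `|x| <= rho) ->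
  (\int[mu]_x ((quad_form (a x) (grad phi x) (grad phi x)) `^ (p / 2))%:E < M%:E)%E ->
  rintegrable mu (fun x : T => dot (sqrt_grad a phi x) (sqrt_grad a phi x) `^ (p / 2)) /\
  (\int[mu]_x (dot (sqrt_grad a phi x) (sqrt_grad a phi x) `^ (p / 2)))%R <= M.
Proof.
move=> L0 pL pr.
have pc := lipschitz_continuous_rV L0 pL.
have pdL i := lipschitz_dir_lipschitz i pL L0.
have [mP _ _] := sqrt_grad_bounded a_meas a_bnd a_sym a_psd
  (fun i => partial_measurable pc (pdL i)) (fun i x => partial_le_everywhere x pc (pdL i))
  (fun i x => @partial_support _ _ i phi rho x pr).
have mg : @vmeasurable _ T R n (grad phi).
  move=> i; rewrite (_ : (fun x => _) = partial i phi); first exact: partial_measurable pc (pdL i).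
  by apply/funext => x; rewrite mxE.
have mga : @vmeasurable _ T R n (fun x => grad phi x *m a x).
  exact: vmeasurable_mulmx mg (fun i j => @a_meas i j).
apply: (@rintegrable_ae_bound _ T R mu).
- exact: (@measurableT_comp _ _ _ _ _ _ _ _ _ (measurable_powR (p / 2)) (measurable_dot mP mP)).
- have -> : (fun x : T => quad_form (a x) (grad phi x) (grad phi x) `^ (p / 2)) =
      (fun x : T => dot (grad phi x *m a x) (grad phi x) `^ (p / 2)).
    by apply/funext => x; rewrite quad_formE.
  exact: (@measurableT_comp _ _ _ _ _ _ _ _ _ (measurable_powR (p / 2)) (measurable_dot mga mg)).
- by move=> x; exact: powR_ge0.
- by apply: ae_imp (ae_psd a_sym a_psd) => x px; rewrite /sqrt_grad dot_psd_sqrt.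
Qed.

End capacity_competitor.

Theorem theorem3 (R : realType) (n : nat) (q nu p : R)
    (a : 'rV[R]_n -> 'M[R]_n)
    (hn : (2 <= n)%N) (hq : 1 < q)
    (hnu : 0 < nu < 1) (hnuq : nu < q - 1)
    (hp : p = 2 * (q - nu) / (q - 1))
    (a_meas : forall i j, lebesgue_measurable_fun setT (fun x => a x i j))
    (a_bnd : forall i j, [locally [bounded a x i j | x in setT]])
    (a_sym : forall i j x, a x i j = a x j i)
    (a_psd : {ae lebesgue_rV R n, forall x, forall xi, 0 <= quad_form (a x) xi xi})
    (a_cap : (limf_einf (fun r : R =>
                capacity a p (closed_eball (r / 2)) (~` eball r)) +oo%R < +oo)%E)
    (u v : 'rV[R]_n -> R) (U V : 'rV[R]_n -> 'rV[R]_n)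
    (huv : entire_solution a q u U v V)
    (u_ge_v : {ae lebesgue_rV R n, forall x, v x <= u x}) :
  {ae lebesgue_rV R n, forall x, u x = v x}.
Proof.
have /andP[nu0 nu1] := hnu.
have [M hM] := limf_einf_ltP a_cap.
(* s is an integer above 2 and at least p, as the regularisation limit and the interpolation of the
   cut-off demand. *)
pose k := (Num.truncn p).+1; pose s := k.+2.
have s2 : (2 < s)%N by [].
have ps : p <= s%:R by apply: ltW; apply: lt_le_trans (truncnS_gt p) _; rewrite ler_nat ltnW.
pose th := (1 - nu) / (q - nu).
have th01 : 0 < th < 1 := interpolation_exponent_lt1 hq hnu.
pose z (x : lebesgue_rVType R n) : R := `|u x - v x| `^ (q - nu).
have z0 x : 0 <= z x by exact: powR_ge0.
pose B (N : nat) : set (lebesgue_rVType R n) := cube N%:R.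
have mB N : measurable (B N) by exact: measurable_cube.
have ndB i j : (i <= j)%N -> B i `<=` B j.
  by move=> ij x /= xi; apply: le_trans xi _; rewrite ler_nat.
have covB x : exists N, B N x.
  by exists (Num.truncn `|x : 'rV[R]_n|).+1; apply: ltW; exact: truncnS_gt.
have c0 : 0 < 2 `^ (- q) :> R by exact: powR_gt0.
have D0 : 0 <= s%:R ^+ 2 / (2 * nu) by rewrite divr_ge0 ?sqr_ge0// mulr_ge0// ltW.
suff competitor N : exists f G h : lebesgue_rVType R n -> R,
  [/\ rintegrable (lebesgue_rV R n) (fun x => f x * z x),
    rintegrable (lebesgue_rV R n) G /\ (\int[lebesgue_rV R n]_x G x)%R <= M,
    rintegrable (lebesgue_rV R n) h /\
      2 `^ (- q) * (\int[lebesgue_rV R n]_x (f x * z x))%R <=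
      s%:R ^+ 2 / (2 * nu) * (\int[lebesgue_rV R n]_x h x)%R,
    forall x, [/\ 0 <= f x <= 1, 0 <= G x & B N x -> f x = 1 /\ h x = 0] &
    forall kap x, 0 < kap ->
      h x <= kap `^ (1 - th) * (f x * z x) + kap `^ (- th) * G x].
  apply: ae_imp (two_pass_ae z0 mB ndB covB c0 D0 th01 competitor) => x /powR_eq0_eq0.
  by move=> /normr0_eq0/subr0_eq.
(* The Euclidean ball of radius r / 2 has to contain the sup-norm cube of radius N + 1; the
   Euclidean norm is at most n times the sup norm. *)
have [r rN] := hM (2 * (n%:R * N.+1%:R)).
move=> /ereal_inf_lt[_ [phi [philip phi1 phi0 phi01] <-] capM].
have supp x : phi x != 0 -> `|x| <= r.
  move=> px; apply: le_trans (norm_le_enorm x) _; rewrite leNgt; apply/negP => rx.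
  by move/eqP: px; apply; apply: phi0 => /= /ltW; rewrite leNgt rx.
have [L L0 phiL] := lipschitz_of_compact_support philip phi01 supp.
have r0 : 0 <= r by apply: le_trans (ltW rN); rewrite !mulr_ge0.
have [i1 i2 est] := energy_estimate a_meas a_bnd a_sym a_psd hq nu0 nu1 huv u_ge_v r0
  s2 L0 phiL phi01 supp.
have [iG GM] := competitor_energy a_meas a_bnd a_sym a_psd L0 phiL supp capM.
(* phi is 1 on an open cube strictly larger than [B N], so its gradient vanishes at every point of
   [B N], boundary included. *)
have flat x : `|x| < N.+1%:R -> phi x = 1.
  move=> xN; apply: phi1 => /=; apply: le_trans (enorm_le_norm x) _.
  rewrite ler_pdivlMr// mulrC; apply: le_trans (ltW rN).
  by rewrite ler_wpM2l// ler_wpM2l// ltW.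
exists (fun x => phi x ^+ s), (fun x => dot (sqrt_grad a phi x) (sqrt_grad a phi x) `^ (p / 2)),
  (fun x => phi x ^+ (s - 2) * `|u x - v x| `^ (1 - nu) *
    dot (sqrt_grad a phi x) (sqrt_grad a phi x)); split.
- exact: i1.
- by split; [exact: iG|exact: GM].
- by split; [exact: i2|exact: est].
- move=> x; have [p0 p1] := andP (phi01 x); split.
  + by rewrite exprn_ge0//= exprn_ile1.
  + exact: powR_ge0.
  + move=> Bx; have xN : `|x : 'rV[R]_n| < N.+1%:R by apply: le_lt_trans Bx _; rewrite ltr_nat.
    rewrite (flat x xN) expr1n; split; first by [].
    rewrite (sqrt_grad_eq0 _ (@open_open_cube R n N.+1%:R) xN) ?dot0l ?mulr0//.
    by move=> y yN; rewrite !flat.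
- move=> kap x kap0.
  apply: le_trans (cutoff_interpolation hq hnu hp s2 ps (phi01 x) (normr_ge0 _) (dot_ge0 _)) _.
  apply: interpolation_le; [|exact: powR_ge0|exact: th01|exact: kap0].
  by rewrite mulr_ge0 ?powR_ge0// exprn_ge0//; case/andP: (phi01 x).
Qed.
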